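(* Let $\lambda\in(0,1/2)$, let $\delta\ge2$ be an integer and $N\in\mathbb N$. For every $d\ge -N$, put $\theta=(N+d)/2$, and let $g\in\mathcal L(\lambda)$. There exist a positive $\tau_*\in I(g)$ and a function $C:[0,\tau_*]\to\mathbb R_+=[0,+\infty)$ such that, with $\beta_*=\tau_*/(\delta^\lambda-1)$ and with $\{F_n\}$ denoting, for $\tau\ge 0$, the sequence of solutions of $$\frac{\partial F_n(t,x)}{\partial t}=\tau\left(\Delta+\frac{d}{(x,x)}(x,\nabla)\right)F_n(t,x),\ t\in[0,1],\ x\in\mathbb R^N,\qquad F_n(0,x)=\left[F_{n-1}(1,x\delta^{-(1+\lambda)/2})\right]^\delta,\ n\in\mathbb N,$$ the following hold: (i) for $\tau<\tau_*$, the sequence $\{F_n(t,x)\}_{n\in\mathbb N_0}$ with $F_0(1,x)=C(\tau)g((x,x))$ converges in $\mathcal A^{(N)}_{\beta_*^{-1}}$ to the function $F(t,x)\equiv 1$; (ii) for $\tau=\tau_*$, the sequence $\{F_n(t,x)\}_{n\in\mathbb N_0}$ with $F_0(1,x)=C(\tau_* )g((x,x))$ converges in $\mathcal A^{(N)}_{\beta_*^{-1}}$ to $$F_*(t,x)=\delta^{-\delta\theta\lambda/(\delta-1)}\left[1-t(1-\delta^{-\lambda})\right]^{-\theta}\exp\left(\frac1{\tau_*}\,\frac{1-\delta^{-\lambda}}{1-t(1-\delta^{-\lambda})}\,(x,x)\right).$$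
   Context: $\mathcal L$ (Laguerre entire functions) is the set of entire functions of the form $f(z)=Cz^m\exp(\alpha z)\prod_{j=1}^\infty(1+\gamma_j z)$ with $C\in\mathbb C$, $m\in\mathbb N_0$, $\alpha\ge 0$, $\gamma_j\ge\gamma_{j+1}\ge 0$, $\sum_j\gamma_j<\infty$; $\mathcal L^{(1)}=\{f\in\mathcal L: f(0)=1\}$. For $g$ of this form with $g(0)>0$ put $m_k(g)=\sum_j\gamma_j^k$, and $I(g)=[0,(\delta^\lambda-1)/\alpha]$ if $\alpha>0$, $I(g)=[0,\infty)$ if $\alpha=0$. Let $\epsilon=(1-2\lambda)/4$ and $\vartheta(\lambda)=\dfrac{1-\delta^{-\epsilon}}{\delta^\lambda-\delta^{-\epsilon}}$. The family $\mathcal L(\lambda)$ (depending also on $\theta$) consists of the non-constant $g\in\mathcal L^{(1)}$ such that $$\frac{m_2(g)}{[\alpha+m_1(g)]^2}\le\frac{\delta^{1/2}}{\theta+1}\vartheta(\lambda),\qquad \frac{m_2(g)}{[m_1(g)]^2}\le\frac{\delta^{1/2}}{\theta+1},$$ where the second condition is regarded as satisfied when $m_1(g)=0$ (i.e. $g(z)=e^{\alpha z}$). $(\cdot,\cdot)$ and $|\cdot|$ are the scalar product and Euclidean norm of $\mathbb R^N$; $\Delta,\nabla$ the Laplacian and gradient in $\mathbb R^N$. For $b>0$ and an analytic function $F:\mathbb R^N\to\mathbb C$ put $\|F\|_{b,N}=\sup_{x\in\mathbb R^N}|F(x)|\exp(-b|x|^2)$. For $a\ge0$, $\mathcal A_a^{(N)}$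 is the set of analytic $F:\mathbb R^N\to\mathbb C$ with $\|F\|_{b,N}<\infty$ for all $b>a$, with the topology generated by the norms $\|\cdot\|_{b,N}$, $b>a$.
   Formalization: The equation is taken with coefficient τ/4 instead of τ before (Δ + d/(x,x)(x,∇)), since with τ as printed the stated F_* does not solve the equation and (ii) fails, for example for g(z)=exp(αz). *)

(* Defs.v *)
From HB Require Import structures.
From mathcomp Require Import all_boot all_order all_algebra.
From mathcomp Require Import complex.
From mathcomp Require Import all_classical all_reals all_analysis.

Set Implicit Arguments.
Unset Strict Implicit.
Unset Printing Implicit Defensive.

Import Order.TTheory GRing.Theory Num.Theory.
Import numFieldNormedType.Exports.

Local Open Scope classical_set_scope.
Local Open Scope ring_scope.
Local Open Scope complex_scope.

(* [R[i]^o] is [R[i]] with the topology of its modulus: the library attaches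
   topologies to the regular module over a numFieldType. *)

Definition cmod {R : realType} (z : R[i]) : R := complex.Re `|z|.

Definition cexp {R : realType} (z : R[i]) : R[i] :=
  (expR (complex.Re z))%:C * (cos (complex.Im z) +i* sin (complex.Im z)).

Definition laguerre_rep {R : realType} (c : R[i]) (m : nat) (alpha : R)
    (gamma : nat -> R) (f : R[i] -> R[i]) : Prop :=
  [/\ 0 <= alpha,
      (forall j, 0 <= gamma j.+1 <= gamma j),
      cvgn (series gamma) &
      forall z : R[i],
        (fun n : nat => (c * z ^+ m * cexp (alpha%:C * z)
           * \prod_(j < n) (1 + (gamma j)%:C * z) : R[i]^o)) @ \oo
        --> (f z : R[i]^o)].

Definition moment {R : realType} (gamma : nat -> R) (k : nat) : R :=
  limn (series (fun j => gamma j ^+ k)).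

Definition interval_I {R : realType} (delta : nat) (lambda alpha : R) : set R :=
  [set tau | 0 <= tau /\
    (0 < alpha -> tau <= (delta%:R `^ lambda - 1) / alpha)].

Definition vartheta {R : realType} (delta : nat) (lambda : R) : R :=
  let eps := (1 - 2 * lambda) / 4 in
  (1 - delta%:R `^ (- eps)) / (delta%:R `^ lambda - delta%:R `^ (- eps)).

(* [alpha] and [gamma] are determined by [g]; they are kept as parameters
   because the moments of [gamma] and [interval_I] refer to them. *)
Definition laguerre_family {R : realType} (delta : nat) (lambda theta : R)
    (g : R[i] -> R[i]) (alpha : R) (gamma : nat -> R) : Prop :=
  [/\ exists c m, laguerre_rep c m alpha gamma g,
      g 0 = 1,
      exists z w, g z <> g w,
      moment gamma 2 / (alpha + moment gamma 1) ^+ 2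
        <= delta%:R `^ (1 / 2) / (theta + 1) * vartheta delta lambda &
      moment gamma 1 = 0 \/
      moment gamma 2 / (moment gamma 1) ^+ 2
        <= delta%:R `^ (1 / 2) / (theta + 1)].

(* The library norm of ['rV_N] is the sup norm, hence an explicit Euclidean
   scalar product. *)
Definition dotp {R : realType} {N : nat} (x y : 'rV[R]_N) : R :=
  \sum_(i < N) x ord0 i * y ord0 i.

(* Real analyticity: around every point, the sum of an absolutely convergent
   multivariate power series.  The multi-indices with all entries < n are the
   functions ['I_N -> 'I_n]. *)
Definition analytic {R : realType} {N : nat} (F : 'rV[R]_N -> R[i]) : Prop :=
  forall x : 'rV[R]_N,
  exists (r M : R) (c : {ffun 'I_N -> nat} -> R[i]),
  let coef n (k : {ffun 'I_N -> 'I_n}) := c [ffun i => nat_of_ord (k i)] in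
  [/\ 0 < r,
      (forall n, \sum_(k : {ffun 'I_N -> 'I_n})
         cmod (coef n k) * r ^+ (\sum_(i < N) k i)%N <= M) &
      forall h : 'rV[R]_N, (forall i, `|h ord0 i| < r) ->
        (fun n : nat => (\sum_(k : {ffun 'I_N -> 'I_n})
           coef n k * (\prod_(i < N) h ord0 i ^+ k i)%:C : R[i]^o)) @ \oo
        --> (F (x + h) : R[i]^o)].

Definition partial {R : realType} {N : nat} (i : 'I_N) (F : 'rV[R]_N -> R[i])
    (x : 'rV[R]_N) : R[i] :=
  ('D_(delta_mx ord0 i) (fun y => complex.Re (F y)) x)
  +i* ('D_(delta_mx ord0 i) (fun y => complex.Im (F y)) x).

Definition laplacian {R : realType} {N : nat} (F : 'rV[R]_N -> R[i])
    (x : 'rV[R]_N) : R[i] :=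
  \sum_(i < N) partial i (partial i F) x.

Definition euler {R : realType} {N : nat} (F : 'rV[R]_N -> R[i])
    (x : 'rV[R]_N) : R[i] :=
  \sum_(i < N) (x ord0 i)%:C * partial i F x.

Definition wnorm {R : realType} {N : nat} (b : R) (F : 'rV[R]_N -> R[i]) :
    \bar R :=
  ereal_sup (range (fun x => (cmod (F x) * expR (- (b * dotp x x)))%:E)).

Definition in_A {R : realType} {N : nat} (a : R) (F : 'rV[R]_N -> R[i]) : Prop :=
  analytic F /\ forall b, a < b -> (wnorm b F < +oo)%E.

Definition cvg_A {R : realType} {N : nat} (a : R)
    (F : nat -> 'rV[R]_N -> R[i]) (L : 'rV[R]_N -> R[i]) : Prop :=
  [/\ forall n, in_A a (F n), in_A a L &
      forall b, a < b ->
        (fun n => wnorm b (fun x => F n x - L x)) @ \oo --> (0 : \bar R)%E].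

(* One-sided at the endpoints of [0, 1]. *)
Definition is_time_derive {R : realType} (u : R -> R[i]) (t : R) (v : R[i]) :
    Prop :=
  (fun s : R => (((s - t)^-1)%:C * (u s - u t) : R[i]^o))
    @ within `[0, 1]%classic (t^') --> (v : R[i]^o).

(* Classical solutions on [0, 1] x R^N: analytic in x, C^1 in t, of at most
   Gaussian growth uniformly in t (Tychonoff's uniqueness class).  The drift is
   singular at x = 0, where the equation only holds in the limit.
   On radial functions
     (Delta + d/(x,x) (x,nabla)) f((x,x)) = 4 (theta f' + z f'')(z), z = (x,x),
   with theta = (N + d)/2; the factor 1/4 makes the equation
   df/dt = tau (theta f' + z f''), the one which is solved by
     (1 - s t)^(-theta) exp (tau^-1 s/(1 - s t) (x,x)). *)
Definition is_solution {R : realType} {N : nat} (d tau : R)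
    (u : R -> 'rV[R]_N -> R[i]) : Prop :=
  let slab := [set p : R * 'rV[R]_N | 0 <= p.1 <= 1] in
  [/\ (forall t, 0 <= t <= 1 -> analytic (u t)),
      (exists b K : R, forall t, 0 <= t <= 1 -> (wnorm b (u t) <= K%:E)%E),
      {within slab, continuous (fun p => (u p.1 p.2 : R[i]^o))} &
      exists v : R -> 'rV[R]_N -> R[i],
      [/\ {within slab, continuous (fun p => (v p.1 p.2 : R[i]^o))},
          (forall t x, 0 <= t <= 1 -> is_time_derive (u ^~ x) t (v t x)) &
          forall t x, 0 <= t <= 1 -> x != 0 ->
            v t x = (tau / 4)%:C *
              (laplacian (u t) x + (d / dotp x x)%:C * euler (u t) x)]].

(* [F 0 t] is only meaningful for t = 1. *)
Definition solution_sequence {R : realType} {N : nat} (delta : nat)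
    (lambda d tau : R) (F0 : 'rV[R]_N -> R[i])
    (F : nat -> R -> 'rV[R]_N -> R[i]) : Prop :=
  (forall x, F 0%N 1 x = F0 x) /\
  forall n, is_solution d tau (F n.+1) /\
    forall x, F n.+1 0 x
      = (F n 1 ((delta%:R `^ (- ((1 + lambda) / 2))) *: x)) ^+ delta.

Definition sequence_cvg {R : realType} {N : nat} (a : R)
    (F : nat -> R -> 'rV[R]_N -> R[i]) (L : R -> 'rV[R]_N -> R[i]) : Prop :=
  in_A a (F 0%N 1) /\
  forall t, 0 <= t <= 1 -> cvg_A a (fun n => F n.+1 t) (L t).

Definition F_star {R : realType} {N : nat} (delta : nat)
    (lambda theta taustar t : R) (x : 'rV[R]_N) : R[i] :=
  let s := 1 - delta%:R `^ (- lambda) in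
  (delta%:R `^ (- (delta%:R * theta * lambda / (delta%:R - 1)))
   * (1 - t * s) `^ (- theta)
   * expR (1 / taustar * (s / (1 - t * s)) * dotp x x))%:C.

(* Main.v *)
(* Write f(z) = sum_k b_k z^k/k!.  On radial functions the equation becomes
   df/dt = tau D f with D = theta d/dz + z d^2/dz^2, and exp(s D) acts on the
   coefficients b_k >= 0 by an explicit series.  For s >= 0 the operator 1 + s D
   preserves polynomials with only nonpositive zeros (Gauss-Lucas), so their
   coefficientwise limits are stable under the renormalization step
   b |-> exp(tau D) b^delta(delta^-(1+lambda) z).

   Put p = b_1/b_0 and q = p^2 - b_2/b_0 >= 0.  Along exp(s D) they satisfy
   p' = p^2 - (theta+1) q and q' <= 4 p q, which bounds one step: x = tau p is
   essentially sent to (x/L)/(1 - x/L), L = delta^lambda, with repelling fixed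
   point L - 1, while c = (theta+1) tau^2 q does not increase as long as x stays
   below L - delta^-eps.  The bound on m_2 is exactly what forces an orbit which
   reaches L - delta^-eps to go above it.  The critical tau is the infimum of the
   parameters whose orbit does not leave the band [L-1, L-delta^-eps] from below;
   there c tends to 0 geometrically and x to L - 1, whereas p tends to 0 for
   smaller tau.  In both cases q -> 0 makes the normalized coefficients converge
   to those of an exponential, and C(tau) is the exponential of the bounded
   solution of s_(n+1) = delta s_n + r_n, r_n the logarithm of the mass created
   at step n.

   Solutions are unique by the maximum principle with a Gaussian barrier on short
   time intervals.  At a maximum located at x = 0 the singular equation gives, in
   the limit along the i-th axis, v(0) = tau/4 (tr H + d H_ii); averaging over i
   yields v(0) = tau/4 (1 + d/N) tr H, with N + d >= 0. *)

Require Import Defs.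
From mathcomp Require Import all_boot all_order all_algebra.
From mathcomp Require Import complex.
From mathcomp Require Import all_classical all_reals all_analysis.
From mathcomp Require Import ring lra.

Import Order.TTheory GRing.Theory Num.Theory.
Import numFieldNormedType.Exports.

Local Open Scope classical_set_scope.
Local Open Scope ring_scope.
Local Open Scope complex_scope.

Set Implicit Arguments.
Unset Strict Implicit.
Unset Printing Implicit Defensive.

(** * Polynomials with nonpositive zeros *)

Section HyperbolicPolynomials.
Variable R : rcfType.
Implicit Types (p : {poly R}) (s : seq R) (z : R[i]).

(** The constants rest on the identity delta = E^4 L^2 with E = delta^eps, that is 4 eps + 2 lambda
    = 1. One step multiplies q by at most (1 - x/L)^-4 / (E^4 L^4), and for x < L this factor is at
    most 1 exactly when x <= L - E^-1: hence the upper edge of the band. On that edge the lower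
    bound for the next x returns L - E^-1 itself when c = E^2 L (1 - E^-1) (L - E^-1), and vartheta
    is the constant for which the bound on m_2 says that c is no larger. Equality is allowed there,
    so non-strict estimates would let an orbit rest on the edge; a strict form of the bound on p,
    obtained from a rigidity argument, makes leaving the band an open condition on either side.
    Parameters range over [0, T], where the exponential type (L - 1)/T is fixed by a step of length
    T, so every orbit stays in one class of entire functions. If alpha > 0, T is the right end of
    I(g): there exp(alpha z) is fixed up to a factor and, as a minorant, keeps x from falling below
    L - 1. If alpha = 0 every T is admissible, and a large one starts the orbit above the band. *)

Definition hyperbolic p := exists (c : R) s,
  [/\ 0 < c, all (fun x => 0 <= x) s & p = c *: \prod_(x <- s) (1 + x *: 'X)].

Definition logder s z : R[i] := \sum_(x <- s) x%:C / (1 + x%:C * z).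

Notation cpoly p := (map_poly (real_complex R) p).

Lemma cpoly_conj p z : (cpoly p).[z^*] = ((cpoly p).[z])^*.
Proof.
rewrite -(horner_map (conjc : {rmorphism R[i] -> R[i]})) /=; congr (_.[_]).
rewrite -map_poly_comp; apply: eq_map_poly => x /=.
by rewrite oppr0.
Qed.

Lemma cpoly_real p (x : R) : (cpoly p).[x%:C] = (p.[x])%:C.
Proof. exact: horner_map. Qed.

Lemma hyperbolic_of_roots p : 0 < p.[0] ->
  (forall z, root (cpoly p) z -> complex.Im z = 0 /\ complex.Re z < 0) ->
  hyperbolic p.
Proof.
elim: {p}(size p) {-2}p (erefl (size p)) => [|n IH] p sp p0 rp.
  by move/eqP: sp p0; rewrite size_poly_eq0 => /eqP ->; rewrite horner0 ltxx.
have [n0|n0] := posnP n.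
  move/eqP: sp; rewrite n0 => /size_poly1P [c c0 pE].
  exists c, [::]; split => //; first by rewrite pE hornerC in p0.
  by rewrite big_nil pE alg_polyC.
have : size (cpoly p) != 1 by rewrite size_map_poly sp eqSS -lt0n.
move=> /closed_rootP [z rz].
have [iz rez] := rp _ rz.
have zE : z = (complex.Re z)%:C by case: (z) iz => a b /= ->.
move: (complex.Re z) rez zE => x x0 zE.
have rx : root p x.
  move: rz; rewrite zE /root cpoly_real => /eqP[] h.
  by apply/eqP.
move/factor_theorem: rx => [q pE].
have p0E : p.[0] = q.[0] * - x by rewrite pE hornerM !hornerE.
have q0 : 0 < q.[0].
  by move: p0; rewrite p0E pmulr_lgt0 // oppr_gt0.
have q_n0 : q != 0 by apply: contraTneq q0 => ->; rewrite horner0 ltxx.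
have [||c [s [c0 s0 qE]]] := IH q _ q0.
- by move: sp; rewrite pE size_Mmonic ?monicXsubC // size_XsubC addn2 /= => -[].
- move=> w rw; apply: rp; rewrite pE rmorphM /= rootM rw //.
exists (c * - x), (- x^-1 :: s); split.
- by rewrite mulr_gt0 // oppr_gt0.
- by rewrite /= s0 oppr_ge0 invr_le0 ltW.
- rewrite big_cons pE qE; have -> : 'X - x%:P = (- x) *: (1 + (- x^-1) *: 'X).
    rewrite scalerDr scalerA mulrNN divff ?lt_eqF // scale1r addrC.
    by rewrite scaleNr alg_polyC.
  by rewrite -scalerAl -scalerAr scalerA [X in _ *: X]mulrC.
Qed.

Lemma Im_divc x z : 0 <= x -> 0 < complex.Im z ->
  complex.Im (x%:C / (1 + x%:C * z)) =
  - (x ^+ 2 * complex.Im z / ((1 + x * complex.Re z) ^+ 2 + (x * complex.Im z) ^+ 2)).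
Proof.
case: z => a b /= x0 b0; rewrite !mul0r subr0 addr0 !add0r; field.
have [->|xn0] := eqVneq x 0; first by rewrite !mul0r addr0 !expr0n /= expr1n addr0 oner_eq0.
rewrite gt_eqF // ltr_wpDl ?sqr_ge0 // exprn_even_gt0 // mulf_neq0 // gt_eqF //.
Qed.

(** For x >= 0 and z in the upper half-plane, x / (1 + x z) lies in the closed lower half-plane. *)
Lemma Im_logder_le0 s z : all (fun x => 0 <= x) s -> 0 < complex.Im z ->
  complex.Im (logder s z) <= 0.
Proof.
move=> s0 z0; elim: s s0 => [|x s IH] /=; first by rewrite /logder big_nil.
move=> /andP[x0 s0]; rewrite /logder big_cons.
rewrite (raddfD (@complex.Im R : {additive Rcomplex R -> R})) /=.
rewrite -oppr_ge0 opprD addr_ge0 // oppr_ge0; last exact: IH.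
rewrite Im_divc // oppr_le0 divr_ge0 ?addr_ge0 ?sqr_ge0 //.
by rewrite mulr_ge0 ?sqr_ge0 // ltW.
Qed.

Lemma Im_logder_lt0 s z : all (fun x => 0 <= x) s -> has (fun x => 0 < x) s ->
  0 < complex.Im z -> complex.Im (logder s z) < 0.
Proof.
move=> s0 hs z0; elim: s s0 hs => [|x s IH] //=.
move=> /andP[x0 s0] /orP hs; rewrite /logder big_cons.
rewrite (raddfD (@complex.Im R : {additive Rcomplex R -> R})) /=.
have h : complex.Im (logder s z) <= 0 by apply: Im_logder_le0.
have h' : complex.Im (x%:C / (1 + x%:C * z)) <= 0.
  rewrite Im_divc // oppr_le0 divr_ge0 ?addr_ge0 ?sqr_ge0 //.
  by rewrite mulr_ge0 ?sqr_ge0 // ltW.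
case: hs => [x1|hs]; last by rewrite ltr_wnDl //; apply: IH.
rewrite ltr_wnDr // Im_divc // oppr_lt0 divr_gt0 //.
  by rewrite mulr_gt0 // exprn_gt0.
by rewrite ltr_wpDl ?sqr_ge0 // exprn_gt0 // mulr_gt0.
Qed.

(** Each summand x z / (1 + x z) = 1 - 1 / (1 + x z) has nonnegative imaginary part. *)
Lemma Im_mul_logder_ge0 s z : all (fun x => 0 <= x) s -> 0 < complex.Im z ->
  0 <= complex.Im (z * logder s z).
Proof.
move=> s0 z0; elim: s s0 => [|x s IH] /=.
  by rewrite /logder big_nil mulr0.
move=> /andP[x0 s0]; rewrite /logder big_cons mulrDr.
rewrite (raddfD (@complex.Im R : {additive Rcomplex R -> R})) /=.
apply: addr_ge0 => /=; last exact: IH.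
have -> : complex.Im (z * (x%:C / (1 + x%:C * z))) = 
   x * complex.Im z / ((1 + x * complex.Re z) ^+ 2 + (x * complex.Im z) ^+ 2).
  case: z z0 {IH} => a b /= b0; rewrite !mul0r subr0 addr0 !add0r; field.
  have [->|xn0] := eqVneq x 0.
    by rewrite !mul0r addr0 !expr0n /= expr1n addr0 oner_eq0.
  by rewrite gt_eqF // ltr_wpDl ?sqr_ge0 // exprn_even_gt0 // mulf_neq0 // gt_eqF.
by rewrite divr_ge0 ?addr_ge0 ?sqr_ge0 ?mulr_ge0 // ltW.
Qed.

Lemma linear_neq0 x z : 0 <= x -> 0 < complex.Im z -> 1 + x%:C * z != 0.
Proof.
case: z => a b /= x0 b0; rewrite eq_complex /= !mul0r subr0 addr0 add0r.
have [->|xn0] := eqVneq x 0; first by rewrite !mul0r addr0 oner_eq0.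
by rewrite mulf_eq0 (negbTE xn0) (gt_eqF b0) andbF.
Qed.

Section Product.
Variables (c : R) (s : seq R).
Hypotheses (c0 : 0 < c) (s0 : all (fun x => 0 <= x) s).
Let p := c *: \prod_(x <- s) (1 + x *: 'X).

Lemma hornerc_product z :
  (cpoly p).[z] = c%:C * \prod_(x <- s) (1 + x%:C * z).
Proof.
rewrite /p map_polyZ /= hornerZ; congr (_ * _).
rewrite rmorph_prod /= horner_prod; apply: eq_bigr => x _.
by rewrite rmorphD /= rmorph1 map_polyZ /= map_polyX !hornerE.
Qed.

Lemma hornerc_product_neq0 z : 0 < complex.Im z -> (cpoly p).[z] != 0.
Proof.
move=> z0; rewrite hornerc_product mulf_neq0 //.
  by rewrite eq_complex /= gt_eqF.
rewrite prodf_seq_neq0; apply/allP => x xs /=.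
by apply: linear_neq0 => //; move/allP: s0; apply.
Qed.

Lemma deriv_product (A : fieldType) (t : seq A) (z : A) :
  (forall x, x \in t -> 1 + x * z != 0) ->
  ((\prod_(x <- t) (1 + x *: 'X))^`()).[z] =
  (\prod_(x <- t) (1 + x * z)) * \sum_(x <- t) x / (1 + x * z).
Proof.
elim: t => [|x t IH] h; first by rewrite !big_nil derivC horner0 mulr0.
rewrite !big_cons derivM hornerD !hornerM IH; last first.
  by move=> y yt; apply: h; rewrite inE yt orbT.
rewrite horner_prod derivD derivC derivZ derivX !hornerE.
have hx : 1 + x * z != 0 by rewrite h ?mem_head.
rewrite (_ : \prod_(i <- t) _ = \prod_(i <- t) (1 + i * z)); last first.
  by apply: eq_bigr => y _; rewrite !hornerE.
move: (\prod_(i <- t) _) (\sum_(i <- t) _) => A1 A2 /=.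
by field.
Qed.

Lemma derivc_product z : 0 < complex.Im z ->
  (cpoly p^`()).[z] = (cpoly p).[z] * logder s z.
Proof.
move=> z0; rewrite -deriv_map hornerc_product /p map_polyZ derivZ hornerZ /=.
rewrite -mulrA; congr (_ * _).
have -> : map_poly (real_complex R) (\prod_(x <- s) (1 + x *: 'X)) =
  \prod_(y <- [seq x%:C | x <- s]) (1 + y *: 'X).
  rewrite rmorph_prod /= big_map; apply: eq_bigr => x _.
  by rewrite rmorphD /= rmorph1 map_polyZ /= map_polyX.
rewrite deriv_product ?big_map //.
move=> _ /mapP[x xs ->]; apply: linear_neq0 => //.
by move/allP: s0; apply.
Qed.

Lemma horner_product_gt0 (x : R) : 0 <= x -> 0 < p.[x].
Proof.
move=> x0; rewrite /p hornerZ mulr_gt0 // horner_prod big_seq prodr_gt0 //.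
move=> y ys; rewrite !hornerE ltr_wpDr // mulr_ge0 //.
by move/allP: s0; apply.
Qed.

Lemma deriv_product_real (x : R) : 0 <= x ->
  p^`().[x] = p.[x] * \sum_(y <- s) y / (1 + y * x).
Proof.
move=> x0; rewrite /p derivZ !hornerZ -mulrA deriv_product.
  congr (_ * (_ * _)); rewrite horner_prod; apply: eq_bigr => y _.
  by rewrite !hornerE.
move=> y ys; rewrite gt_eqF // ltr_wpDr // mulr_ge0 //.
by move/allP: s0; apply.
Qed.

Lemma deriv_product_ge0 (x : R) : 0 <= x -> 0 <= p^`().[x].
Proof.
move=> x0; rewrite deriv_product_real // mulr_ge0 //.
  by rewrite ltW // horner_product_gt0.
rewrite big_seq; apply: sumr_ge0 => y ys.
have y0 : 0 <= y by move/allP: s0; apply.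
by rewrite divr_ge0 // addr_ge0 // mulr_ge0.
Qed.

Lemma deriv_product_gt0 (x : R) : 0 <= x -> has (fun y => 0 < y) s ->
  0 < p^`().[x].
Proof.
move=> x0 hs; rewrite deriv_product_real // mulr_gt0 //.
  by rewrite horner_product_gt0.
elim: (s) hs s0 => [|y t IH] //= hs /andP[y0 t0].
rewrite big_cons.
have h : 0 <= y / (1 + y * x) by rewrite divr_ge0 // addr_ge0 // mulr_ge0.
case/orP: hs => hs; last by rewrite ltr_wpDl // IH.
rewrite ltr_wpDr // ?divr_gt0 // ?ltr_wpDr ?mulr_ge0 //.
rewrite big_seq; apply: sumr_ge0 => w wt.
have w0 : 0 <= w by move/allP: t0; apply.
by rewrite divr_ge0 // addr_ge0 // mulr_ge0.
Qed.

End Product.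

(** Real coefficients make the zeros symmetric under conjugation, so a zero-free upper half-plane
    and positivity on [0, oo) leave only negative zeros. *)
Lemma root_upper_half p :
  (forall z, 0 < complex.Im z -> (cpoly p).[z] != 0) ->
  (forall x, 0 <= x -> 0 < p.[x]) -> hyperbolic p.
Proof.
move=> hu hr; apply: hyperbolic_of_roots; first exact: hr.
move=> z rz; have [z0|z0|z0] := ltgtP (complex.Im z) 0.
- have : 0 < complex.Im (z^*) by case: (z) z0 => a b /=; rewrite oppr_gt0.
  move=> /hu; rewrite cpoly_conj.
  by move/rootP: rz => ->; rewrite conjc0 eqxx.
- by move/hu: z0; move/rootP: rz => ->; rewrite eqxx.
split=> //; rewrite ltNge; apply/negP => /hr.
have zE : z = (complex.Re z)%:C by case: (z) z0 => a b /= ->.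
move: rz; rewrite zE /root cpoly_real /= => /eqP[] ->.
by rewrite ltxx.
Qed.

(** [p'] is [p] times its logarithmic derivative, whose imaginary part is negative on the upper
    half-plane unless [p] is constant. *)
Lemma hyperbolic_deriv p : hyperbolic p -> p^`() = 0 \/ hyperbolic p^`().
Proof.
move=> [c [s [c0 s0 pE]]].
have [hs|hs] := boolP (has (fun x => 0 < x) s); last first.
  left; rewrite pE derivZ; suff -> : \prod_(x <- s) (1 + x *: 'X) = 1 :> {poly R}.
    by rewrite derivC scaler0.
  rewrite big_seq big1 // => x xs; suff -> : x = 0 by rewrite scale0r addr0.
  move/allP: s0 => /(_ _ xs) x0; move/hasPn: hs => /(_ _ xs) /=.
  by rewrite -leNgt => x1; apply/eqP; rewrite eq_le x0 x1.
right; apply: root_upper_half => [z z0|x x0].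
  rewrite pE derivc_product // mulf_neq0 //; first exact: hornerc_product_neq0.
  by apply: contraTneq (Im_logder_lt0 s0 hs z0) => -> /=; rewrite ltxx.
by rewrite pE; apply: deriv_product_gt0.
Qed.

Definition heatop (theta : R) p := theta *: p^`() + 'X * p^`()^`().

(* For [0 < Im z] and [h = p + s (theta p' + z p'')], write
   [h / p' = p / p' + s (theta + z p'' / p')]: by Gauss-Lucas [p'] is hyperbolic
   as well, and both [p / p'] and [z p'' / p'] have nonnegative imaginary part. *)
Lemma hyperbolic_heat_step (theta s : R) p : 0 <= theta -> 0 <= s ->
  hyperbolic p -> hyperbolic (p + s *: heatop theta p).
Proof.
move=> th0 s0 hp; have := hyperbolic_deriv hp.
case: hp => c [t [c0 t0 pE]] [dp0|[c' [t' [c'0 t'0 pE']]]].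
  rewrite /heatop dp0 derivC scaler0 mulr0 addr0 scaler0 addr0.
  by exists c, t.
apply: root_upper_half => [z z0|x x0]; last first.
  rewrite /heatop !hornerE ltr_wpDr //; last first.
    by rewrite pE; apply: horner_product_gt0.
  rewrite mulr_ge0 // addr_ge0 // mulr_ge0 //.
    by rewrite pE; apply: deriv_product_ge0.
  by rewrite pE'; apply: deriv_product_ge0.
have -> : (cpoly (p + s *: heatop theta p)).[z] =
   (cpoly p).[z] + s%:C * (theta%:C * (cpoly p^`()).[z] + z * (cpoly p^`()^`()).[z]).
  rewrite /heatop !rmorphD /= !map_polyZ !rmorphD /= rmorphM /= map_polyX map_polyZ.
  by rewrite !hornerE.
have d2 : (cpoly p^`()^`()).[z] = (cpoly p^`()).[z] * logder t' z.
  by rewrite pE' derivc_product.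
have d1 : (cpoly p^`()).[z] = (cpoly p).[z] * logder t z.
  by rewrite pE derivc_product.
have q0 : (cpoly p^`()).[z] != 0 by rewrite pE'; apply: hornerc_product_neq0.
have p0 : (cpoly p).[z] != 0 by rewrite pE; apply: hornerc_product_neq0.
have L0 : logder t z != 0 by move: q0; rewrite d1 mulf_eq0 negb_or => /andP[].
have IL : complex.Im (logder t z) < 0.
  apply: Im_logder_lt0 => //; apply: contraR q0 => /hasPn ht.
  suff -> : p^`() = 0 by rewrite rmorph0 horner0.
  rewrite pE derivZ; suff -> : \prod_(x <- t) (1 + x *: 'X) = 1 :> {poly R}.
    by rewrite derivC scaler0.
  rewrite big_seq big1 // => x xs; suff -> : x = 0 by rewrite scale0r addr0.
  move/allP: t0 => /(_ _ xs) x0; move: (ht _ xs) => /=.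
  by rewrite -leNgt => x1; apply/eqP; rewrite eq_le x0 x1.
rewrite d2.
have -> : (cpoly p).[z] = (cpoly p^`()).[z] / logder t z by rewrite d1 mulfK.
rewrite [X in _ + X](_ : _ = (cpoly p^`()).[z] * (s%:C * (theta%:C + z * logder t' z))); last by ring.
rewrite -mulrDr mulf_neq0 //.
suff : 0 < complex.Im ((logder t z)^-1 + s%:C * (theta%:C + z * logder t' z)).
  by move=> h; apply: contraTneq h => -> /=; rewrite ltxx.
have hI := Im_mul_logder_ge0 t'0 z0.
rewrite (raddfD (@complex.Im R : {additive Rcomplex R -> R})) /=.
apply: ltr_wpDr.
  case: (z * logder t' z) hI => a b /= hI.
  by rewrite mul0r addr0 add0r mulr_ge0.
case: (logder t z) IL => a b /= IL.
rewrite oppr_gt0 pmulr_llt0 // invr_gt0 ltr_wpDl ?sqr_ge0 //.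
by rewrite exprn_even_gt0 //= lt_eqF.
Qed.

End HyperbolicPolynomials.

(** * Coefficientwise limits of such polynomials *)

Section LaguerreClass.
Variable R : realType.
Implicit Types (b : nat -> R) (p : {poly R}).

Definition egfc p k : R := k`!%:R * p`_k.

(** Multiplication by 1 + x z on the coefficients of z^k / k!; at [k = 0] the default [b 0.-1 = b 0]
    is killed by the factor [k]. *)
Definition mul1 (x : R) b k := b k + k%:R * x * b k.-1.

(** For b 0 = 1 and b k = k! e_k, with e_k the elementary symmetric functions of the parameters, the
    last two conditions are Newton's identities truncated after the first and after the second power
    sum, b 1 and b 1 ^ 2 - b 2. They bound each coefficient from above and from below by the
    previous ones. *)
Definition lpineq b :=
  [/\ 0 < b 0%N, forall k, 0 <= b k,
      forall k, b 0%N * b k.+1 <= b 1%N * b k &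
      forall k, b 0%N * b 1%N * b k.+1 <= b 0%N ^+ 2 * b k.+2
                 + k.+1%:R * (b 1%N ^+ 2 - b 0%N * b 2%N) * b k].

Lemma egfc_mul1 p x k : egfc ((1 + x *: 'X) * p) k = mul1 x (egfc p) k.
Proof.
rewrite /egfc /mul1 mulrDl mul1r coefD -scalerAl coefZ coefXM.
case: k => [|k] /=; first by rewrite mulr0 addr0 !mul0r addr0.
rewrite factS natrM; ring.
Qed.

Lemma lpineq_mul1 b x : 0 <= x -> b 0%N = 1 -> lpineq b -> lpineq (mul1 x b).
Proof.
move=> x0 b1 [b0 bk h1 h2]; rewrite b1 in h1 h2.
have E0 : mul1 x b 0 = 1 by rewrite /mul1 b1 !mul0r addr0.
have E1 : mul1 x b 1 = b 1%N + x by rewrite /mul1 /= b1 mul1r mulr1.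
have E2 : mul1 x b 2 = b 2%N + 2 * x * b 1%N by [].
have q0 : 0 <= b 1%N ^+ 2 - b 2%N.
  by have := h1 1%N; rewrite mul1r subr_ge0 expr2.
rewrite /lpineq E0 E1 E2; split=> //.
- by move=> k; rewrite addr_ge0 // !mulr_ge0.
- case=> [|k]; first by rewrite E0 E1; lra.
  rewrite /mul1 /=.
  have := h1 k.+1; have := h1 k; have := bk k.
  have k0 : 0 <= k.+1%:R :> R by [].
  have -> : k.+2%:R = k.+1%:R + 1 :> R by rewrite -[k.+2]addn1 natrD.
  move: (k.+1%:R : R) k0 => c c0 bk0 l1 l2.
  (* The difference of the two sides is that of the old inequality at [k.+1], plus [c * x] times
     that at [k], plus [c * x ^+ 2 * b k]. *)
  have := mulr_ge0 (mulr_ge0 c0 (mulr_ge0 x0 x0)) bk0.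
  have : 0 <= c * x * (b 1%N * b k - b k.+1) by rewrite !mulr_ge0 // subr_ge0; lra.
  lra.
case=> [|k]; first by rewrite E0 E1 E2 /=; lra.
rewrite /mul1 /=.
have := h2 k.+1; have := h2 k; have := bk k.
have k0 : 0 <= k.+1%:R :> R by [].
have -> : k.+3%:R = k.+1%:R + 2 :> R by rewrite -[k.+3]addn2 natrD.
have -> : k.+2%:R = k.+1%:R + 1 :> R by rewrite -[k.+2]addn1 natrD.
move: (k.+1%:R : R) k0 => c c0 bk0 l1 l2.
have := mulr_ge0 (mulr_ge0 (mulr_ge0 c0 (addr_ge0 c0 ler01)) (mulr_ge0 x0 (mulr_ge0 x0 x0))) bk0.
have : 0 <= (c + 1) * x * (b k.+2 + c * (b 1%N ^+ 2 - b 2%N) * b k - b 1%N * b k.+1).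
  apply: mulr_ge0; last by rewrite subr_ge0; lra.
  by rewrite mulr_ge0 // addr_ge0.
lra.
Qed.

Lemma lpineq_scale b c : 0 < c -> lpineq b -> lpineq (fun k => c * b k).
Proof.
move=> c0 [b0 bk h1 h2]; split.
- by rewrite mulr_gt0.
- by move=> k; rewrite mulr_ge0 // ltW.
- move=> k; rewrite mulrACA [leRHS]mulrACA ler_pM2l ?mulr_gt0 //.
- move=> k; rewrite -subr_ge0.
  have -> : (c * b 0%N) ^+ 2 * (c * b k.+2) +
    k.+1%:R * ((c * b 1%N) ^+ 2 - c * b 0%N * (c * b 2%N)) * (c * b k) -
    c * b 0%N * (c * b 1%N) * (c * b k.+1) = c ^+ 3 *
    (b 0%N ^+ 2 * b k.+2 + k.+1%:R * (b 1%N ^+ 2 - b 0%N * b 2%N) * b k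
     - b 0%N * b 1%N * b k.+1) by ring.
  by rewrite mulr_ge0 ?subr_ge0 // exprn_ge0 // ltW.
Qed.

Lemma hyperbolic_lpineq p : hyperbolic p -> lpineq (egfc p).
Proof.
move=> [c [s [c0 s0 ->]]].
suff [h1 h2] : lpineq (egfc (\prod_(x <- s) (1 + x *: 'X))) /\
   egfc (\prod_(x <- s) (1 + x *: 'X)) 0 = 1.
  have := lpineq_scale c0 h1; congr lpineq; apply/funext => k.
  by rewrite /egfc coefZ mulrCA.
elim: s s0 => [_|x s IH /= /andP[x0 s0]].
  rewrite big_nil; split; last by rewrite /egfc coef1 mul1r.
  have e k : egfc 1 k = (k == 0)%:R.
    by rewrite /egfc coef1; case: k => [|k]; rewrite ?mulr1 ?mulr0.
  split; rewrite ?e //.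
  - by move=> k; rewrite e.
  - by move=> k; rewrite !e /= mulr0 mul0r.
  - move=> k; rewrite !e /=; lra.
rewrite big_cons; have [h1 h2] := IH s0.
have -> : egfc ((1 + x *: 'X) * \prod_(j <- s) (1 + j *: 'X)) =
  mul1 x (egfc (\prod_(j <- s) (1 + j *: 'X))) by apply/funext => k; exact: egfc_mul1.
split; first exact: lpineq_mul1.
by rewrite /mul1 h2 !mul0r addr0.
Qed.

(* Coefficientwise limits of hyperbolic polynomials, in terms of the
   coefficients [b k] of [z ^ k / k!]. *)
Definition LP b := forall n (e : R), 0 < e -> exists p,
  hyperbolic p /\ forall k, (k < n)%N -> `|egfc p k - b k| < e.

Lemma LP_seq b : LP b -> exists p_ : nat -> {poly R},
  (forall n, hyperbolic (p_ n)) /\ forall k, egfc (p_ n) k @[n --> \oo] --> b k.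
Proof.
move=> h.
have /choice [p_ hp] : forall n, exists p, hyperbolic p /\
    forall k, (k < n)%N -> `|egfc p k - b k| < n.+1%:R^-1.
  by move=> n; apply: h; rewrite invr_gt0.
exists p_; split=> [n|k]; first by have [] := hp n.
apply/cvgrPdist_lt => e e0; near=> n.
have [_ /(_ k)] := hp n.
have kn : (k < n)%N by near: n; exists k.+1.
move=> /(_ kn); rewrite distrC => /lt_trans; apply.
near: n; exact: near_infty_natSinv_lt (PosNum e0).
Unshelve. all: by end_near. Qed.

Lemma LP_cvg b (p_ : nat -> {poly R}) : (forall n, hyperbolic (p_ n)) ->
  (forall k, egfc (p_ n) k @[n --> \oo] --> b k) -> LP b.
Proof.
move=> hp hb n e e0.
have : \forall m \near \oo, forall k, (k < n)%N -> `|egfc (p_ m) k - b k| < e.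
  elim: n => [|n IH]; first by near=> m => k.
  have := hb n => /cvgrPdist_lt /(_ _ e0) h.
  near=> m => k; rewrite ltnS leq_eqVlt => /predU1P[->|kn].
    by rewrite distrC; near: m.
  by move: k kn; near: m.
move=> [N _ /(_ N (leqnn _)) h]; exists (p_ N); split=> //.
Unshelve. all: by end_near. Qed.

Lemma LP_closed (u : nat -> nat -> R) b : (forall n, LP (u n)) ->
  (forall k, u n k @[n --> \oo] --> b k) -> LP b.
Proof.
move=> hu hb n e e0.
have e20 : 0 < e / 2 by rewrite divr_gt0.
have : \forall m \near \oo, forall k, (k < n)%N -> `|u m k - b k| < e / 2.
  elim: n => [|n IH]; first by near=> m => k.
  have := hb n => /cvgrPdist_lt /(_ _ e20) h.
  near=> m => k; rewrite ltnS leq_eqVlt => /predU1P[->|kn].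
    by rewrite distrC; near: m.
  by move: k kn; near: m.
move=> [N _ /(_ N (leqnn _)) h].
have [p [hp hpe]] := hu N n _ e20.
exists p; split=> // k kn; rewrite (splitr e) -(subrK (u N k) (egfc p k)) -addrA.
by rewrite (le_lt_trans (ler_normD _ _)) // ltrD ?hpe ?h.
Unshelve. all: by end_near. Qed.

Lemma lpineq_LP b : 0 < b 0%N -> LP b -> lpineq b.
Proof.
move=> b0 /LP_seq [p_ [hp hb]].
have H n := hyperbolic_lpineq (hp n).
split=> //.
- move=> k; apply: ler_cvg_to (cvg_cst 0) (hb k) _; near=> n; have [_ h _ _] := H n; exact: h.
- move=> k; apply: ler_cvg_to (cvgM (hb 0%N) (hb k.+1)) (cvgM (hb 1%N) (hb k)) _.
  by near=> n; have [_ _ h _] := H n; exact: h.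
move=> k; rewrite !expr2.
pose E n := egfc (p_ n).
have h1 : E n 0 * E n 1 * E n k.+1 @[n --> \oo] --> b 0%N * b 1%N * b k.+1.
  by apply: cvgM; [apply: cvgM|]; exact: hb.
have h2 : E n 0 * E n 0 * E n k.+2 + k.+1%:R * (E n 1 * E n 1 - E n 0 * E n 2) * E n k
    @[n --> \oo] -->
    b 0%N * b 0%N * b k.+2 + k.+1%:R * (b 1%N * b 1%N - b 0%N * b 2%N) * b k.
  apply: cvgD; first by apply: cvgM; [apply: cvgM|]; exact: hb.
  apply: cvgM; last exact: hb.
  apply: cvgM; first exact: cvg_cst.
  by apply: cvgB; apply: cvgM; exact: hb.
apply: ler_cvg_to h1 h2 _.
by near=> n; have [_ _ _ h] := H n; move: (h k); rewrite !expr2.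
Unshelve. all: by end_near. Qed.

End LaguerreClass.

(** * The heat flow on coefficients *)

Section Series.
Variable R : realType.
Implicit Types (u v M b : nat -> R).

Lemma series_dominated u M : cvgn (series M) -> (forall j, `|u j| <= M j) ->
  cvgn (series u).
Proof.
move=> cM uM; apply: normed_cvg; apply: series_le_cvg cM => // j /=; first exact: normr_ge0.
exact: le_trans (normr_ge0 _) (uM j).
Qed.

Lemma series_tail_dominated u M n : cvgn (series M) -> (forall j, `|u j| <= M j) ->
  `|limn (series u) - series u n| <= limn (series M) - series M n.
Proof.
move=> cM uM; have cu := series_dominated cM uM.
have h1 : `|series u m - series u n| @[m --> \oo] --> `|limn (series u) - series u n|.
  by apply: cvg_norm; apply: cvgB => //; exact: cvg_cst.
have h2 : series M m - series M n @[m --> \oo] --> limn (series M) - series M n.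
  by apply: cvgB => //; exact: cvg_cst.
apply: ler_cvg_to h1 h2 _; near=> m.
have nm : (n <= m)%N by near: m; exists n.
rewrite !sub_series_geq // (le_trans (ler_norm_sum _ _ _)) // ler_sum //.
Unshelve. all: by end_near. Qed.

Lemma series_norm_le u M : cvgn (series M) -> (forall j, `|u j| <= M j) ->
  `|limn (series u)| <= limn (series M).
Proof.
move=> cM uM; have := series_tail_dominated 0 cM uM.
by rewrite /series /= !big_geq // !subr0.
Qed.

(** Tannery's theorem along a filter that may be improper, such as the punctured neighbourhoods
    within [0, 1] used for time derivatives. The bound on the limit is then a hypothesis; for proper
    filters [tannery] deduces it. *)
Lemma tannery_filter T (F : set_system T) {FF : Filter F} (f : T -> nat -> R) g M :
  cvgn (series M) -> (\forall x \near F, forall j, `|f x j| <= M j) ->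
  (forall j, `|g j| <= M j) -> (forall j, f x j @[x --> F] --> g j) ->
  limn (series (f x)) @[x --> F] --> limn (series g).
Proof.
move=> cM fM gM fg.
apply/cvgrPdist_lt => e e0.
have e30 : 0 < e / 3 by rewrite divr_gt0.
have /cvgrPdist_lt /(_ _ e30) [n _ /(_ n (leqnn n))] := cM.
rewrite /= => hn.
have tM : limn (series M) - series M n < e / 3 by apply: le_lt_trans hn; exact: ler_norm.
have fin : series (f x) n @[x --> F] --> series g n.
  rewrite /series /=; elim: n {hn tM} => [|n IH].
    rewrite big_geq //; under eq_cvg do rewrite big_geq //; exact: cvg_cst.
  rewrite big_nat_recr //=; under eq_cvg do rewrite big_nat_recr //=.
  exact: cvgD.
move/cvgrPdist_lt: fin => /(_ _ e30) fin.
near=> x.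
have fx : forall j, `|f x j| <= M j by near: x.
have h1 := series_tail_dominated n cM fx.
have h2 := series_tail_dominated n cM gM.
have h3 : `|series g n - series (f x) n| < e / 3 by near: x.
have -> : limn (series g) - limn (series (f x)) = (limn (series g) - series g n)
   - (limn (series (f x)) - series (f x) n) + (series g n - series (f x) n) by ring.
have := ler_normD (limn (series g) - series g n - (limn (series (f x)) - series (f x) n)) (series g n - series (f x) n).
have := ler_normB (limn (series g) - series g n) (limn (series (f x)) - series (f x) n).
lra.
Unshelve. all: by end_near. Qed.

Lemma tannery T (F : set_system T) {FF : ProperFilter F} (f : T -> nat -> R) g M :
  cvgn (series M) -> (\forall x \near F, forall j, `|f x j| <= M j) ->
  (forall j, f x j @[x --> F] --> g j) ->
  limn (series (f x)) @[x --> F] --> limn (series g).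
Proof.
move=> cM fM fg; apply: (tannery_filter cM fM _ fg) => j.
have h : `|f x j| @[x --> F] --> `|g j : R| by exact: cvg_norm.
by apply: (cvgr_to_le h); apply: filterS fM => x.
Qed.

Lemma series_finite u n : (forall j, (n <= j)%N -> u j = 0) ->
  series u @ \oo --> \sum_(j < n) u j.
Proof.
move=> hu; apply: cvg_near_cst; near=> m.
have nm : (n <= m)%N by near: m; exists n.
rewrite /series /= (@big_cat_nat _ _ _ n) //= big_mkord [X in _ + X]big_nat_cond.
by rewrite [X in _ + X]big1 ?addr0 // => j; rewrite andbT => /andP[/hu].
Unshelve. all: by end_near. Qed.

Lemma cvg_geometric_pos (M r : R) : 0 <= r < 1 -> cvgn (series (fun j => M * r ^+ j)).
Proof.
move=> /andP[r0 r1]; apply: is_cvg_geometric_series.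
by rewrite ger0_norm.
Qed.

Lemma limn_seriesZ u (c : R) : cvgn (series u) ->
  limn (series (fun j => c * u j)) = c * limn (series u).
Proof. exact: lim_seriesZ. Qed.

Lemma series_shift u : cvgn (series u) ->
  series (fun j => u j.+1) @ \oo --> limn (series u) - u 0%N.
Proof.
move=> cu.
have -> : series (fun j => u j.+1) = (fun n => series u n.+1 - u 0%N).
  apply/funext => n; rewrite /series /= big_nat_recl // addrC addKr.
  by apply: eq_big_nat.
by apply: cvgB; [rewrite (cvg_shiftS (series u)) | exact: cvg_cst].
Qed.

Lemma le_of_derive_ge0 (f df : R -> R) (a b : R) : a <= b ->
  (forall x, a <= x <= b -> is_derive x 1 f (df x)) ->
  (forall x, a <= x <= b -> 0 <= df x) -> f a <= f b.
Proof.
move=> ab dfx df0; have [/eqP ->//|nab] := boolP (a == b).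
have {nab} ab' : a < b by rewrite lt_neqAle nab.
have [||c cab] := @MVT_segment R f df a b ab.
- move=> x; rewrite in_itv /= => /andP[ax xb].
  by apply: dfx; rewrite !ltW.
- apply: derivable_within_continuous => x; rewrite in_itv /= => xab.
  by have [] := dfx x xab.
rewrite -subr_ge0 => ->; rewrite mulr_ge0 ?subr_ge0 //.
by apply: df0; move: cab; rewrite in_itv.
Qed.

End Series.

(** * The binomial series *)

Section RisingFactorial.
Variable R : realType.
Implicit Types (x y : R).

Definition rising x j : R := \prod_(i < j) (x + i%:R).

Lemma rising0 x : rising x 0 = 1. Proof. by rewrite /rising big_ord0. Qed.

Lemma risingSr x j : rising x j.+1 = rising x j * (x + j%:R).
Proof. by rewrite /rising big_ord_recr. Qed.

Lemma risingS x j : rising x j.+1 = x * rising (x + 1) j.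
Proof.
rewrite /rising big_ord_recl /= addr0; congr (_ * _); apply: eq_bigr => i _.
by rewrite -addrA -[1 + _]/(1%:R + _) -natrD add1n.
Qed.

Lemma rising_ge0 x j : 0 <= x -> 0 <= rising x j.
Proof. by move=> x0; apply: prodr_ge0 => i _; rewrite addr_ge0. Qed.

(** Taylor coefficients of (1 - y)^(-x). *)
Definition negbin x j : R := rising x j / j`!%:R.

Lemma negbin_ge0 x j : 0 <= x -> 0 <= negbin x j.
Proof. by move=> x0; rewrite divr_ge0 // rising_ge0. Qed.

Lemma negbin_diffs x : pseries_diffs (negbin x) = (fun j => x * negbin (x + 1) j).
Proof.
apply/funext => j; rewrite /pseries_diffs /negbin risingS factS natrM.
have : j`!%:R != 0 :> R by rewrite pnatr_eq0 -lt0n fact_gt0.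
have : j.+1%:R != 0 :> R by rewrite pnatr_eq0.
move: (j.+1%:R : R) (j`!%:R : R) (rising _ _) => a c r a0 c0; field.
by rewrite a0 c0.
Qed.

Lemma cvg_negbin x y : 0 <= x -> `|y| < 1 -> cvgn (pseries (negbin x) y).
Proof.
move=> x0 y1; pose z := (`|y| + 1) / 2.
have z1 : z < 1 by rewrite /z; lra.
have z0 : 0 < z by rewrite /z; have := normr_ge0 y; lra.
have yz : `|y| < z by rewrite /z; lra.
(* From [N] on, consecutive terms [negbin x j * z ^+ j] have ratio at most 1, so all of them are
   bounded by the sum [K] of the first ones, and |y| < z gives a geometric majorant. *)
have [N hN] : exists N : nat, forall j, (N <= j)%N -> (x + j%:R) * z <= j.+1%:R.
  exists (Num.bound (x * z / (1 - z))) => j hj.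
  have : x * z / (1 - z) <= j%:R.
    have h0 : 0 <= x * z / (1 - z) by rewrite divr_ge0 ?mulr_ge0 ?subr_ge0 // ltW.
    rewrite (le_trans (ltW (archi_boundP h0))) // ler_nat //.
  rewrite ler_pdivrMr ?subr_gt0 // -[j.+1]addn1 natrD; lra.
pose K := \sum_(j < N.+1) negbin x j * z ^+ j.
have hK j : negbin x j * z ^+ j <= K.
  elim: j => [|j IH].
    rewrite /K big_ord_recl /= lerDl sumr_ge0 // => i _.
    by rewrite mulr_ge0 ?negbin_ge0 // exprn_ge0 // ltW.
  have [jN|Nj] := ltnP j N.
    rewrite /K (bigD1 (Ordinal (jN : j.+1 < N.+1)%N)) //= lerDl sumr_ge0 // => i _.
    by rewrite mulr_ge0 ?negbin_ge0 // exprn_ge0 // ltW.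
  apply: le_trans IH; rewrite /negbin risingSr factS natrM exprS.
  have f0 : 0 < j`!%:R :> R by rewrite ltr0n fact_gt0.
  have -> : rising x j * (x + j%:R) / (j.+1%:R * j`!%:R) * (z * z ^+ j) =
     (rising x j / j`!%:R * z ^+ j) * ((x + j%:R) * z / j.+1%:R).
     have := gt_eqF f0 => /negbT ?; field; rewrite gt_eqF // ltr_pwDr //.
  rewrite ler_piMr //; last by rewrite ler_pdivrMr // mul1r hN.
  by rewrite mulr_ge0 ?divr_ge0 ?rising_ge0 // exprn_ge0 // ltW.
apply: (@series_dominated _ _ (fun j => K * (`|y| / z) ^+ j)).
  apply: cvg_geometric_pos; rewrite divr_ge0 ?(ltW z0) //=.
  by rewrite ltr_pdivrMr // mul1r.
move=> j; rewrite normrM normrX ger0_norm ?negbin_ge0 // expr_div_n.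
rewrite mulrA ler_pdivlMr ?exprn_gt0 // mulrAC ler_wpM2r ?exprn_ge0 //.
Qed.

Definition negbin_sum x y : R := limn (pseries (negbin x) y).

Lemma negbin_sum_derive x y : 0 <= x -> `|y| < 1 ->
  is_derive y 1 (negbin_sum x) (x * negbin_sum (x + 1) y).
Proof.
move=> x0 y1; pose z := (`|y| + 1) / 2.
have z1 : `|z| < 1.
  by rewrite ger0_norm /z; have := normr_ge0 y; lra.
have yz : `|y| < `|z|.
  by rewrite [X in _ < X]ger0_norm /z; have := normr_ge0 y; lra.
have x10 : 0 <= x + 1 by rewrite addr_ge0.
have x20 : 0 <= x + 1 + 1 by rewrite !addr_ge0.
have E a : 0 <= a -> pseries (fun j => x * negbin a j) = (fun w => series (fun j => x * (negbin a j * w ^+ j))).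
  by move=> _; apply/funext => w; rewrite /pseries; congr series; apply/funext => j; rewrite mulrA.
have E2 a : 0 <= a -> pseries_diffs (fun j => x * negbin a j) = (fun j => x * (a * negbin (a + 1) j)).
  move=> a0; have := negbin_diffs a => /(congr1 (fun f j => x * f j)) <-.
  by apply/funext => j; rewrite /pseries_diffs mulrCA.
have := @pseries_snd_diffs R (negbin x) z y.
rewrite negbin_diffs E2 // E //.
rewrite [limn (series (fun j => x * (_ * y ^+ j)))]limn_seriesZ; last exact: cvg_negbin.
apply => //; first exact: cvg_negbin.
  by apply: is_cvg_seriesZ; exact: cvg_negbin.
have -> : (fun j => x * ((x + 1) * negbin (x + 1 + 1) j)) = (fun j => (x * (x + 1)) * negbin (x + 1 + 1) j).
  by apply/funext => j; rewrite mulrA.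
have -> : pseries (fun j => x * (x + 1) * negbin (x + 1 + 1) j) z =
   series (fun j => (x * (x + 1)) * (negbin (x + 1 + 1) j * z ^+ j)).
  by rewrite /pseries; congr series; apply/funext => j; rewrite /= !mulrA.
apply: is_cvg_seriesZ; exact: cvg_negbin.
Qed.

(** With [negbin_sum_derive] this becomes the differential equation (1 - y) S' = x S. *)
Lemma negbin_sum_rec x y : 0 <= x -> `|y| < 1 ->
  (1 - y) * negbin_sum (x + 1) y = negbin_sum x y.
Proof.
move=> x0 y1.
have x10 : 0 <= x + 1 by rewrite addr_ge0.
have c1 : cvgn (series (fun j => negbin (x + 1) j * y ^+ j)) by exact: cvg_negbin.
have c0 : cvgn (series (fun j => negbin x j * y ^+ j)) by exact: cvg_negbin.
have h1 := series_shift c1; have h0 := series_shift c0.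
have e : series (fun j => negbin x j.+1 * y ^+ j.+1) =
   (fun n => series (fun j => negbin (x + 1) j.+1 * y ^+ j.+1) n
     - y * series (fun j => negbin (x + 1) j * y ^+ j) n).
  apply/funext => n; rewrite /series /= mulr_sumr -sumrB; apply: eq_bigr => j _.
  rewrite exprS mulrCA [in RHS]mulrCA -mulrBr; congr (_ * _).
  rewrite -mulrBl; congr (_ * _).
  rewrite /negbin (risingS x) (risingSr (x + 1)) factS natrM.
  have : j`!%:R != 0 :> R by rewrite pnatr_eq0 -lt0n fact_gt0.
  have : j.+1%:R != 0 :> R by rewrite pnatr_eq0.
  have -> : j%:R = j.+1%:R - 1 :> R by rewrite -natr1 addrK.
  move: (j.+1%:R : R) (j`!%:R : R) (rising _ _) => a c r an0 cn0; field.
  by rewrite an0 cn0.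
have h2 : series (fun j => negbin x j.+1 * y ^+ j.+1) @ \oo -->
   negbin_sum (x + 1) y - negbin (x + 1) 0 * y ^+ 0 - y * negbin_sum (x + 1) y.
  by rewrite e; apply: cvgB => //; apply: cvgZl_tmp.
have := cvg_unique _ h0 h2.
rewrite /negbin !rising0 fact0 -/(pseries (negbin x) y) -/(negbin_sum x y) expr0 => h.
have {}h := h (@Rhausdorff R).
rewrite -[negbin_sum x y](subrK (1 / 1 * 1)) h; ring.
Qed.

(** The product of the sum with (1 - y)^x has zero derivative and takes the value 1 at 0. *)
Lemma negbin_sumE x y : 0 <= x -> `|y| < 1 -> negbin_sum x y = (1 - y) `^ (- x).
Proof.
move=> x0 y1.
have y1' : 0 < 1 - y by move: y1; rewrite ltr_norml; lra.
pose f w := negbin_sum x w * expR (x * ln (1 - w)).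
have df (w : R) : `|w| < 1 -> is_derive w 1 f 0.
  move=> w1; have w1' : 0 < 1 - w by move: w1; rewrite ltr_norml; lra.
  have dw := negbin_sum_derive x0 w1.
  have dl : is_derive w 1 (fun w => ln (1 - w)) (- (1 - w)^-1).
    have := @is_derive1_comp R (@ln R) (fun w => 1 - w) w (1 - w)^-1 (-1) (is_derive1_ln w1') _.
    rewrite mulrN1; apply.
    have -> : (fun v : R => 1 - v) = cst 1 - id by [].
    by apply: is_derive_eq; rewrite sub0r.
  have de : is_derive w 1 (fun w => expR (x * ln (1 - w))) (expR (x * ln (1 - w)) * (x * - (1 - w)^-1)).
    have := @is_derive1_comp R (@expR R) (fun w => x * ln (1 - w)) w (expR (x * ln (1 - w))) (x * - (1 - w)^-1) (is_derive_expR _).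
    by apply; have := is_deriveZ x dl.
  apply: (is_derive_eq (is_deriveM dw de)).
  rewrite -(negbin_sum_rec x0 w1) /GRing.scale /=.
  by have := lt0r_neq0 w1' => ?; field.
have fy : f y = 1.
  have f0 : f 0 = 1.
    rewrite /f subr0 ln1 mulr0 expR0 mulr1 /negbin_sum.
    have h : series (fun j => negbin x j * 0 ^+ j) @ \oo --> (1 : R).
      have := @series_finite R (fun j => negbin x j * 0 ^+ j) 1.
      rewrite big_ord1 /negbin rising0 fact0 divr1 mul1r expr0; apply.
      by case=> // j _; rewrite exprS mul0r mulr0.
    by apply: cvg_lim h.
  rewrite -f0; apply/eqP; rewrite eq_le.
  have dfN (w : R) : `|w| < 1 -> is_derive w 1 (- f) 0.
    by move=> /df h; have := is_deriveN h; rewrite oppr0.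
  have [yle|yge] := leP y 0.
    have r w : y <= w <= 0 -> `|w| < 1 by move: y1; rewrite !ltr_norml; lra.
    apply/andP; split; first by apply: (@le_of_derive_ge0 _ f (fun => 0)) => // w /r /df.
    by rewrite -lerN2; apply: (@le_of_derive_ge0 _ (fun w => - f w) (fun => 0)) => // w /r /dfN.
  have r w : 0 <= w <= y -> `|w| < 1 by move: y1; rewrite !ltr_norml; lra.
  apply/andP; split; last by apply: (@le_of_derive_ge0 _ f (fun => 0)) => // [|w /r /df //]; exact: ltW.
  rewrite -lerN2; apply: (@le_of_derive_ge0 _ (fun w => - f w) (fun => 0)) => // [|w /r /dfN //]; exact: ltW.
rewrite /powR gt_eqF // mulNr expRN.
apply: (mulIf (lt0r_neq0 (expR_gt0 (x * ln (1 - y))))).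
by rewrite mulVf ?lt0r_neq0 ?expR_gt0.
Qed.

End RisingFactorial.

(** * The operator exp(s D) *)

Section Flow.
Variable R : realType.
Implicit Types (b c : nat -> R) (M B s theta : R).

(** Coefficientwise domination by M exp(B z). Exponentials are transformed explicitly by every
    operation of the step, so these bounds can be followed through it. *)
Definition gbound M B b := forall k, 0 <= b k <= M * B ^+ k.

Definition flow_coef theta b k j := negbin (theta + k%:R) j * b (k + j)%N.

(* [flow theta s] is [exp (s D)] for [D = theta d/dz + z d^2/dz^2], acting on the
   coefficients of [z ^ k / k!], where [D] reads
   [(b_k) |-> ((theta + k) b_(k+1))]. *)
Definition flow theta s b k := limn (pseries (flow_coef theta b k) s).

Lemma gbound_ge0 M B b k : gbound M B b -> 0 <= b k.
Proof. by move=> /(_ k) /andP[]. Qed.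

Lemma gbound_M_ge0 M B b : gbound M B b -> 0 <= M.
Proof. by move=> /(_ 0%N) /andP[h1 h2]; rewrite expr0 mulr1 in h2; apply: le_trans h2. Qed.

Lemma flow_term_le theta M B b k j s : 0 <= theta -> 0 <= B -> gbound M B b ->
  `|flow_coef theta b k j * s ^+ j| <=
  M * B ^+ k * (negbin (theta + k%:R) j * (`|s| * B) ^+ j).
Proof.
move=> th0 B0 hb; rewrite /flow_coef normrM (normrM (negbin _ _)) normrX.
have th1 : 0 <= theta + k%:R by rewrite addr_ge0.
rewrite (ger0_norm (negbin_ge0 _ th1)) (ger0_norm (gbound_ge0 _ hb)).
have /andP[_ h] := hb (k + j)%N.
rewrite exprMn exprD in h *.
have -> : M * B ^+ k * (negbin (theta + k%:R) j * (`|s| ^+ j * B ^+ j)) =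
  negbin (theta + k%:R) j * (M * (B ^+ k * B ^+ j)) * `|s| ^+ j by ring.
by rewrite ler_wpM2r ?exprn_ge0 // ler_wpM2l // negbin_ge0.
Qed.

Lemma cvg_flow_bound theta M B k s : 0 <= theta -> 0 <= B -> `|s| * B < 1 ->
  series (fun j => M * B ^+ k * (negbin (theta + k%:R) j * (`|s| * B) ^+ j)) @ \oo
  --> M * B ^+ k * (1 - `|s| * B) `^ (- (theta + k%:R)).
Proof.
move=> th0 B0 sB; have th1 : 0 <= theta + k%:R by rewrite addr_ge0.
have sB' : `|(`|s| * B)| < 1 by rewrite ger0_norm // mulr_ge0.
rewrite -(negbin_sumE th1 sB') -limn_seriesZ; last exact: cvg_negbin.
by apply: is_cvg_seriesZ; exact: cvg_negbin.
Qed.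

Lemma cvg_flow theta M B b k s : 0 <= theta -> 0 <= B -> gbound M B b ->
  `|s| * B < 1 -> cvgn (pseries (flow_coef theta b k) s).
Proof.
move=> th0 B0 hb sB.
apply: series_dominated (fun j => flow_term_le k j s th0 B0 hb).
by apply/cvg_ex; eexists; apply: cvg_flow_bound.
Qed.

Lemma powR_flow_bound theta M B k s : s * B < 1 ->
  M * B ^+ k * (1 - s * B) `^ (- (theta + k%:R)) =
  M * (1 - s * B) `^ (- theta) * (B / (1 - s * B)) ^+ k.
Proof.
move=> sB; have h : 0 < 1 - s * B by rewrite subr_gt0.
rewrite opprD powRD; last by rewrite (gt_eqF h) implybT.
rewrite [_ `^ (- k%:R)]powRN powR_mulrn ?(ltW h) // expr_div_n; ring.
Qed.

(** For s >= 0 the operator exp(s D) respects coefficientwise order, and it sends exp(B z) to (1 - s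
    B)^(-theta) exp(B z / (1 - s B)). *)
Lemma flow_gbound theta M B b s : 0 <= theta -> 0 <= B -> gbound M B b ->
  0 <= s -> s * B < 1 ->
  gbound (M * (1 - s * B) `^ (- theta)) (B / (1 - s * B)) (flow theta s b).
Proof.
move=> th0 B0 hb s0 sB k; rewrite -powR_flow_bound //.
have sB' : `|s| * B < 1 by rewrite ger0_norm.
apply/andP; split.
  apply: limr_ge; first exact: cvg_flow hb _.
  near=> n; apply: sumr_ge0 => j _.
  rewrite mulr_ge0 ?exprn_ge0 // mulr_ge0 ?(gbound_ge0 _ hb) //.
  by rewrite negbin_ge0 // addr_ge0.
have cM := @cvg_flow_bound theta M B k s th0 B0 sB'.
have := series_norm_le (cvgP _ cM) (fun j => flow_term_le k j s th0 B0 hb).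
rewrite (cvg_lim _ cM) // (ger0_norm s0) => /(le_trans _); apply.
exact: ler_norm.
Unshelve. all: by end_near. Qed.

Lemma flow_geometric theta C B s k : 0 <= theta -> 0 <= B -> 0 <= s -> s * B < 1 ->
  flow theta s (fun k => C * B ^+ k) k =
  C * (1 - s * B) `^ (- theta) * (B / (1 - s * B)) ^+ k.
Proof.
move=> th0 B0 s0 sB; rewrite -powR_flow_bound //.
have := @cvg_flow_bound theta C B k s th0 B0; rewrite ger0_norm // => /(_ sB) h.
rewrite -(cvg_lim (@Rhausdorff R) h); congr (limn (series _)).
apply/funext => j; rewrite /flow_coef /= exprMn exprD; ring.
Qed.

Lemma flow_le theta M B b c s s' k : 0 <= theta -> 0 <= B -> gbound M B c ->
  0 <= s -> s <= s' -> s' * B < 1 -> (forall k, 0 <= b k <= c k) ->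
  flow theta s b k <= flow theta s' c k.
Proof.
move=> th0 B0 hc s0 ss' sB hbc; have sB' : `|s'| * B < 1 by rewrite ger0_norm // (le_trans s0).
have hb : gbound M B b.
  move=> i; have /andP[b0 bc] := hbc i; rewrite b0 (le_trans bc) //.
  by have /andP[] := hc i.
apply: ler_lim; [apply: cvg_flow hb _ => //|exact: cvg_flow hc _|near=> n].
  by apply: le_lt_trans sB'; rewrite ler_wpM2r // !ger0_norm // (le_trans s0).
apply: ler_sum => j _; have /andP[b0 bc] := hbc (k + j)%N.
have n0 : 0 <= negbin (theta + k%:R) j by rewrite negbin_ge0 // addr_ge0.
rewrite ler_pM ?exprn_ge0 ?(mulr_ge0 n0 b0) //; first exact: ler_wpM2l.
by rewrite lerXn2r ?nnegrE // (le_trans s0).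
Unshelve. all: by end_near. Qed.

Lemma flow0 theta b : flow theta 0 b = b.
Proof.
apply/funext => k; rewrite /flow.
have := @series_finite R (fun j => flow_coef theta b k j * 0 ^+ j) 1.
rewrite big_ord1 /flow_coef /negbin rising0 fact0 divr1 mul1r expr0 mulr1 addn0.
move=> h; apply: (cvg_lim (@Rhausdorff R)); apply: h => -[//|j] _.
by rewrite exprS mul0r mulr0.
Qed.

Lemma flow_scale theta a b s M B k : 0 <= theta -> 0 <= B -> gbound M B b ->
  `|s| * B < 1 -> flow theta s (fun k => a * b k) k = a * flow theta s b k.
Proof.
move=> th0 B0 hb sB; rewrite /flow -limn_seriesZ; last exact: cvg_flow hb _.
rewrite /pseries; congr (limn (series _)); apply/funext => j; rewrite /flow_coef /=; ring.
Qed.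

Lemma flow_ge theta M B b s k : 0 <= theta -> 0 <= B -> gbound M B b ->
  0 <= s -> s * B < 1 -> b k <= flow theta s b k.
Proof.
move=> th0 B0 hb s0 sB; have sB' : `|s| * B < 1 by rewrite ger0_norm.
apply: limr_ge; first exact: cvg_flow hb _.
near=> n; have n0 : (0 < n)%N by near: n; exists 1%N.
rewrite /pseries /series /= -(prednK n0) big_nat_recl //.
rewrite /flow_coef /negbin rising0 fact0 divr1 mul1r expr0 mulr1 addn0 lerDl.
apply: sumr_ge0 => j _.
rewrite !mulr_ge0 ?exprn_ge0 ?invr_ge0 ?rising_ge0 ?addr_ge0 //.
exact: gbound_ge0 hb.
Unshelve. all: by end_near. Qed.

Lemma flow_coef_diffs theta b k :
  pseries_diffs (flow_coef theta b k) =
  (fun j => (theta + k%:R) * flow_coef theta b k.+1 j).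
Proof.
have := negbin_diffs (theta + k%:R) => /(congr1 (fun f => fun j => f j * b (k + j.+1)%N)) h.
apply/funext => j; rewrite /flow_coef /pseries_diffs mulrA.
have /(congr1 (fun f => f j)) /= := h; rewrite /pseries_diffs => ->.
by rewrite addnS addSn -mulrA -addrA natr1.
Qed.

Lemma flow_derive theta M B b s k : 0 <= theta -> 0 <= B -> gbound M B b ->
  `|s| * B < 1 ->
  is_derive s 1 (fun s => flow theta s b k) ((theta + k%:R) * flow theta s b k.+1).
Proof.
move=> th0 B0 hb sB.
have [K sK KB] : exists2 K : R, `|s| < `|K| & `|K| * B < 1.
  have [->|Bn0] := eqVneq B 0.
    exists (`|s| + 1); last by rewrite mulr0.
    by rewrite [X in _ < X]ger0_norm ?addr_ge0 // ltrDl.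
  have Bp : 0 < B by rewrite lt_neqAle eq_sym Bn0.
  exists ((`|s| + B^-1) / 2).
    rewrite [X in _ < X]ger0_norm ?divr_ge0 ?addr_ge0 ?invr_ge0 //.
    have : `|s| < B^-1 by rewrite -[B^-1]mul1r ltr_pdivlMr.
    lra.
  rewrite ger0_norm ?divr_ge0 ?addr_ge0 ?invr_ge0 // mulrAC mulrDl mulVf //.
  lra.
have cv (a : R) i (x : R) : `|x| * B < 1 -> cvgn (series (fun j => a * (flow_coef theta b i j * x ^+ j))).
  by move=> xB; apply: is_cvg_seriesZ; apply: cvg_flow hb xB.
have E (a : R) i (x : R) : pseries (fun j => a * flow_coef theta b i j) x =
   series (fun j => a * (flow_coef theta b i j * x ^+ j)).
  by rewrite /pseries; congr series; apply/funext => j; rewrite mulrA.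
have := @pseries_snd_diffs R (flow_coef theta b k) K s.
rewrite flow_coef_diffs.
have -> : pseries_diffs (fun j => (theta + k%:R) * flow_coef theta b k.+1 j) =
  (fun j => (theta + k%:R) * (theta + k.+1%:R) * flow_coef theta b k.+2 j).
  have := flow_coef_diffs theta b k.+1 => /(congr1 (fun f j => (theta + k%:R) * f j)) h.
  apply/funext => j; rewrite -mulrA.
  by have /(congr1 (fun f => f j)) /= <- := h; rewrite /pseries_diffs mulrCA.
rewrite !E [limn (series (fun j => _ * (_ * s ^+ j)))]limn_seriesZ; last exact: cvg_flow hb _.
by apply => //; [apply: cvg_flow hb KB|exact: cv|exact: cv].
Qed.

Lemma flow_cvg_to T (F : set_system T) {FF : ProperFilter F} theta M B S
    (u : T -> nat -> R) b (v : T -> R) s k : 0 <= theta -> 0 <= B -> 0 <= S -> S * B < 1 ->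
  (\forall x \near F, gbound M B (u x) /\ `|v x| <= S) ->
  (forall k, u x k @[x --> F] --> b k) -> v x @[x --> F] --> s ->
  flow theta (v x) (u x) k @[x --> F] --> flow theta s b k.
Proof.
move=> th0 B0 S0 SB hu ub vs.
apply: (@tannery _ _ _ _ (fun x j => flow_coef theta (u x) k j * v x ^+ j) _
  (fun j => M * B ^+ k * (negbin (theta + k%:R) j * (`|S| * B) ^+ j))).
- by apply/cvg_ex; eexists; apply: cvg_flow_bound => //; rewrite ger0_norm.
- near=> x => j; have [hb vS] : gbound M B (u x) /\ `|v x| <= S by near: x.
  apply: le_trans (flow_term_le k j (v x) th0 B0 hb) _.
  rewrite ler_wpM2l ?mulr_ge0 ?(gbound_M_ge0 hb) ?exprn_ge0 //.
  rewrite ler_wpM2l ?negbin_ge0 ?addr_ge0 //.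
  by rewrite lerXn2r ?nnegrE ?mulr_ge0 // ler_wpM2r // (ger0_norm S0).
move=> j; apply: cvgM; first by apply: cvgM; [exact: cvg_cst|exact: ub].
rewrite /=; elim: j => [|j IH]; first exact: cvg_cst.
by rewrite exprS; under eq_fun do rewrite exprS; apply: cvgM.
Unshelve. all: by end_near. Qed.

Definition heat_step theta s b k := b k + s * (theta + k%:R) * b k.+1.

Lemma egfc_heat_step theta s (p : {poly R}) :
  egfc (p + s *: heatop theta p) = heat_step theta s (egfc p).
Proof.
apply/funext => k; rewrite /egfc /heat_step /heatop coefD coefZ coefD coefZ coefXM.
rewrite !coef_deriv; case: k => [|k] /=; rewrite !factS !natrM ?fact0; last first.
  rewrite -[_ *+ k.+2 *+ k.+1]mulr_natr -[_ *+ k.+2]mulr_natr.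
  by move: (k.+2%:R) (k.+1%:R) (k`!%:R) => x y z; ring.
by rewrite -mulr_natr; ring.
Qed.

(** The binomial expansion of (1 + s D)^n: the k-th coefficient of D^j b is b (k + j) times a rising
    factorial. *)
Lemma iter_heat_step theta s b n k :
  iter n (heat_step theta s) b k =
  \sum_(j < n.+1) 'C(n, j)%:R * s ^+ j * rising (theta + k%:R) j * b (k + j)%N.
Proof.
elim: n k => [|n IH] k.
  by rewrite big_ord1 /= rising0 bin0 expr0 !mul1r addn0.
rewrite iterS /heat_step !IH big_ord_recl [in X in _ + X]big_ord_recr /=.
rewrite [RHS]big_ord_recl [in RHS]big_ord_recr /=.
rewrite !bin0 !binn expr0 !rising0 addn0 !mul1r -!addrA; congr (_ + _).
rewrite mulrDr mulr_sumr addrA -big_split /=; congr (_ + _).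
  apply: eq_bigr => i _; rewrite /bump /= add1n.
  rewrite binS natrD exprS [rising _ i.+1]risingS -natr1 addrA addnS addSn; ring.
rewrite /bump /= add1n exprS risingS -natr1 addrA addnS addSn; ring.
Qed.

Lemma falling_ratio_le1 n j : ('C(n, j) * j`!)%:R / n%:R ^+ j <= 1 :> R.
Proof.
rewrite bin_ffact; have [->|n0] := posnP n.
  by case: j => [|j]; rewrite ?ffactn0 ?expr0 ?divr1 // expr0n /= invr0 mulr0.
rewrite ler_pdivrMr ?exprn_gt0 ?ltr0n // mul1r -natrX ler_nat.
elim: j => [//|j IH]; by rewrite ffactnSr expnSr leq_mul // leq_subr.
Qed.

Lemma falling_ratio_cvg j : ('C(n, j) * j`!)%:R / n%:R ^+ j @[n --> \oo] --> (1 : R).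
Proof.
under eq_fun do rewrite bin_ffact.
elim: j => [|j IH].
  by under eq_fun do rewrite ffactn0 expr0 divr1; exact: cvg_cst.
have h : (n - j)%:R / n%:R @[n --> \oo] --> (1 : R).
  have h1 : 1 - j%:R * n%:R^-1 @[n --> \oo] --> (1 - j%:R * 0 : R).
    apply: cvgB; first exact: cvg_cst.
    apply: cvgM; first exact: cvg_cst.
    apply/cvgrPdist_lt => e e0; near=> n.
    rewrite sub0r normrN ger0_norm ?invr_ge0 //.
    have n0 : (0 < n)%N by near: n; exists 1%N.
    rewrite -(prednK n0); near: n.
    have [N _ hN] := near_infty_natSinv_lt (PosNum e0).
    by exists N.+1 => // n /= Nn; apply: hN => /=; case: n Nn.
  rewrite mulr0 subr0 in h1; apply: cvg_trans h1; apply: near_eq_cvg; near=> n.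
  have jn : (j < n)%N by near: n; exists j.+1.
  have n0 : n%:R != 0 :> R by rewrite pnatr_eq0 -lt0n (leq_ltn_trans _ jn).
  by rewrite natrB ?(ltnW jn) // mulrBl divff.
have E : (fun n => (n ^_ j.+1)%:R / n%:R ^+ j.+1) =
  (fun n => (n ^_ j)%:R / n%:R ^+ j * ((n - j)%:R / n%:R)) :> (nat -> R).
  by apply/funext => n; rewrite ffactnSr natrM exprSr invfM mulrACA.
have h' : (n ^_ j)%:R / n%:R ^+ j * ((n - j)%:R / n%:R) @[n --> \oo] --> (1 : R).
  by rewrite -[X in _ --> X]mulr1; apply: cvgM.
by move=> t ht; rewrite E; exact: h'.
Unshelve. all: by end_near. Qed.

(** exp(s D) as the limit of (1 + s D / n)^n. The terms of the binomial expansion are those of the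
    series times falling-factorial ratios, which lie in [0, 1] and tend to 1. The data vary with n
    because approximating polynomials are inserted. *)
Lemma euler_flow_cvg theta M B (u : nat -> nat -> R) b s k :
  0 <= theta -> 0 <= B -> 0 <= s -> s * B < 1 ->
  (\forall n \near \oo, gbound M B (u n)) ->
  (forall k, u n k @[n --> \oo] --> b k) ->
  iter n (heat_step theta (s / n%:R)) (u n) k @[n --> \oo] --> flow theta s b k.
Proof.
move=> th0 B0 s0 sB hu ub.
pose f n j := ('C(n, j) * j`!)%:R / n%:R ^+ j * (flow_coef theta (u n) k j * s ^+ j).
have E n : iter n (heat_step theta (s / n%:R)) (u n) k = limn (series (f n)).
  rewrite iter_heat_step.
  have h : forall j, (n.+1 <= j)%N -> f n j = 0.
    by move=> j nj; rewrite /f bin_small // mul0n mul0r mul0r.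
  rewrite (cvg_lim _ (series_finite h)) //; apply: eq_bigr => j _.
  rewrite /f /flow_coef /negbin expr_div_n natrM.
  have : j`!%:R != 0 :> R by rewrite pnatr_eq0 -lt0n fact_gt0.
  move: (_ ^-1) (j`!%:R) (rising _ _) => x y r y0; field.
  by [].
under eq_fun do rewrite E.
have F0 n j : 0 <= ('C(n, j) * j`!)%:R / n%:R ^+ j :> R by rewrite divr_ge0.
apply: (@tannery _ _ _ _ f _
  (fun j => M * B ^+ k * (negbin (theta + k%:R) j * (`|s| * B) ^+ j))).
- by apply/cvg_ex; eexists; apply: cvg_flow_bound => //; rewrite ger0_norm.
- near=> n => j; have hb : gbound M B (u n) by near: n.
  apply: le_trans (flow_term_le k j s th0 B0 hb).
  rewrite /f normrM ger0_norm // ler_piMl // falling_ratio_le1 //.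
move=> j; rewrite -[X in _ --> X]mul1r; apply: cvgM; first exact: falling_ratio_cvg.
apply: cvgM; last exact: cvg_cst.
by apply: cvgM; [exact: cvg_cst|exact: ub].
Unshelve. all: by end_near. Qed.

Lemma lpineq_gbound b : lpineq b -> gbound (b 0%N) (b 1%N / b 0%N) b.
Proof.
move=> [b0 bk h _] k; rewrite bk /=; elim: k => [|k IH]; first by rewrite expr0 mulr1.
have h1 : b k.+1 <= b 1%N / b 0%N * b k by rewrite mulrAC ler_pdivlMr // mulrC.
apply: le_trans h1 _; rewrite exprS mulrCA ler_wpM2l // divr_ge0 // ltW.
Qed.

Lemma LP_flow theta b s : 0 <= theta -> 0 <= s -> 0 < b 0%N ->
  s * (b 1%N / b 0%N) < 1 -> LP b -> LP (flow theta s b).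
Proof.
move=> th0 s0 b0 sP hb; have [_ bk _ _] := lpineq_LP b0 hb.
have [p_ [hp pb]] := LP_seq hb.
have P0 : 0 <= b 1%N / b 0%N by rewrite divr_ge0 // ltW.
(* Strict room above b 1 / b 0: the ratios of the approximating polynomials are only eventually
   below [B], while their flow must converge uniformly. *)
have [B PB sB] : exists2 B : R, b 1%N / b 0%N < B & s * B < 1.
  have [->|sn0] := eqVneq s 0.
    by exists (b 1%N / b 0%N + 1); rewrite ?ltrDl // mul0r.
  have sp : 0 < s by rewrite lt_neqAle eq_sym sn0.
  exists ((b 1%N / b 0%N + s^-1) / 2).
    have : b 1%N / b 0%N < s^-1 by rewrite -[s^-1]mul1r ltr_pdivlMr // mulrC.
    lra.
  rewrite mulrA mulrDr divff //; lra.
have B0 : 0 <= B by apply: le_trans (ltW PB).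
have ratio : egfc (p_ n) 1 / egfc (p_ n) 0 @[n --> \oo] --> b 1%N / b 0%N.
  by apply: cvgM; [exact: pb|apply: cvgV; [rewrite gt_eqF|exact: pb]].
have hu : \forall n \near \oo, gbound (b 0%N + 1) B (egfc (p_ n)).
  near=> n => k; have lp := hyperbolic_lpineq (hp n).
  have /andP[-> h] := lpineq_gbound lp k; rewrite (le_trans h) //=.
  have [e0 ek _ _] := lp.
  rewrite ler_pM ?exprn_ge0 ?divr_ge0 ?(ltW e0) //.
    apply: ltW; near: n; apply: cvgr_lt (pb 0%N) _ _; rewrite ltrDl //.
  rewrite lerXn2r ?nnegrE ?divr_ge0 ?(ltW e0) //.
  by apply: ltW; near: n; exact: cvgr_lt ratio _ PB.
apply: (@LP_cvg _ _ (fun n => iter n (fun p => p + (s / n%:R) *: heatop theta p) (p_ n))).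
  move=> n; move: (s / n%:R) (divr_ge0 s0 (ler0n R n)) (p_ n) (hp n) => x x0.
  elim: n => [//|n IH] p h; rewrite iterS; apply: hyperbolic_heat_step => //.
  exact: IH.
move=> k; have := euler_flow_cvg (k := k) th0 B0 s0 sB hu pb.
rewrite (_ : (fun n => iter n _ _ k) = (fun n => egfc (iter n (fun p =>
    p + (s / n%:R) *: heatop theta p) (p_ n)) k)) //.
apply/funext => n.
move: (s / n%:R) (p_ n) => x p.
elim: n k => [//|n IH] k; rewrite !iterS egfc_heat_step /heat_step.
by rewrite !IH.
Unshelve. all: by end_near. Qed.

End Flow.

(** * Products and exponential generating functions *)

Section BinomialConvolution.
Variable R : realType.
Implicit Types (b c : nat -> R) (M B : R) (p q : {poly R}).

Definition binconv b c k := \sum_(j < k.+1) 'C(k, j)%:R * (b j * c (k - j)%N).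

Definition unit_seq k : R := (k == 0%N)%:R.

Definition cpow n b := iter n (binconv b) unit_seq.

Definition rescale (a : R) b k := a ^+ k * b k.

Lemma egfc_mul p q : egfc (p * q) = binconv (egfc p) (egfc q).
Proof.
apply/funext => k; rewrite /egfc /binconv coefM mulr_sumr; apply: eq_bigr => j _.
rewrite -(bin_fact (ltn_ord j : (j <= k)%N)) !natrM.
move: (_`!%:R) (_`!%:R) (_%:R) => x y z; ring.
Qed.

Lemma egfc1 : egfc 1 = unit_seq.
Proof.
apply/funext => -[|k]; rewrite /egfc /unit_seq coef1 /= ?mulr1 ?mulr0 //.
Qed.

Lemma conv_geometric (C D B E : R) :
  binconv (fun k => C * B ^+ k) (fun k => D * E ^+ k) = (fun k => C * D * (B + E) ^+ k).
Proof.
apply/funext => k; rewrite [B + E]addrC exprDn mulr_sumr; apply: eq_bigr => j _.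
by rewrite -mulr_natl; ring.
Qed.

Lemma conv_le b c b' c' k : (forall j, 0 <= b j <= b' j) ->
  (forall j, 0 <= c j <= c' j) -> 0 <= binconv b c k <= binconv b' c' k.
Proof.
move=> hb hc; apply/andP; split.
  apply: sumr_ge0 => j _; rewrite !mulr_ge0 //.
    by have /andP[] := hb j.
  by have /andP[] := hc (k - j)%N.
apply: ler_sum => j _; rewrite ler_wpM2l //.
have /andP[? ?] := hb j; have /andP[? ?] := hc (k - j)%N.
exact: ler_pM.
Qed.

Lemma unit_seq_geometric k : unit_seq k = 1 * 0 ^+ k.
Proof. by rewrite /unit_seq expr0n mul1r. Qed.

Lemma cpow_geometric n C B k :
  cpow n (fun k => C * B ^+ k) k = C ^+ n * (n%:R * B) ^+ k.
Proof.
elim: n k => [|n IH] k; first by rewrite /= unit_seq_geometric expr0 mul0r.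
rewrite /cpow iterS -/(cpow n _) (_ : cpow n _ = fun k => C ^+ n * (n%:R * B) ^+ k).
  by rewrite conv_geometric exprS -[n.+1]add1n natrD mulrDl mul1r.
by apply/funext.
Qed.

Lemma cpow_le n b b' k : (forall j, 0 <= b j <= b' j) -> 0 <= cpow n b k <= cpow n b' k.
Proof.
move=> hb; elim: n k => [|n IH] k; first by rewrite /= /unit_seq lexx ler0n.
rewrite /cpow !iterS; exact: conv_le.
Qed.

Lemma cpow_gbound n M B b : gbound M B b -> gbound (M ^+ n) (n%:R * B) (cpow n b).
Proof. by move=> hb k; rewrite -cpow_geometric; exact: cpow_le. Qed.

Lemma rescale_gbound (a : R) M B b : 0 <= a -> gbound M B b -> gbound M (a * B) (rescale a b).
Proof.
move=> a0 hb k; have /andP[b0 bM] := hb k.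
rewrite /rescale mulr_ge0 ?exprn_ge0 //= exprMn mulrCA ler_wpM2l ?exprn_ge0 //.
Qed.

Lemma conv_gbound M B M' B' b c : gbound M B b -> gbound M' B' c ->
  gbound (M * M') (B + B') (binconv b c).
Proof.
move=> hb hc k; have := conv_le k hb hc; rewrite (congr1 (fun f => f k) (conv_geometric M M' B B')).
by [].
Qed.

Lemma cvg_sum_seq T (F : set_system T) {FF : Filter F} (I : Type) (r : seq I)
    (f : I -> T -> R) l : (forall j, f j x @[x --> F] --> l j) ->
  \sum_(j <- r) f j x @[x --> F] --> \sum_(j <- r) l j.
Proof.
move=> h; elim: r => [|j r IH].
  by rewrite big_nil; under eq_fun do rewrite big_nil; exact: cvg_cst.
rewrite big_cons; under eq_fun do rewrite big_cons.
exact: cvgD.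
Qed.

Lemma conv_cvg T (F : set_system T) {FF : Filter F} (u v : T -> nat -> R) b c k :
  (forall j, u x j @[x --> F] --> b j) -> (forall j, v x j @[x --> F] --> c j) ->
  binconv (u x) (v x) k @[x --> F] --> binconv b c k.
Proof.
move=> ub vc; apply: cvg_sum_seq => j; apply: cvgM; first exact: cvg_cst.
by apply: cvgM; [exact: ub|exact: vc].
Qed.

Lemma cpow_cvg T (F : set_system T) {FF : Filter F} n (u : T -> nat -> R) b k :
  (forall j, u x j @[x --> F] --> b j) -> cpow n (u x) k @[x --> F] --> cpow n b k.
Proof.
move=> ub; elim: n k => [|n IH] k; first exact: cvg_cst.
exact: conv_cvg.
Qed.

(** [ratio1] and [defect] are p and q, that is (log f)'(0) and -(log f)''(0); this is why they are
    additive under products. *)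
Definition ratio1 b := b 1%N / b 0%N.
Definition defect b := ratio1 b ^+ 2 - b 2%N / b 0%N.

Lemma conv0E b c : binconv b c 0 = b 0%N * c 0%N.
Proof. by rewrite /binconv big_ord1 mul1r. Qed.

Lemma conv1E b c : binconv b c 1 = b 0%N * c 1%N + b 1%N * c 0%N.
Proof. by rewrite /binconv !big_ord_recr big_ord0 /= add0r !mul1r. Qed.

Lemma conv2E b c : binconv b c 2 = b 0%N * c 2%N + 2 * b 1%N * c 1%N + b 2%N * c 0%N.
Proof. by rewrite /binconv !big_ord_recr big_ord0 /= add0r !mul1r mulrA. Qed.

Lemma cpow0E n b : cpow n b 0 = b 0%N ^+ n.
Proof. by elim: n => [//|n IH]; rewrite exprS /cpow iterS conv0E -/(cpow n b) IH. Qed.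

Lemma cpow_ratio1 n b : 0 < b 0%N -> ratio1 (cpow n b) = n%:R * ratio1 b.
Proof.
move=> b0; elim: n => [|n IH]; first by rewrite /ratio1 /= /unit_seq !mul0r.
rewrite -natr1 mulrDl -IH mul1r /ratio1 /cpow !iterS conv0E conv1E -/(cpow n b).
have : cpow n b 0 != 0 by rewrite cpow0E gt_eqF // exprn_gt0.
by move=> h; field; rewrite h gt_eqF.
Qed.

Lemma cpow_defect n b : 0 < b 0%N -> defect (cpow n b) = n%:R * defect b.
Proof.
move=> b0; elim: n => [|n IH].
  by rewrite /defect /ratio1 /= /unit_seq !mul0r expr0n subrr.
rewrite -natr1 mulrDl -IH mul1r /defect /ratio1 /cpow !iterS conv0E conv1E conv2E -/(cpow n b).
have : cpow n b 0 != 0 by rewrite cpow0E gt_eqF // exprn_gt0.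
by move=> h; field; rewrite h gt_eqF.
Qed.

Lemma rescale_ratio1 a b : ratio1 (rescale a b) = a * ratio1 b.
Proof. by rewrite /ratio1 /rescale expr0 expr1 mul1r mulrA. Qed.

Lemma rescale_defect a b : defect (rescale a b) = a ^+ 2 * defect b.
Proof.
rewrite /defect rescale_ratio1 /rescale expr0 mul1r exprMn -mulrA -mulrBr //.
Qed.

Lemma hyperbolic_mul p q : hyperbolic p -> hyperbolic q -> hyperbolic (p * q).
Proof.
move=> [c [s [c0 s0 ->]]] [d [t [d0 t0 ->]]]; exists (c * d), (s ++ t); split.
- by rewrite mulr_gt0.
- by rewrite all_cat s0 t0.
- by rewrite big_cat /= -scalerAl -scalerAr scalerA.
Qed.

Lemma LP_conv b c : LP b -> LP c -> LP (binconv b c).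
Proof.
move=> /LP_seq[p [hp pb]] /LP_seq[q [hq qc]].
apply: (@LP_cvg _ _ (fun n => p n * q n)); first by move=> n; exact: hyperbolic_mul.
by move=> k; under eq_fun do rewrite egfc_mul; exact: conv_cvg.
Qed.

Lemma LP_unit : LP unit_seq.
Proof.
apply: (@LP_cvg _ _ (fun=> 1)); last by move=> k; rewrite egfc1; exact: cvg_cst.
by move=> _; exists 1, [::]; rewrite big_nil scale1r.
Qed.

Lemma LP_cpow n b : LP b -> LP (cpow n b).
Proof. by move=> hb; elim: n => [|n IH]; [exact: LP_unit|exact: LP_conv]. Qed.

Lemma LP_rescale a b : 0 <= a -> LP b -> LP (rescale a b).
Proof.
move=> a0 /LP_seq[p [hp pb]].
apply: (@LP_cvg _ _ (fun n => p n \Po (a *: 'X))).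
  move=> n; have [c [s [c0 s0 ->]]] := hp n.
  exists c, [seq a * x | x <- s]; split => //.
    by rewrite all_map; apply: sub_all s0 => x /=; apply: mulr_ge0.
  rewrite comp_polyZ rmorph_prod big_map; congr (_ *: _); apply: eq_bigr => x _.
  by rewrite rmorphD /= rmorph1 comp_polyZ comp_polyX scalerA mulrC.
move=> k; have h : rescale a (egfc (p n)) k @[n --> \oo] --> rescale a b k.
  by apply: cvgM; [exact: cvg_cst|exact: pb].
rewrite (_ : (fun n => _) = fun n => rescale a (egfc (p n)) k) //.
apply/funext => n; rewrite /egfc /rescale comp_polyE mulrCA coef_sum; congr (_ * _).
under eq_bigr do rewrite coefZ exprZn coefZ coefXn.
have [kp|kp] := ltnP k (size (p n)).
  rewrite (bigD1 (Ordinal kp)) //= eqxx mulr1 big1 ?addr0 1?mulrC // => i ik.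
  by rewrite eq_sym (_ : (i == k :> nat) = false) ?mulr0 //; apply/negbTE.
rewrite big1 ?(nth_default _ kp) ?mulr0 // => i _.
by rewrite gtn_eqF ?mulr0 // (leq_trans (ltn_ord i)).
Qed.

Lemma LP_scale (a : R) b : 0 < a -> LP b -> LP (fun k => a * b k).
Proof.
move=> a0 /LP_seq[p [hp pb]].
apply: (@LP_cvg _ _ (fun n => a *: p n)).
  move=> n; have [c [s [c0 s0 ->]]] := hp n.
  by exists (a * c), s; split; rewrite ?scalerA ?mulr_gt0.
move=> k; rewrite /egfc; under eq_fun do rewrite coefZ mulrCA.
by apply: cvgM; [exact: cvg_cst|exact: pb].
Qed.

End BinomialConvolution.

(** * From coefficients to entire functions *)

Section ExponentialSeries.
Variable R : realType.
Implicit Types (b c : nat -> R) (M B z : R).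

Definition egf b z := limn (pseries (fun k => b k / k`!%:R) z).

Lemma egf_term_le M B b z k : gbound M B b -> 
  `|b k / k`!%:R * z ^+ k| <= M * exp_coeff (B * `|z|) k.
Proof.
move=> hb; rewrite /exp_coeff /= exprMn !normrM normrX.
rewrite (ger0_norm (gbound_ge0 k hb)) ger0_norm //.
have -> : M * (B ^+ k * `|z| ^+ k / k`!%:R) = M * B ^+ k * (k`!%:R)^-1 * `|z| ^+ k by ring.
have /andP[_ h] := hb k.
by rewrite ler_wpM2r ?exprn_ge0 // ler_wpM2r // invr_ge0.
Qed.

Lemma cvg_exp_bound M x : cvgn (series (fun k => M * exp_coeff x k)).
Proof. by apply: is_cvg_seriesZ; exact: is_cvg_series_exp_coeff. Qed.

Lemma cvg_egf M B b z : gbound M B b -> cvgn (pseries (fun k => b k / k`!%:R) z).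
Proof.
move=> hb; exact: series_dominated (@cvg_exp_bound M _) (fun k => egf_term_le z k hb).
Qed.

Lemma egf_norm_le M B b z : gbound M B b -> `|egf b z| <= M * expR (B * `|z|).
Proof.
move=> hb; have := series_norm_le (@cvg_exp_bound M _) (fun k => egf_term_le z k hb).
by rewrite limn_seriesZ //; exact: is_cvg_series_exp_coeff.
Qed.

Lemma egf_geometric (C B z : R) : egf (fun k => C * B ^+ k) z = C * expR (B * z).
Proof.
rewrite /expR -limn_seriesZ; last exact: is_cvg_series_exp_coeff.
congr (limn (series _)); apply/funext => k; rewrite /exp_coeff /= exprMn; ring.
Qed.

Lemma egf_rescale a b z : egf (rescale a b) z = egf b (a * z).
Proof.
congr (limn (series _)); apply/funext => k; rewrite /rescale /= exprMn; ring.
Qed.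

Lemma egf_scale M B b a z : gbound M B b -> egf (fun k => a * b k) z = a * egf b z.
Proof.
move=> hb; rewrite /egf -limn_seriesZ; last exact: cvg_egf hb.
by congr (limn (series _)); apply/funext => k; rewrite /= !mulrA.
Qed.

Lemma egf_cvg_to T (F : set_system T) {FF : ProperFilter F} M B (S : R)
    (u : T -> nat -> R) b (v : T -> R) z : 0 <= B ->
  (\forall x \near F, gbound M B (u x) /\ `|v x| <= S) ->
  (forall k, u x k @[x --> F] --> b k) -> v x @[x --> F] --> z ->
  egf (u x) (v x) @[x --> F] --> egf b z.
Proof.
move=> B0 hu ub vz.
apply: (@tannery R T F _ (fun x k => u x k / k`!%:R * v x ^+ k)
  (fun k => b k / k`!%:R * z ^+ k) (fun k => M * exp_coeff (B * S) k)).
- exact: cvg_exp_bound.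
- near=> x => k; have [hb vS] : gbound M B (u x) /\ `|v x| <= S by near: x.
  apply: le_trans (egf_term_le (v x) k hb) _.
  rewrite /exp_coeff /= ler_wpM2l ?(gbound_M_ge0 hb) // ler_wpM2r ?invr_ge0 //.
  have S0 : 0 <= S by apply: le_trans vS.
  by rewrite lerXn2r ?nnegrE ?mulr_ge0 // ler_wpM2l.
move=> k; apply: cvgM; first by apply: cvgM; [exact: ub|exact: cvg_cst].
rewrite /=; elim: k => [|k IH]; first exact: cvg_cst.
by rewrite exprS; under eq_fun do rewrite exprS; apply: cvgM.
Unshelve. all: by end_near. Qed.

Lemma egf_poly (p : {poly R}) z : egf (egfc p) z = p.[z].
Proof.
rewrite horner_coef; apply: (cvg_lim (@Rhausdorff R)).
rewrite (eq_bigr (fun k : 'I_(size p) => egfc p k / k`!%:R * z ^+ k)).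
  apply: series_finite => k kp.
  by rewrite /= /egfc nth_default // mulr0 !mul0r.
by move=> k _; rewrite /egfc [_ * p`_k]mulrC mulfK // pnatr_eq0 -lt0n fact_gt0.
Qed.

(** For truncations this is the evaluation of a product of polynomials; domination removes the
    truncation. *)
Lemma egf_conv M B M' B' b c z : 0 <= B -> 0 <= B' -> gbound M B b -> gbound M' B' c ->
  egf (binconv b c) z = egf b z * egf c z.
Proof.
move=> B0 B'0 hb hc.
pose tr (a : nat -> R) n : {poly R} := \poly_(k < n) (a k / k`!%:R).
have trE a n k : egfc (tr a n) k = if (k < n)%N then a k else 0.
  rewrite /egfc coef_poly; case: ifP => _; last by rewrite mulr0.
  by rewrite mulrC divfK // pnatr_eq0 -lt0n fact_gt0.
have tr_le M0 B0' a n : gbound M0 B0' a -> forall k, 0 <= egfc (tr a n) k <= a k.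
  by move=> ha k; rewrite trE; have a0 := gbound_ge0 k ha; case: ifP; rewrite ?lexx ?a0.
have tr_cvg (a : nat -> R) k : egfc (tr a n) k @[n --> \oo] --> a k.
  by apply: cvg_near_cst; near=> n; rewrite trE ifT //; near: n; exists k.+1.
have tr_gb M0 B0' a n : gbound M0 B0' a -> gbound M0 B0' (egfc (tr a n)).
  move=> ha k; have /andP[-> h] := tr_le _ _ _ n ha k.
  by rewrite (le_trans h) //; have /andP[] := ha k.
have h0 n : gbound (M * M') (B + B') (egfc (tr b n * tr c n)).
  by rewrite egfc_mul; apply: conv_gbound; exact: tr_gb.
have h1 : egf (egfc (tr b n * tr c n)) z @[n --> \oo] --> egf (binconv b c) z.
  apply: (@egf_cvg_to _ _ _ (M * M') (B + B') `|z|); first exact: addr_ge0.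
  - by near=> n.
  - by move=> k; under eq_fun do rewrite egfc_mul; exact: conv_cvg.
  - exact: cvg_cst.
have h2 : egf (egfc (tr b n)) z * egf (egfc (tr c n)) z @[n --> \oo] --> egf b z * egf c z.
  apply: cvgM.
    apply: (@egf_cvg_to _ _ _ M B `|z|) => //; last exact: cvg_cst.
    by near=> n; split=> //; exact: tr_gb.
  apply: (@egf_cvg_to _ _ _ M' B' `|z|) => //; last exact: cvg_cst.
  by near=> n; split=> //; exact: tr_gb.
apply: (cvg_unique (@Rhausdorff R) h1).
rewrite (_ : (fun n => _) = fun n => egf (egfc (tr b n)) z * egf (egfc (tr c n)) z) //.
by apply/funext => n; rewrite !egf_poly hornerM.
Unshelve. all: by end_near. Qed.

Lemma egf_unit z : egf (@unit_seq R) z = 1.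
Proof. by rewrite -egfc1 egf_poly hornerC. Qed.

Lemma egf_cpow M B b n z : 0 <= B -> gbound M B b -> egf (cpow n b) z = egf b z ^+ n.
Proof.
move=> B0 hb; elim: n => [|n IH]; first by rewrite egf_unit.
rewrite /cpow iterS -/(cpow n b) (egf_conv _ B0 _ hb (cpow_gbound n hb)) ?IH ?exprS //.
by rewrite mulr_ge0.
Qed.

Definition eshift b k : R := b k.+1.

Lemma eshift_gbound M B b : gbound M B b -> gbound (M * B) B (eshift b).
Proof. by move=> hb k; rewrite -mulrA -exprS; exact: hb. Qed.

Lemma egf_derive M B b z : gbound M B b -> is_derive z 1 (egf b) (egf (eshift b) z).
Proof.
move=> hb.
have D c : pseries_diffs (fun k => c k / k`!%:R) = (fun k => eshift c k / k`!%:R).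
  apply/funext => k; rewrite /pseries_diffs factS natrM invfM /eshift.
  by rewrite mulrCA mulVKf ?pnatr_eq0.
have := @pseries_snd_diffs R (fun k => b k / k`!%:R) (`|z| + 1) z.
rewrite !D; apply.
- exact: cvg_egf hb.
- exact: cvg_egf (eshift_gbound hb).
- exact: cvg_egf (eshift_gbound (eshift_gbound hb)).
- by rewrite [X in _ < X]ger0_norm ?addr_ge0 // ltrDl.
Qed.

Lemma egf_heat M B b theta z : gbound M B b ->
  egf (fun k => (theta + k%:R) * b k.+1) z =
  theta * egf (eshift b) z + z * egf (eshift (eshift b)) z.
Proof.
move=> hb; have h1 := cvg_egf (z := z) (eshift_gbound hb).
have h2 := cvg_egf (z := z) (eshift_gbound (eshift_gbound hb)).
have h3 : series (fun k => k%:R * b k.+1 / k`!%:R * z ^+ k) @ \oo -->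
    z * egf (eshift (eshift b)) z.
  rewrite -cvg_shiftS /=.
  have -> : (fun n => series (fun k => k%:R * b k.+1 / k`!%:R * z ^+ k) n.+1) =
     (fun n => z * pseries (fun k => eshift (eshift b) k / k`!%:R) z n).
    apply/funext => n; rewrite /pseries /series /= big_nat_recl //= !mul0r add0r mulr_sumr.
    apply: eq_bigr => k _; rewrite factS natrM exprS /eshift.
    have : k`!%:R != 0 :> R by rewrite pnatr_eq0 -lt0n fact_gt0.
    have : k.+1%:R != 0 :> R by rewrite pnatr_eq0.
    by move: (k.+1%:R) (k`!%:R) => x y x0 y0; field; rewrite x0 y0.
  by apply: cvgM; [exact: cvg_cst|exact: h2].
have h4 : theta * pseries (fun k => eshift b k / k`!%:R) z n +
   series (fun k => k%:R * b k.+1 / k`!%:R * z ^+ k) n @[n --> \oo] -->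
   theta * egf (eshift b) z + z * egf (eshift (eshift b)) z.
  by apply: cvgD => //; apply: cvgM; [exact: cvg_cst|exact: h1].
apply: (cvg_lim (@Rhausdorff R)).
rewrite (_ : pseries _ z = fun n => theta * pseries (fun k => eshift b k / k`!%:R) z n +
   series (fun k => k%:R * b k.+1 / k`!%:R * z ^+ k) n) //.
apply/funext => n; rewrite /pseries /series /= mulr_sumr -big_split /=.
by apply: eq_bigr => k _; rewrite /eshift; ring.
Qed.

End ExponentialSeries.

(** * The renormalization step *)

Lemma lpineq_defect_ge0 (R : realType) (c : nat -> R) : lpineq c -> 0 <= defect c.
Proof.
move=> [c0 ck h _]; rewrite /defect /ratio1 subr_ge0 expr_div_n.
rewrite ler_pdivlMr // ?exprn_gt0 // expr2.
have -> : c 2%N / c 0%N * (c 0%N * c 0%N) = c 0%N * c 2%N by field; rewrite gt_eqF.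
exact: h.
Qed.

(** * Differential inequalities for p and q along the flow *)

Section RiccatiInequalities.
Variables (R : realType) (theta s : R) (b : nat -> R).
Hypotheses (theta0 : 0 <= theta) (b0 : 0 < b 0%N) (b1 : 0 < b 1%N) (LPb : LP b).
Hypotheses (s0 : 0 <= s) (sP : s * ratio1 b < 1).

Implicit Types t x : R.

Let P0 := ratio1 b.
Let Q0 := defect b.
Let P t := ratio1 (flow theta t b).
Let Q t := defect (flow theta t b).
Let H t : R := 1 - t * P0.

Lemma is_derive_unique (f : R -> R) (x d d' : R) : is_derive x 1 f d -> is_derive x 1 f d' -> d = d'.
Proof. by move=> h h'; rewrite -(@derive_val _ _ _ _ _ _ _ h) (@derive_val _ _ _ _ _ _ _ h'). Qed.

Lemma is_derive_div (f g : R -> R) (x df dg : R) : g x != 0 ->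
  is_derive x 1 f df -> is_derive x 1 g dg ->
  is_derive x 1 (fun y => f y / g y) ((df - f x / g x * dg) / g x).
Proof.
move=> g0 hf hg; have hv := is_deriveV g0 hg.
apply: (is_derive_eq (is_deriveM hf hv)); rewrite /GRing.scale /=; field.
by rewrite g0.
Qed.

Let P00 : 0 < P0. Proof. by rewrite divr_gt0. Qed.

Let gb : gbound (b 0%N) P0 b.
Proof. exact/lpineq_gbound/lpineq_LP. Qed.

Let tP t : 0 <= t <= s -> `|t| * P0 < 1.
Proof.
move=> /andP[t0 ts]; rewrite ger0_norm //; apply: le_lt_trans sP.
by rewrite ler_wpM2r // ltW.
Qed.

Let H_gt0 t : 0 <= t <= s -> 0 < H t.
Proof. by move=> /[dup] /andP[t0 _] /tP; rewrite ger0_norm // subr_gt0. Qed.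

Lemma flow_stage_gt0 t k : 0 <= t <= s -> 0 < b k -> 0 < flow theta t b k.
Proof.
move=> /[dup] /andP[t0 ts] /tP; rewrite ger0_norm // => h bk.
exact: lt_le_trans bk (flow_ge _ theta0 (ltW P00) gb t0 h).
Qed.

Lemma flow_stage_LP t : 0 <= t <= s -> LP (flow theta t b).
Proof.
move=> /[dup] /andP[t0 ts] /tP; rewrite ger0_norm // => h.
exact: LP_flow.
Qed.

Let lpt t : 0 <= t <= s -> lpineq (flow theta t b).
Proof.
by move=> ht; apply: lpineq_LP; [exact: flow_stage_gt0|exact: flow_stage_LP].
Qed.

Let P_gt0 t : 0 <= t <= s -> 0 < P t.
Proof. by move=> ht; rewrite divr_gt0 // flow_stage_gt0. Qed.

Let Q_ge0 t : 0 <= t <= s -> 0 <= Q t.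
Proof. by move=> ht; apply: lpineq_defect_ge0; exact: lpt. Qed.

Let dflow t k : 0 <= t <= s ->
  is_derive t 1 (fun t => flow theta t b k) ((theta + k%:R) * flow theta t b k.+1).
Proof. by move=> ht; exact: flow_derive theta0 (ltW P00) gb (tP ht). Qed.

Lemma ratio1_flow_derive t : 0 <= t <= s ->
  is_derive t 1 P (P t ^+ 2 - (theta + 1) * Q t).
Proof.
move=> ht; have f0 := flow_stage_gt0 ht b0.
apply: (is_derive_eq (is_derive_div (lt0r_neq0 f0) (dflow 1 ht) (dflow 0 ht))); rewrite /Q /defect /P /ratio1.
by move: (lt0r_neq0 f0) => ?; field.
Qed.

Let dH t : is_derive t 1 H (- P0).
Proof.
have -> : H = cst 1 - (fun t => P0 *: (t : R^o)).
  by apply/funext => x; rewrite /H mulrC.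
by apply: is_derive_eq; rewrite sub0r /GRing.scale /= mulr1.
Qed.

Lemma defect_flow_derive t : 0 <= t <= s ->
  exists2 dQ, is_derive t 1 Q dQ & dQ <= 4 * P t * Q t.
Proof.
move=> ht; have f0 := flow_stage_gt0 ht b0.
have d2 := is_derive_div (lt0r_neq0 f0) (dflow 2 ht) (dflow 0 ht).
have dP := ratio1_flow_derive ht.
have dQ := is_deriveB (is_deriveM dP dP) d2.
exists (2 * P t * (P t ^+ 2 - (theta + 1) * Q t) -
   ((theta + 2) * flow theta t b 3 - flow theta t b 2 / flow theta t b 0
     * (theta * flow theta t b 1)) / flow theta t b 0).
  by apply: (is_derive_eq dQ); rewrite /GRing.scale /= addr0; ring.
(* The second Newton inequality at k = 1 bounds the third coefficient from below; that coefficient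
   enters Q' with a negative sign. *)
have [_ _ _ /(_ 1%N)] := lpt ht.
rewrite /Q /defect /P /ratio1.
move: (flow theta t b 0) (flow theta t b 1) (flow theta t b 2) (flow theta t b 3) f0.
move=> c0 c1 c2 c3 c00 h; rewrite -subr_ge0.
have -> : 4 * (c1 / c0) * ((c1 / c0) ^+ 2 - c2 / c0) -
    (2 * (c1 / c0) * ((c1 / c0) ^+ 2 - (theta + 1) * ((c1 / c0) ^+ 2 - c2 / c0)) -
     ((theta + 2) * c3 - c2 / c0 * (theta * c1)) / c0) =
   (theta + 2) / c0 ^+ 3 * (c0 ^+ 2 * c3 + 2 * (c1 ^+ 2 - c0 * c2) * c1 - c0 * c1 * c2).
  by field; rewrite gt_eqF.
by rewrite mulr_ge0 ?subr_ge0 // divr_ge0 ?addr_ge0 // exprn_ge0 // ltW.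
Qed.

Let in0s t x : 0 <= t <= s -> 0 <= x <= t -> 0 <= x <= s.
Proof. by move=> /andP[_ ts] /andP[-> xt]; exact: le_trans ts. Qed.

(** Since Q >= 0, P' <= P^2, so 1/P + t does not decrease. *)
Lemma ratio1_flow_le t : 0 <= t <= s -> P t * H t <= P0.
Proof.
move=> ht; pose f x := (P x)^-1 + x.
have df x : 0 <= x <= t -> is_derive x 1 f ((theta + 1) * Q x / P x ^+ 2).
  move=> hx; have hx' := in0s ht hx; have Pn0 := lt0r_neq0 (P_gt0 hx').
  have d := is_deriveD (is_deriveV Pn0 (ratio1_flow_derive hx')) (is_derive_id x 1).
  apply: (is_derive_eq d); rewrite /GRing.scale /=; field.
  by rewrite Pn0.
have : f 0 <= f t.
  have [t0 _] := andP ht.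
  apply: (le_of_derive_ge0 t0 df) => x hx; have hx' := in0s ht hx.
  apply: divr_ge0; last exact: sqr_ge0.
    by apply: mulr_ge0; [exact: addr_ge0|exact: Q_ge0].
rewrite /f /P flow0 -/P0 addr0 => h; have Pt := P_gt0 ht.
have : P0^-1 - t <= (P t)^-1 by rewrite lerBlDr.
rewrite -(ler_pM2l Pt) divff ?gt_eqF // -(ler_pM2r P00) mul1r; apply: le_trans.
rewrite -mulrA ler_wpM2l ?(ltW Pt) // mulrBl mulVf ?gt_eqF //.
Qed.

(** Q' <= 4 P Q together with P <= P0/H and H' = -P0 makes Q H^4 nonincreasing. *)
Lemma defect_flow_le t : 0 <= t <= s -> Q t * H t ^+ 4 <= Q0.
Proof.
move=> ht; pose f x := - (Q x * H x ^+ 4).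
have hd x : exists d : R, 0 <= x <= t -> is_derive x 1 f d /\ 0 <= d.
  have [hx|hx] := boolP (0 <= x <= t); last by exists 0 => h.
  have hx' := in0s ht hx; have [dQ h1 h2] := defect_flow_derive hx'.
  exists (- (dQ * H x ^+ 4 - 4 * P0 * H x ^+ 3 * Q x)) => _; split.
    apply: (is_derive_eq (is_deriveN (is_deriveM h1 (is_deriveX 4 (dH x))))).
    rewrite exprfctE /GRing.scale /=; ring.
  have Hx := H_gt0 hx'.
  have : 0 <= (4 * P x * Q x - dQ) * H x ^+ 4 + 4 * Q x * H x ^+ 3 * (P0 - P x * H x).
    apply: addr_ge0; first by rewrite mulr_ge0 ?subr_ge0 // exprn_ge0 // ltW.
    rewrite !mulr_ge0 ?Q_ge0 ?exprn_ge0 ?(ltW Hx) // subr_ge0.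
    exact: ratio1_flow_le.
  by congr (_ <= _); ring.
have /choice [d hd'] := hd.
have [t0 _] := andP ht.
have := le_of_derive_ge0 t0 (fun x hx => proj1 (hd' x hx)) (fun x hx => proj2 (hd' x hx)).
by rewrite /f /Q flow0 -/Q0 /H mul0r subr0 expr1n mulr1 lerN2.
Qed.

(** The derivative of P H^2 is (P H - P0)^2 - P0^2 - (theta + 1) Q H^2. The second summand cancels
    -P0^2, and the third compensates Q H^2 <= Q0 / H^2, since t/H has derivative 1/H^2. Hence [mono]
    does not decrease. *)
Let mono t := P t * H t ^+ 2 + P0 ^+ 2 * t + (theta + 1) * Q0 * (t / H t).

Let dmono t : 0 <= t <= s -> is_derive t 1 mono
  ((P t * H t - P0) ^+ 2 + (theta + 1) / H t ^+ 2 * (Q0 - Q t * H t ^+ 4)).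
Proof.
move=> ht; have Hn0 := lt0r_neq0 (H_gt0 ht).
have d1 := is_deriveM (ratio1_flow_derive ht) (is_deriveX 2 (dH t)).
have d2 := is_deriveZ (P0 ^+ 2) (is_derive_id t (1 : R)).
have d3 := is_deriveZ ((theta + 1) * Q0) (is_derive_div Hn0 (is_derive_id t 1) (dH t)).
apply: (is_derive_eq (is_deriveD (is_deriveD d1 d2) d3)).
by rewrite exprfctE /GRing.scale /=; move: Hn0; rewrite /H => h; field.
Qed.

Let dmono_ge0 t : 0 <= t <= s ->
  0 <= (P t * H t - P0) ^+ 2 + (theta + 1) / H t ^+ 2 * (Q0 - Q t * H t ^+ 4).
Proof.
move=> ht; rewrite addr_ge0 ?sqr_ge0 // mulr_ge0 ?subr_ge0 ?defect_flow_le //.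
by rewrite divr_ge0 ?addr_ge0 ?sqr_ge0.
Qed.

Let monole x y : 0 <= x -> x <= y -> y <= s -> mono x <= mono y.
Proof.
move=> x0 xy ys; have h z : x <= z <= y -> 0 <= z <= s.
  by move=> /andP[xz zy]; rewrite (le_trans x0 xz) (le_trans zy ys).
apply: (le_of_derive_ge0 xy (fun z hz => dmono (h z hz))) => z hz.
exact: dmono_ge0 (h z hz).
Qed.

Let mono0 : mono 0 = P0.
Proof. by rewrite /mono /P flow0 -/P0 /H mul0r subr0 expr1n mul0r !mulr0 !addr0 mulr1. Qed.

Lemma ratio1_flow_ge : P0 * H s - (theta + 1) * Q0 * s / H s <= P s * H s ^+ 2.
Proof.
have := monole (lexx 0) s0 (lexx s); rewrite mono0 /mono => h.
have -> : P0 * H s = P0 - P0 ^+ 2 * s by rewrite /H; ring.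
move: h; rewrite mulrA; lra.
Qed.

(** Equality at [s] would make [mono] constant, hence P H = P0 and Q H^4 = Q0 inside the interval,
    and these two identities contradict the equation for P. *)
Lemma ratio1_flow_gt : 0 < s -> 0 < Q0 ->
  P0 * H s - (theta + 1) * Q0 * s / H s < P s * H s ^+ 2.
Proof.
move=> sp Q0p; rewrite lt_neqAle ratio1_flow_ge andbT; apply/negP => /eqP e.
have ms : mono s = P0.
  rewrite /mono -e; have -> : P0 * H s = P0 - P0 ^+ 2 * s by rewrite /H; ring.
  by rewrite mulrA; ring.
have mc t : 0 <= t <= s -> mono t = P0.
  move=> /andP[t0 ts]; apply/eqP; rewrite eq_le.
  by have := monole t0 ts (lexx s); have := monole (lexx 0) t0 ts; rewrite ms mono0 => -> ->.
have ins t : t \in `]0, s[ -> 0 <= t <= s.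
  by rewrite in_itv /= => /andP[? ?]; rewrite !ltW.
have hz t : t \in `]0, s[ -> P t * H t = P0 /\ Q t * H t ^+ 4 = Q0.
  move=> ht; have ht' := ins t ht.
  have d0 : is_derive t 1 mono 0.
    (* [mono] is constant, so every interior point is a maximum. *)
    apply: (@derive1_at_max R mono 0 s t) => //.
    - by move=> x hx; have [] := dmono (ins x hx).
    - by move=> x hx; rewrite !mc // ins.
  have := is_derive_unique (dmono ht') d0.
  have h1 := sqr_ge0 (P t * H t - P0).
  have Hp := H_gt0 ht'.
  have c0 : 0 < (theta + 1) / H t ^+ 2 by rewrite divr_gt0 ?exprn_gt0 // ltr_wpDl.
  have h2 : 0 <= Q0 - Q t * H t ^+ 4 by rewrite subr_ge0 defect_flow_le.
  have h3 := mulr_ge0 (ltW c0) h2 => E; split.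
    have /eqP : (P t * H t - P0) ^+ 2 = 0 by lra.
    by rewrite sqrf_eq0 subr_eq0 => /eqP.
  have /eqP : (theta + 1) / H t ^+ 2 * (Q0 - Q t * H t ^+ 4) = 0 by lra.
  by rewrite mulf_eq0 (gt_eqF c0) /= subr_eq0 => /eqP.
pose m := s / 2; have hm : m \in `]0, s[ by rewrite in_itv /= /m; lra.
have hm' := ins m hm.
have dPH := is_deriveM (ratio1_flow_derive hm') (dH m).
have d0 : is_derive m 1 (P * H) 0.
  apply: (@derive1_at_max R (P * H) 0 s m) => //.
  - move=> x hx; have hx' := ins x hx.
    by have [] := is_deriveM (ratio1_flow_derive hx') (dH x).
  - move=> x hx; have [ex _] := hz x hx; have [em _] := hz m hm.
    by rewrite -[leLHS]/(P x * H x) -[leRHS]/(P m * H m) ex em.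
have := is_derive_unique dPH d0; rewrite /GRing.scale /=.
have [e1 e2] := hz m hm.
(* The constant P H would have derivative -(theta + 1) H Q, which is nonzero. *)
have -> : P m * - P0 + H m * (P m ^+ 2 - (theta + 1) * Q m) =
  - ((theta + 1) * H m * Q m) by rewrite -e1; ring.
move/eqP; rewrite oppr_eq0 !mulf_eq0 (gt_eqF (H_gt0 hm')).
have t1 : 0 < theta + 1 by rewrite ltr_wpDl.
rewrite (gt_eqF t1) /= => /eqP q0.
by move: Q0p; rewrite -e2 q0 mul0r ltxx.
Qed.

End RiccatiInequalities.

(** * Estimates for one renormalization step *)

Section Renormalization.
Variable R : realType.
Variables (delta : nat) (theta L E : R).
Hypotheses (theta0 : 0 <= theta) (L1 : 1 < L) (E1 : 1 < E)
  (dLE : delta%:R = E ^+ 4 * L ^+ 2).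
Implicit Types (b : nat -> R) (tau sigma T A : R).

Let L0 : 0 < L. Proof. exact: lt_trans ltr01 L1. Qed.
Let E0 : 0 < E. Proof. exact: lt_trans ltr01 E1. Qed.

(** The initial datum of a step as a function of z = (x,x): (delta L)^-1 = delta^-(1 + lambda) is
    the square of the scaling of x. *)
Definition rg_start b := rescale (delta%:R * L)^-1 (cpow delta b).

Definition rg_step tau b := flow theta tau (rg_start b).

Let d0 : delta%:R != 0 :> R.
Proof. by rewrite dLE mulf_neq0 // expf_neq0 // gt_eqF. Qed.

Lemma start0E b : rg_start b 0 = b 0%N ^+ delta.
Proof. by rewrite /rg_start /rescale expr0 mul1r cpow0E. Qed.

Lemma start_ratio1 b : 0 < b 0%N -> ratio1 (rg_start b) = ratio1 b / L.
Proof.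
move=> b0; rewrite rescale_ratio1 cpow_ratio1 // invfM -mulrA [_^-1 * (_ * _)]mulrCA.
by rewrite mulKf // mulrC.
Qed.

Lemma start_defect b : 0 < b 0%N -> defect (rg_start b) = defect b / (E ^+ 4 * L ^+ 4).
Proof.
move=> b0; rewrite rescale_defect cpow_defect //.
by rewrite dLE; field; rewrite !gt_eqF.
Qed.

Lemma start_gt0 b : 0 < b 0%N -> 0 < rg_start b 0.
Proof. by move=> b0; rewrite start0E exprn_gt0. Qed.

Lemma start1_gt0 b : 0 < b 0%N -> 0 < b 1%N -> 0 < rg_start b 1.
Proof.
move=> b0 b1; have : 0 < ratio1 (rg_start b) by rewrite start_ratio1 // !divr_gt0.
by rewrite /ratio1 pmulr_lgt0 // invr_gt0 start_gt0.
Qed.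

Lemma start_gbound M B b : gbound M B b -> gbound (M ^+ delta) (B / L) (rg_start b).
Proof.
move=> hb; have := rescale_gbound (a := (delta%:R * L)^-1) _ (cpow_gbound delta hb).
rewrite invr_ge0 mulr_ge0 ?(ltW L0) // => /(_ isT).
by congr gbound; field; rewrite d0 gt_eqF.
Qed.

Lemma start_le b b' k : (forall j, 0 <= b j <= b' j) -> 0 <= rg_start b k <= rg_start b' k.
Proof.
move=> hb; have /andP[h1 h2] := cpow_le delta k hb.
have c0 : 0 <= (delta%:R * L)^-1 ^+ k by rewrite exprn_ge0 // invr_ge0 mulr_ge0 ?(ltW L0).
by rewrite /rg_start /rescale mulr_ge0 //= ler_wpM2l.
Qed.

Lemma start_cvg X (F : set_system X) {FF : Filter F} (u : X -> nat -> R) b k :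
  (forall j, u x j @[x --> F] --> b j) -> rg_start (u x) k @[x --> F] --> rg_start b k.
Proof. by move=> ub; apply: cvgM; [exact: cvg_cst|exact: cpow_cvg]. Qed.

Lemma start_geometric (C B : R) k : rg_start (fun k => C * B ^+ k) k = C ^+ delta * (B / L) ^+ k.
Proof.
rewrite /rg_start /rescale cpow_geometric mulrCA -exprMn; congr (_ * _ ^+ _).
by field; rewrite d0 gt_eqF.
Qed.

Lemma LP_start b : LP b -> LP (rg_start b).
Proof.
by move=> hb; apply: LP_rescale; [rewrite invr_ge0 mulr_ge0 ?(ltW L0)|exact: LP_cpow].
Qed.

(* [etype A b]: the entire function with coefficients [b] has exponential type
   at most [A]. *)
Definition etype A b := forall B, A < B -> exists M, gbound M B b.

Lemma gbound_weaken M B B' b : 0 <= B -> B <= B' -> gbound M B b -> gbound M B' b.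
Proof.
move=> B0 BB' hb k; have /andP[-> h] := hb k; apply: le_trans h _.
rewrite ler_wpM2l ?(gbound_M_ge0 hb) // lerXn2r ?nnegrE //; exact: le_trans BB'.
Qed.

(** Rescaling divides the type by L, so any type below L/T can be flowed up to time T; [L - 2^-1]
    lies strictly between L - 1 and L. *)
Lemma etype_start_admissible T b : 0 < T -> etype ((L - 1) / T) b ->
  exists M B, [/\ 0 <= B, T * B < 1 & gbound M B (rg_start b)].
Proof.
move=> T0 hb; have h : (L - 1) / T < (L - 2^-1) / T.
  by rewrite ltr_pM2r ?invr_gt0 // ltrD2l ltrN2; lra.
have [M hM] := hb _ h; exists (M ^+ delta), ((L - 2^-1) / T / L); split.
- have h2 : 0 <= L - 2^-1 by have := L1; lra.
  by rewrite !divr_ge0 ?(ltW T0) ?(ltW L0).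
- have -> : T * ((L - 2^-1) / T / L) = 1 - (2 * L)^-1 by field; rewrite !gt_eqF.
  by rewrite gtrDl oppr_lt0 invr_gt0 mulr_gt0.
- exact: start_gbound.
Qed.

(** (L - 1)/T is the fixed point of B |-> (B/L) / (1 - T B/L), the change of type in a step of
    length T; a shorter step raises the type less. *)
Lemma etype_step T b tau : 0 < T -> 0 <= tau <= T -> etype ((L - 1) / T) b ->
  etype ((L - 1) / T) (rg_step tau b).
Proof.
move=> T0 /andP[t0 tT] hb B' AB'.
have B'0 : 0 < B'.
  by apply: le_lt_trans AB'; rewrite divr_ge0 ?(ltW T0) // subr_ge0 ltW.
have TB0 : 0 < 1 + T * B' by rewrite addr_gt0 // mulr_gt0.
(* The right side is the preimage of [B'] under that map, and it stays above the fixed point because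
   [B'] does. *)
have h : (L - 1) / T < L * B' / (1 + T * B').
  have AB2 : L - 1 < B' * T by rewrite -ltr_pdivrMr.
  by rewrite ltr_pdivrMr // mulrAC ltr_pdivlMr //; lra.
have [M /start_gbound hM] := hb _ h.
have e1 : L * B' / (1 + T * B') / L = B' / (1 + T * B') by field; rewrite !gt_eqF.
rewrite e1 in hM.
have B20 : 0 <= B' / (1 + T * B') by rewrite divr_ge0 // ltW.
have tB : tau * (B' / (1 + T * B')) < 1.
  rewrite mulrA ltr_pdivrMr // mul1r.
  have : tau * B' <= T * B' by rewrite ler_pM2r.
  lra.
have := flow_gbound theta0 B20 hM t0 tB.
set M' := (X in gbound X _ _) => hf; exists M'.
have D0 : 0 < 1 - tau * (B' / (1 + T * B')) by rewrite subr_gt0.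
apply: gbound_weaken hf; first by rewrite divr_ge0 // ltW.
rewrite ler_pdivrMr // ler_pdivrMr // -mulrA ler_peMr ?(ltW B'0) //.
rewrite mulrBl mul1r mulrA divfK ?gt_eqF //.
have : tau * B' <= T * B' by rewrite ler_pM2r.
lra.
Qed.

Section OneStep.
Variables (b : nat -> R) (tau : R).
Hypotheses (b0 : 0 < b 0%N) (b1 : 0 < b 1%N) (LPb : LP b) (tau0 : 0 <= tau).
Let x := tau * ratio1 b.
Let c := (theta + 1) * tau ^+ 2 * defect b.
Let b' := rg_step tau b.
Let x' := tau * ratio1 b'.
Let c' := (theta + 1) * tau ^+ 2 * defect b'.
Hypothesis xL : x < L.

Let s0 := start_gt0 b0.
Let s1 := start1_gt0 b0 b1.
Let LPs := LP_start LPb.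
Let tP : tau * ratio1 (rg_start b) < 1.
Proof. by rewrite start_ratio1 // mulrA ltr_pdivrMr // mul1r. Qed.
Let tin : 0 <= tau <= tau. Proof. by rewrite tau0 lexx. Qed.

Lemma step_LP : LP b'.
Proof. exact: (flow_stage_LP theta0 s0 s1 LPs tP tin). Qed.

Lemma step_ratio1_le : ratio1 b' * (1 - x / L) <= ratio1 b / L.
Proof.
have := ratio1_flow_le theta0 s0 s1 LPs tP tin.
by rewrite start_ratio1 // mulrA.
Qed.

Lemma step_defect_le : c' * (1 - x / L) ^+ 4 <= c / (E ^+ 4 * L ^+ 4).
Proof.
have := defect_flow_le theta0 s0 s1 LPs tP tin.
rewrite start_ratio1 // start_defect // mulrA => h.
by rewrite /c /c' -mulrA -[leRHS]mulrA ler_wpM2l // mulr_ge0 ?addr_ge0 ?sqr_ge0.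
Qed.

Lemma step_ratio1_ge :
  x / L * (1 - x / L) - c / (E ^+ 4 * L ^+ 4) / (1 - x / L) <= x' * (1 - x / L) ^+ 2.
Proof.
have := ratio1_flow_ge theta0 s0 s1 LPs tau0 tP.
rewrite start_ratio1 // start_defect // mulrA => h.
have := ler_wpM2l tau0 h; rewrite -/x /x' [tau * (_ * _)]mulrA.
apply: le_trans; rewrite /c /x le_eqVlt; apply/orP; left; apply/eqP; ring.
Qed.

Lemma step_ratio1_gt : 0 < tau -> 0 < defect b ->
  x / L * (1 - x / L) - c / (E ^+ 4 * L ^+ 4) / (1 - x / L) < x' * (1 - x / L) ^+ 2.
Proof.
move=> tp db; have := ratio1_flow_gt theta0 s0 s1 LPs tau0 tP tp.
rewrite start_ratio1 // start_defect // mulrA => h.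
have q0 : 0 < defect b / (E ^+ 4 * L ^+ 4) by rewrite divr_gt0 // mulr_gt0 // exprn_gt0.
have := h q0; rewrite -(ltr_pM2l tp) -/x /x' [tau * (_ * _)]mulrA.
apply: le_lt_trans; rewrite /c /x le_eqVlt; apply/orP; left; apply/eqP; ring.
Qed.

Lemma step_c_ge0 : 0 <= c.
Proof.
rewrite mulr_ge0 //; first by rewrite mulr_ge0 ?addr_ge0 ?sqr_ge0.
exact/lpineq_defect_ge0/lpineq_LP.
Qed.

(** At x = Xtop one has 1 - x/L = (L E)^-1, whose fourth power is exactly the factor 1 / (E^4 L^4)
    of [step_defect_le]. Up to this value of x the quantity c cannot increase. *)
Definition Xtop := L - E^-1.

Lemma Xtop_gt : L - 1 < Xtop.
Proof. by rewrite ltrD2l ltrN2 invf_lt1. Qed.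

Lemma Xtop_gt0 : 0 < Xtop.
Proof. by apply: lt_trans Xtop_gt; rewrite subr_gt0. Qed.

Lemma Xtop_lt : Xtop < L.
Proof. by rewrite gtrDl oppr_lt0 invr_gt0. Qed.

(* The largest [(theta + 1) tau^2 q] compatible with the hypothesis on [m_2]
   at [x = Xtop]. *)
Definition ctop := E ^+ 2 * L * (1 - E^-1) * Xtop.

Lemma ctop_gt0 : 0 < ctop.
Proof.
rewrite mulr_gt0 ?Xtop_gt0 // mulr_gt0 ?subr_gt0 ?invf_lt1 //.
by rewrite mulr_gt0 // exprn_gt0.
Qed.

Lemma oneminus_ge : x <= Xtop -> (L * E)^-1 <= 1 - x / L.
Proof.
move=> xX; have : x / L <= Xtop / L by rewrite ler_pM2r ?invr_gt0.
have -> : Xtop / L = 1 - (L * E)^-1 by rewrite /Xtop; field; rewrite !gt_eqF.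
lra.
Qed.

Lemma step_c_le : x <= Xtop -> c' <= c.
Proof.
move=> /oneminus_ge h; have h0 : 0 < (L * E)^-1 by rewrite invr_gt0 mulr_gt0.
have H0 : 0 < 1 - x / L := lt_le_trans h0 h.
have h4 : (L * E)^-1 ^+ 4 <= (1 - x / L) ^+ 4 by rewrite lerXn2r ?nnegrE // ltW.
have e : (E ^+ 4 * L ^+ 4)^-1 = (L * E)^-1 ^+ 4 by rewrite -exprMn mulrC exprVn.
have := step_defect_le; rewrite e => h1.
rewrite -(ler_pM2r (exprn_gt0 4 H0)); apply: le_trans h1 _.
by rewrite ler_wpM2l // step_c_ge0.
Qed.

(** At x = Xtop and c = ctop the lower bound for x' is exactly Xtop. Strictness comes from
    [ratio1_flow_gt] if q > 0, and from ctop > 0 otherwise. *)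
Lemma step_escape : x = Xtop -> c <= ctop -> Xtop < x'.
Proof.
move=> xX cc; have tp : 0 < tau.
  have h : 0 < tau * ratio1 b by rewrite -/x xX Xtop_gt0.
  rewrite lt_neqAle tau0 andbT eq_sym; apply: contraTneq h => ->.
  by rewrite mul0r ltxx.
have d1 : 1 - x / L = (L * E)^-1 by rewrite xX /Xtop; field; rewrite !gt_eqF.
have dp : 0 < (L * E)^-1 by rewrite invr_gt0 mulr_gt0.
have e : Xtop / L * (L * E)^-1 - ctop / (E ^+ 4 * L ^+ 4) / (L * E)^-1 =
    Xtop * (L * E)^-1 ^+ 2 by rewrite /ctop; field; rewrite !gt_eqF.
have e4 : 0 < E ^+ 4 * L ^+ 4 by rewrite mulr_gt0 // exprn_gt0.
rewrite -(ltr_pM2r (exprn_gt0 2 dp)) -e -d1.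
have [db|db] := ltP 0 (defect b).
  apply: le_lt_trans (step_ratio1_gt tp db); rewrite xX lerD2l lerN2.
  rewrite ler_pM2r ?invr_gt0 -?xX ?d1 // ler_pM2r ?invr_gt0 //.
apply: lt_le_trans step_ratio1_ge; rewrite xX ltrD2l ltrN2.
rewrite ltr_pM2r ?invr_gt0 -?xX ?d1 // ltr_pM2r ?invr_gt0 //.
apply: le_lt_trans ctop_gt0; rewrite /c mulr_ge0_le0 //.
by rewrite mulr_ge0 ?addr_ge0 ?sqr_ge0.
Qed.

(** x' <= x / (L - x), and L - x >= 1. *)
Lemma step_below : x <= L - 1 -> x' <= L - 1.
Proof.
move=> xL1; have H0 : 0 < 1 - x / L by rewrite subr_gt0 ltr_pdivrMr // mul1r.
have := ler_wpM2l tau0 step_ratio1_le; rewrite mulrA -/x' mulrA -/x.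
rewrite -ler_pdivlMr // => /le_trans; apply.
rewrite ler_pdivrMr // ler_pdivrMr //.
have -> : (L - 1) * (1 - x / L) * L = (L - 1) * (L - x) by field; rewrite gt_eqF.
have : L * x <= L * (L - 1) by rewrite ler_pM2l.
lra.
Qed.

End OneStep.

(** * Orbits as functions of tau, and the critical parameter *)

Section Orbit.
Variables (g : nat -> R) (T : R).
Hypotheses (T0 : 0 < T) (g0 : 0 < g 0%N) (g1 : 0 < g 1%N) (LPg : LP g)
  (gT : etype ((L - 1) / T) g).

Definition rg_orbit tau n := iter n (rg_step tau) g.

Lemma orbit_etype tau n : 0 <= tau <= T -> etype ((L - 1) / T) (rg_orbit tau n).
Proof. by move=> ht; elim: n => [//|n IH]; apply: etype_step. Qed.

Lemma etype_ge0 A b k : etype A b -> 0 <= b k.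
Proof.
move=> hb; have [|M hM] := hb (A + 1); first by rewrite ltrDl.
exact: gbound_ge0 hM.
Qed.

Lemma orbit_le sigma tau n k : 0 <= sigma -> sigma <= tau -> tau <= T ->
  0 <= rg_orbit sigma n k <= rg_orbit tau n k.
Proof.
move=> s0 st tT; have ht : 0 <= tau <= T by rewrite (le_trans s0).
have hs : 0 <= sigma <= T by rewrite s0 (le_trans st).
rewrite (etype_ge0 _ (orbit_etype n hs)) /=.
elim: n k => [//|n IH] k; rewrite /rg_orbit !iterS /rg_step.
have [M [B [B0 TB hB]]] := etype_start_admissible T0 (orbit_etype n ht).
apply: (flow_le _ theta0 B0 hB) => //.
  by apply: le_lt_trans TB; rewrite ler_wpM2r.
move=> j; apply: start_le => i; rewrite IH andbT.
exact: etype_ge0 (orbit_etype n hs).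
Qed.

Lemma orbit_gt0 tau n : 0 <= tau <= T -> 0 < rg_orbit tau n 0 /\ 0 < rg_orbit tau n 1.
Proof.
move=> /[dup] ht /andP[t0 tT]; elim: n => [//|n [IH0 IH1]].
have [M [B [B0 TB hB]]] := etype_start_admissible T0 (orbit_etype n ht).
have tB : tau * B < 1 by apply: le_lt_trans TB; rewrite ler_wpM2r.
split; apply: lt_le_trans (flow_ge _ theta0 B0 hB t0 tB).
  exact: start_gt0.
exact: start1_gt0.
Qed.

(** Extends everything that depends on the parameter from [0, T] to the whole line, so that
    continuity and openness refer to ordinary neighbourhoods. *)
Definition clamp sigma : R := Num.max 0 (Num.min sigma T).

Lemma clamp_in sigma : 0 <= clamp sigma <= T.
Proof.
rewrite /clamp le_max lexx /= ge_max (ltW T0) /=.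
by rewrite ge_min lexx orbT.
Qed.

Lemma clampK sigma : 0 <= sigma <= T -> clamp sigma = sigma.
Proof. by move=> /andP[s0 sT]; rewrite /clamp min_l // max_r. Qed.

Lemma clamp_cvg tau : clamp sigma @[sigma --> tau] --> clamp tau.
Proof.
apply: (@continuous_max _ R (cst 0) (fun x => Num.min x T)); first exact: cvg_cst.
apply: (@continuous_min _ R id (cst T)); first exact: cvg_id.
exact: cvg_cst.
Qed.

(** Orbits increase with the parameter, so the one at [T] dominates all others and supplies the
    uniform bound for continuity of the flow. *)
Lemma orbit_cvg tau n k :
  rg_orbit (clamp sigma) n k @[sigma --> tau] --> rg_orbit (clamp tau) n k.
Proof.
elim: n k tau => [|n IH] k tau; first exact: cvg_cst.
have TT : 0 <= T <= T by rewrite lexx ltW.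
have [M [B [B0 TB hB]]] := etype_start_admissible T0 (orbit_etype n TT).
apply: (@flow_cvg_to R R (nbhs tau) _ theta M B T
   (fun sigma => rg_start (rg_orbit (clamp sigma) n)) (rg_start (rg_orbit (clamp tau) n))
   clamp (clamp tau) k) => //.
- exact: ltW.
- near=> sigma; have /andP[c0 cT] := clamp_in sigma; split; last by rewrite ger0_norm.
  move=> j; have /andP[-> h] := @start_le (rg_orbit (clamp sigma) n) (rg_orbit T n) j
    (fun i => orbit_le n i c0 cT (lexx T)).
  by rewrite (le_trans h) //; have /andP[] := hB j.
- move=> j; apply: start_cvg => i; exact: IH.
- exact: clamp_cvg.
Unshelve. all: by end_near. Qed.

Definition xval sigma n := clamp sigma * ratio1 (rg_orbit (clamp sigma) n).
Definition cval sigma n := (theta + 1) * clamp sigma ^+ 2 * defect (rg_orbit (clamp sigma) n).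

Lemma xval_cvg tau n : xval sigma n @[sigma --> tau] --> xval tau n.
Proof.
apply: cvgM; first exact: clamp_cvg.
apply: cvgM; first exact: orbit_cvg.
apply: cvgV; last exact: orbit_cvg.
by have [h _] := orbit_gt0 n (clamp_in tau); rewrite gt_eqF.
Qed.

Lemma xval_ge0 sigma n : 0 <= xval sigma n.
Proof.
have [h0 h1] := orbit_gt0 n (clamp_in sigma); have /andP[c0 _] := clamp_in sigma.
by rewrite mulr_ge0 // divr_ge0 // ltW.
Qed.

Lemma orbit_LP sigma n : (forall m, (m < n)%N -> xval sigma m < L) ->
  LP (rg_orbit (clamp sigma) n).
Proof.
have /andP[c0 _] := clamp_in sigma.
elim: n => [//|n IH] h; have [h0 h1] := orbit_gt0 n (clamp_in sigma).
apply: step_LP => //; last exact: h.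
by apply: IH => m mn; apply: h; exact: ltnW.
Qed.

Lemma orbit_cval_le sigma n : (forall m, (m < n)%N -> xval sigma m <= Xtop) ->
  cval sigma n <= cval sigma 0.
Proof.
have /andP[c0 _] := clamp_in sigma.
elim: n => [//|n IH] h; have [h0 h1] := orbit_gt0 n (clamp_in sigma).
have hn m : (m < n)%N -> xval sigma m <= Xtop by move=> mn; apply: h; exact: ltnW.
apply: le_trans (IH hn); apply: step_c_le => //.
- by apply: orbit_LP => m mn; apply: le_lt_trans Xtop_lt; exact: hn.
- by apply: le_lt_trans Xtop_lt; exact: h.
- exact: h.
Qed.

(* The orbit leaves the band [L - 1 <= x <= Xtop] from below, resp. from above. *)
Definition exits_below sigma := exists n,
  xval sigma n < L - 1 /\ forall m, (m < n)%N -> xval sigma m <= Xtop.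
Definition exits_above sigma := exists n,
  Xtop < xval sigma n /\ forall m, (m < n)%N -> L - 1 <= xval sigma m.

Lemma exits_disjoint sigma : exits_below sigma -> exits_above sigma -> False.
Proof.
move=> [n [xn hn]] [m [xm hm]]; have [nm|mn|e] := ltngtP n m.
- by have := hm _ nm; rewrite leNgt xn.
- by have := hn _ mn; rewrite leNgt xm.
- have h := Xtop_gt; rewrite e in xn.
  by have := lt_trans (lt_trans xn h) xm; rewrite ltxx.
Qed.

Hypothesis gdefect : (theta + 1) * defect g <=
  E ^+ 2 * L * ((1 - E^-1) / Xtop) * ratio1 g ^+ 2.

(** The hypothesis on m_2, multiplied by tau^2, reads c <= (ctop / Xtop^2) x^2. *)
Lemma cval0_le_ctop sigma : xval sigma 0 <= Xtop -> cval sigma 0 <= ctop.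
Proof.
have /andP[c0 _] := clamp_in sigma.
move=> xX; have x0 := xval_ge0 sigma 0.
rewrite /cval [_ * clamp sigma ^+ 2]mulrC -mulrA.
apply: (@le_trans _ _ (clamp sigma ^+ 2 * (E ^+ 2 * L * ((1 - E^-1) / Xtop) * ratio1 g ^+ 2))).
  by rewrite ler_wpM2l ?sqr_ge0.
have -> : clamp sigma ^+ 2 * (E ^+ 2 * L * ((1 - E^-1) / Xtop) * ratio1 g ^+ 2) =
   E ^+ 2 * L * (1 - E^-1) / Xtop * xval sigma 0 ^+ 2 by rewrite /xval /=; ring.
have -> : ctop = E ^+ 2 * L * (1 - E^-1) / Xtop * Xtop ^+ 2.
  by rewrite /ctop; field; rewrite !gt_eqF // Xtop_gt0.
have cp : 0 <= E ^+ 2 * L * (1 - E^-1) / Xtop.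
  rewrite divr_ge0 ?(ltW Xtop_gt0) // mulr_ge0 ?subr_ge0 ?invf_le1 ?(ltW E1) //.
  by rewrite mulr_ge0 ?exprn_ge0 // ltW.
by rewrite ler_wpM2l // lerXn2r ?nnegrE // (ltW Xtop_gt0).
Qed.

(** While x <= Xtop, c has not increased, so c <= ctop still holds when the orbit touches the upper
    edge, and the next point lies above it. *)
Lemma band_escape sigma n : xval sigma n = Xtop ->
  (forall m, (m < n)%N -> xval sigma m <= Xtop) -> Xtop < xval sigma n.+1.
Proof.
have /andP[c0 _] := clamp_in sigma => xn hn.
have [h0 h1] := orbit_gt0 n (clamp_in sigma).
have x0 : xval sigma 0 <= Xtop.
  by case: (n) xn hn => [-> _|k _]; [exact: lexx|apply].
apply: step_escape => //.
- by apply: orbit_LP => m mn; apply: le_lt_trans Xtop_lt; exact: hn.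
- by rewrite -/(xval sigma n) xn; exact: Xtop_lt.
- exact: le_trans (orbit_cval_le hn) (cval0_le_ctop x0).
Qed.

Lemma near_all n (P : nat -> R -> Prop) tau :
  (forall m, (m < n)%N -> \forall sigma \near tau, P m sigma) ->
  \forall sigma \near tau, forall m, (m < n)%N -> P m sigma.
Proof.
elim: n => [|n IH] h; first by near=> sigma.
have h1 := IH (fun m mn => h m (ltnW mn)).
have h2 := h n (ltnSn n); near=> sigma => m; rewrite ltnS leq_eqVlt => /predU1P[->|].
  by near: sigma.
by move: m; near: sigma.
Unshelve. all: by end_near. Qed.

(** The closed conditions x <= Xtop are in fact strict: touching the edge would send the next point
    above Xtop, whereas the orbit is still below at that time. Finitely many strict conditions
    persist nearby. *)
Lemma exits_below_open tau : exits_below tau -> \forall sigma \near tau, exits_below sigma.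
Proof.
move=> [n [xn hn]].
have hlt m : (m < n)%N -> xval tau m < Xtop.
  move=> mn; rewrite lt_neqAle hn // andbT; apply/negP => /eqP e.
  have := band_escape e (fun k km => hn k (ltn_trans km mn)).
  have [mn'|mn'|e'] := ltngtP m.+1 n.
  - by rewrite ltNge hn.
  - by rewrite ltnNge mn in mn'.
  - by rewrite e' => /lt_trans /(_ xn) /(lt_trans Xtop_gt); rewrite ltxx.
have h1 : \forall sigma \near tau, xval sigma n < L - 1.
  by move: (@xval_cvg tau n) => /cvgr_lt; apply.
have h2 : \forall sigma \near tau, forall m, (m < n)%N -> xval sigma m < Xtop.
  by apply: near_all => m /hlt; move: (@xval_cvg tau m) => /cvgr_lt; apply.
near=> sigma; exists n; split; first by near: sigma.
move=> m mn; apply: ltW; move: m mn; near: sigma; exact: h2.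
Unshelve. all: by end_near. Qed.

Lemma band_below sigma n m : (n <= m)%N -> (forall k, (k < n)%N -> xval sigma k < L) ->
  xval sigma n <= L - 1 -> xval sigma m <= L - 1 /\ (forall k, (k < m)%N -> xval sigma k < L).
Proof.
have /andP[c0 _] := clamp_in sigma.
move=> + hn xn; elim: m => [|m IH]; first by rewrite leqn0 => /eqP e; rewrite -e.
rewrite leq_eqVlt => /predU1P[<- //|nm]; have [xm hm] := IH nm.
have [h0 h1] := orbit_gt0 m (clamp_in sigma).
have xmL : xval sigma m < L by apply: le_lt_trans xm _; rewrite gtrBl.
split.
  by apply: step_below => //; exact: orbit_LP.
by move=> k; rewrite ltnS leq_eqVlt => /predU1P[-> //|]; exact: hm.
Qed.

(** Here x >= L - 1 is strict before the exit, since a point at L - 1 would confine all later ones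
    to x <= L - 1. *)
Lemma exits_above_open tau : exits_above tau -> \forall sigma \near tau, exits_above sigma.
Proof.
move=> hex.
(* The first index above Xtop, so that the previous points are at most Xtop and hence below L. *)
have [n [xn hn hX]] : exists n, [/\ Xtop < xval tau n,
    forall m, (m < n)%N -> L - 1 <= xval tau m & forall m, (m < n)%N -> xval tau m <= Xtop].
  have ex : exists n, (Xtop < xval tau n) by case: hex => n [h _]; exists n.
  case: (ex_minnP ex) => n xn minn.
  exists n; split=> //.
    case: hex => k [xk hk] m mn; apply: hk; apply: leq_trans mn _; exact: minn.
  by move=> m mn; rewrite leNgt; apply/negP => /minn; rewrite leqNgt mn.
have hlt m : (m < n)%N -> L - 1 < xval tau m.
  move=> mn; rewrite lt_neqAle hn // andbT; apply/negP => /eqP e.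
  have [|h _] := @band_below tau m n (ltnW mn) _ (eq_ind _ (fun z => z <= L - 1) (lexx _) _ e).
    by move=> k km; apply: le_lt_trans Xtop_lt; apply: hX; exact: ltn_trans mn.
  by have := lt_le_trans (lt_trans Xtop_gt xn) h; rewrite ltxx.
have h1 : \forall sigma \near tau, Xtop < xval sigma n.
  by move: (@xval_cvg tau n) => /cvgr_gt; apply.
have h2 : \forall sigma \near tau, forall m, (m < n)%N -> L - 1 < xval sigma m.
  by apply: near_all => m /hlt; move: (@xval_cvg tau m) => /cvgr_gt; apply.
near=> sigma; exists n; split; first by near: sigma.
move=> m mn; apply: ltW; move: m mn; near: sigma; exact: h2.
Unshelve. all: by end_near. Qed.

(** Leaving below and leaving above are open and mutually exclusive. At the infimum of the
    parameters that do not leave below, neither can hold: the first would hold also at members of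
    that set close by, the second also at slightly smaller parameters, which leave below. *)
Lemma critical_exists : ~ exits_below T -> exists taus,
  [/\ 0 < taus <= T, forall tau, 0 <= tau < taus -> exits_below tau &
      forall n, L - 1 <= xval taus n <= Xtop].
Proof.
move=> nT; pose S := [set sigma : R | 0 <= sigma <= T /\ ~ exits_below sigma].
have ST : S T by split=> //; rewrite lexx ltW.
have Slb : lbound S 0 by move=> x [/andP[]].
have hinf : has_inf S by split; [exists T|exists 0].
pose ts := inf S.
have ts0 : 0 <= ts by apply: lb_le_inf => //; exists T.
have tsT : ts <= T by apply: ge_inf => //; exists 0.
have below tau : 0 <= tau < ts -> exits_below tau.
  move=> /andP[t0 tt]; apply: contrapT => nb.
  have : S tau by split=> //; rewrite t0 /= (le_trans (ltW tt)).
  by move=> /(ge_inf (ex_intro _ 0 Slb)); rewrite leNgt tt.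
have nts : ~ exits_below ts.
  move=> /exits_below_open /nbhs_ballP [r /= r0 hr].
  have [sg Ssg sgr] := inf_adherent r0 hinf.
  have [_] := Ssg; apply; apply: hr; rewrite /ball /= ltr_norml.
  have : ts <= sg by apply: ge_inf => //; exists 0.
  rewrite -/ts in sgr; lra.
have tsp : 0 < ts.
  rewrite lt_neqAle ts0 andbT; apply/negP => /eqP e; apply: nts; rewrite -e.
  exists 0%N; split=> //; rewrite /xval clampK ?lexx ?(ltW T0) // mul0r.
  by rewrite subr_gt0.
have nu : ~ exits_above ts.
  move=> /exits_above_open /nbhs_ballP [r /= r0 hr].
  pose sg := Num.max 0 (ts - r / 2).
  have s0 : 0 <= sg by rewrite le_max lexx.
  have st : sg < ts by rewrite gt_max tsp /= gtrDl oppr_lt0 divr_gt0.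
  have sr : ts - r / 2 <= sg by rewrite le_max lexx orbT.
  apply: (@exits_disjoint sg); first by apply: below; rewrite s0.
  by apply: hr; rewrite /ball /= ltr_norml; lra.
exists ts; split=> //; first by rewrite tsp.
move=> n; have [m] := ubnP n; elim: m n => // m IH n; rewrite ltnS => nm.
have hk k : (k < n)%N -> L - 1 <= xval ts k <= Xtop.
  by move=> kn; apply: IH; exact: leq_trans nm.
apply/andP; split; rewrite leNgt; apply/negP => h.
  by apply: nts; exists n; split=> // k /hk /andP[].
by apply: nu; exists n; split=> // k /hk /andP[].
Qed.

Lemma geometric_le_inv (c M a p : R) : 0 < c -> 0 < a -> 0 <= p ->
  (forall k, c * a ^+ k <= M * p ^+ k) -> a <= p.
Proof.
move=> c0 a0 p0 h; rewrite leNgt; apply/negP => pa.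
have M0 : 0 < M by have := h 0%N; rewrite !expr0 !mulr1; apply: lt_le_trans.
have r1 : `|p / a| < 1 by rewrite ger0_norm ?divr_ge0 ?(ltW a0) // ltr_pdivrMr // mul1r.
have := cvg_geometric M r1 => /cvgr_lt /(_ _ c0) [N _ /(_ N (leqnn N))] /=.
rewrite expr_div_n mulrA ltr_pdivrMr ?exprn_gt0 // ltNge.
by rewrite h.
Qed.

(** For tau = T the step maps exp(alpha z) to a multiple of itself, so every orbit element keeps a
    multiple of it as minorant. Comparing with the majorant of type p gives p >= alpha, that is x >=
    L - 1. *)
Lemma not_exits_below_type (alpha c : R) : 0 < alpha -> T = (L - 1) / alpha ->
  0 < c -> (forall k, c * alpha ^+ k <= g k) -> ~ exits_below T.
Proof.
move=> al0 TE c0 hc [n [xn hn]].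
have TT : 0 <= T <= T by rewrite lexx ltW.
have Tal : T * alpha = L - 1 by rewrite TE divfK // gt_eqF.
have [cn cn0 hcn] : exists2 cn : R, 0 < cn & forall k, cn * alpha ^+ k <= rg_orbit T n k.
  elim: n {xn hn} => [|n [cn cn0 IH]]; first by exists c.
  have [M [B [B0 TB hB]]] := etype_start_admissible T0 (orbit_etype n TT).
  have al1 : 1 - T * (alpha / L) = L^-1.
    by rewrite mulrA Tal; field; rewrite gt_eqF.
  exists (cn ^+ delta * (1 - T * (alpha / L)) `^ (- theta)).
    by rewrite mulr_gt0 ?exprn_gt0 // powR_gt0 // al1 invr_gt0.
  move=> k; have aL : 0 <= alpha / L by rewrite divr_ge0 // ltW.
  have TaL : T * (alpha / L) < 1 by rewrite -subr_gt0 al1 invr_gt0.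
  have := flow_geometric (cn ^+ delta) k theta0 aL (ltW T0) TaL.
  rewrite al1 (_ : alpha / L / L^-1 = alpha); last by rewrite invrK divfK // gt_eqF.
  move=> <-; apply: (flow_le _ theta0 B0 hB) => //; first exact: ltW.
  move=> j; rewrite -start_geometric; apply: start_le => i; rewrite IH andbT.
  by rewrite mulr_ge0 ?exprn_ge0 // ltW.
have [h0 h1] := orbit_gt0 n TT.
have := xn; rewrite /xval (clampK TT) -Tal ltr_pM2l // ltNge => /negP; apply.
have LPn : LP (rg_orbit T n).
  have := @orbit_LP T n; rewrite (clampK TT); apply => m mn.
  by apply: le_lt_trans Xtop_lt; exact: hn.
apply: (@geometric_le_inv cn (rg_orbit T n 0) alpha _ cn0 al0) => [|k]; first by rewrite divr_ge0 // ltW.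
apply: le_trans (hcn k) _.
by have /andP[] := lpineq_gbound (lpineq_LP h0 LPn) k.
Qed.

(** The initial point already lies above the band. *)
Lemma not_exits_below_large : Xtop < T * ratio1 g -> ~ exits_below T.
Proof.
have TT : 0 <= T <= T by rewrite lexx ltW.
move=> h [n [xn hn]]; have x0 : xval T 0 = T * ratio1 g by rewrite /xval (clampK TT).
case: n xn hn => [|n] xn hn.
  by have := lt_trans xn Xtop_gt; rewrite x0 ltNge (ltW h).
by have := hn 0%N isT; rewrite x0 leNgt h.
Qed.

(** Below L - 1 the bound p' <= p / (L - x) contracts: x does not increase any more, so the factor
    stays at most (L - x0)^-1 < 1, with [x0] the point of exit. *)
Lemma subcritical_limit tau : 0 <= tau <= T -> exits_below tau ->
  (forall n, LP (rg_orbit tau n)) /\ ratio1 (rg_orbit tau n) @[n --> \oo] --> (0 : R).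
Proof.
move=> ht [n0 [xn hn]]; have [t0 _] := andP ht.
have hL k : (k < n0)%N -> xval tau k < L by move=> /hn /le_lt_trans; apply; exact: Xtop_lt.
have h m : (n0 <= m)%N -> _ := fun nm => band_below nm hL (ltW xn).
have allL m : xval tau m < L.
  have [nm|mn] := leqP n0 m; last exact: hL.
  by have [/le_lt_trans hm _] := h m nm; apply: hm; rewrite gtrBl.
have allLP m : LP (rg_orbit tau m).
  by have := @orbit_LP tau m; rewrite (clampK ht); apply => k _.
split=> //.
have xE m : xval tau m = tau * ratio1 (rg_orbit tau m) by rewrite /xval (clampK ht).
have stp m : ratio1 (rg_orbit tau m.+1) * (L - xval tau m) <= ratio1 (rg_orbit tau m).
  have [b0 b1] := orbit_gt0 m ht.
  have xL : tau * ratio1 (rg_orbit tau m) < L by rewrite -xE.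
  have := step_ratio1_le b0 b1 (allLP m) t0 xL; rewrite -xE.
  rewrite -(ler_pM2r L0) divfK ?gt_eqF //.
  by congr (_ <= _); field; rewrite gt_eqF.
have p0 m : 0 <= ratio1 (rg_orbit tau m).
  by have [b0 b1] := orbit_gt0 m ht; rewrite divr_ge0 // ltW.
pose x0 := xval tau n0; pose r := (L - x0)^-1.
have x0L : 1 < L - x0 by rewrite ltrBrDr -ltrBrDl.
have r0 : 0 <= r by rewrite invr_ge0 (le_trans ler01) // ltW.
have r1 : r < 1 by rewrite invf_lt1 // (lt_trans ltr01).
have dec j : xval tau (n0 + j) <= x0 /\
    ratio1 (rg_orbit tau (n0 + j)) <= ratio1 (rg_orbit tau n0) * r ^+ j.
  elim: j => [|j [IH1 IH2]]; first by rewrite addn0 expr0 mulr1 lexx.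
  have hx : 0 < L - x0 by apply: lt_trans x0L.
  have hp : ratio1 (rg_orbit tau (n0 + j).+1) <= ratio1 (rg_orbit tau (n0 + j)) * r.
    rewrite ler_pdivlMr //; apply: le_trans (stp _).
    by rewrite ler_wpM2l // lerD2l lerN2.
  rewrite addnS; split.
    rewrite xE; apply: le_trans IH1; rewrite xE ler_wpM2l //.
    by apply: le_trans hp _; rewrite ler_piMr // ltW.
  by apply: le_trans hp _; rewrite exprSr mulrA ler_wpM2r.
rewrite -(cvg_shiftn n0) /=.
apply: (@squeeze_cvgr _ _ _ _ (fun=> 0) (fun j => ratio1 (rg_orbit tau n0) * r ^+ j)).
- near=> j; rewrite p0 /= addnC; by have [] := dec j.
- exact: cvg_cst.
- by apply: cvg_geometric; rewrite ger0_norm.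
Unshelve. all: by end_near. Qed.

(** Near a repelling fixed point a bounded orbit must converge to it: once the errors are small, a
    value at least [eta] grows by at least (L - 1) eta / 2 in each later step and finally exceeds
    [X]. *)
Lemma unstable_cvg0 (e a : nat -> R) (X : R) : (forall n, 0 <= e n <= X) ->
  (forall n, L * e n - a n <= e n.+1) -> a n @[n --> \oo] --> (0 : R) ->
  e n @[n --> \oo] --> (0 : R).
Proof.
move=> he hs a0; apply/cvgrPdist_lt => eta eta0.
have k0 : 0 < (L - 1) * eta / 2 by rewrite divr_gt0 // mulr_gt0 // subr_gt0.
have [N _ hN] := cvgr_lt _ a0 _ k0.
exists N => // n /= Nn; rewrite sub0r normrN; have /andP[en _] := he n.
rewrite ger0_norm // ltNge; apply/negP => h.
have grow j : eta + j%:R * ((L - 1) * eta / 2) <= e (n + j)%N.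
  elim: j => [|j IH]; first by rewrite mul0r addr0 addn0.
  rewrite addnS; apply: le_trans (hs _).
  have aj : a (n + j)%N < (L - 1) * eta / 2 by apply: hN => /=; rewrite (leq_trans Nn) ?leq_addr.
  have ej : eta <= e (n + j)%N by apply: le_trans IH; rewrite lerDl mulr_ge0 // ltW.
  have : (L - 1) * eta <= (L - 1) * e (n + j)%N by rewrite ler_wpM2l // subr_ge0 ltW.
  rewrite -natr1; lra.
have X0 : 0 <= X / ((L - 1) * eta / 2).
  rewrite divr_ge0 ?(ltW k0) //; have /andP[h1 h2] := he 0%N.
  exact: le_trans h2.
have := archi_boundP X0; rewrite ltr_pdivrMr // => hX.
have := grow (Num.bound (X / ((L - 1) * eta / 2))).
have /andP[_] := he (n + Num.bound (X / ((L - 1) * eta / 2)))%N.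
lra.
Qed.

(** * The critical orbit *)

Section Critical.
Variable taus : R.
Hypotheses (taus0 : 0 < taus) (tausT : taus <= T)
  (band : forall n, L - 1 <= xval taus n <= Xtop).

Let tin : 0 <= taus <= T. Proof. by rewrite (ltW taus0). Qed.
Let xE n : xval taus n = taus * ratio1 (rg_orbit taus n).
Proof. by rewrite /xval (clampK tin). Qed.
Let cE n : cval taus n = (theta + 1) * taus ^+ 2 * defect (rg_orbit taus n).
Proof. by rewrite /cval (clampK tin). Qed.
Let xL n : xval taus n < L.
Proof. by have /andP[_ /le_lt_trans] := band n; apply; exact: Xtop_lt. Qed.
Let xL' n : taus * ratio1 (rg_orbit taus n) < L. Proof. by rewrite -xE. Qed.

Lemma critical_LP n : LP (rg_orbit taus n).
Proof. by have := @orbit_LP taus n; rewrite (clampK tin); apply => k _. Qed.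

Let pos n := orbit_gt0 n tin.
Let d n := 1 - xval taus n / L.
Let dm := (L * E)^-1.
Let dm0 : 0 < dm. Proof. by rewrite invr_gt0 mulr_gt0. Qed.

Let x_lt n : xval taus n < Xtop.
Proof.
have /andP[_] := band n; rewrite le_eqVlt => /predU1P[e|//].
have := band_escape e (fun m _ => proj2 (andP (band m))).
by have /andP[_] := band n.+1; rewrite leNgt => /negbTE ->.
Qed.

Let d_gt n : dm < d n.
Proof.
have : xval taus n / L < Xtop / L by rewrite ltr_pM2r ?invr_gt0.
have -> : Xtop / L = 1 - dm by rewrite /Xtop /dm; field; rewrite !gt_eqF.
rewrite /d; lra.
Qed.

Let d_gt0 n : 0 < d n. Proof. exact: lt_trans dm0 (d_gt n). Qed.

Let dm4 : (E ^+ 4 * L ^+ 4)^-1 = dm ^+ 4.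
Proof. by rewrite /dm -exprMn mulrC exprVn. Qed.

Let c_ge0 n : 0 <= cval taus n.
Proof.
by have [b0 b1] := pos n; rewrite cE; exact: step_c_ge0 b0 (critical_LP n).
Qed.

Let c_step n : cval taus n.+1 * d n ^+ 4 <= cval taus n * dm ^+ 4.
Proof.
have [b0 b1] := pos n.
by rewrite !cE /d xE -dm4; exact: step_defect_le (critical_LP n) (ltW taus0) (xL' n).
Qed.

Let c_dec n : cval taus n.+1 <= cval taus 1.
Proof.
elim: n => [//|n IH]; apply: le_trans IH.
rewrite -(ler_pM2r (exprn_gt0 4 (d_gt0 n.+1))); apply: le_trans (c_step n.+1) _.
by rewrite ler_wpM2l // lerXn2r ?nnegrE ?(ltW dm0) ?(ltW (d_gt0 _)) // ltW.
Qed.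

Let x_step n : (1 - d n) * d n - cval taus n * dm ^+ 4 / d n <= xval taus n.+1 * d n ^+ 2.
Proof.
have [b0 b1] := pos n.
rewrite cE /d !xE subKr -dm4.
exact: step_ratio1_ge (critical_LP n) (ltW taus0) (xL' n).
Qed.

(** That x never passes Xtop keeps d = 1 - x/L away from its minimum dm by a uniform amount, and the
    factor (dm/d)^4 of c then gives geometric decay. *)
Lemma critical_cval_cvg : cval taus n @[n --> \oo] --> (0 : R).
Proof.
(* The initial point is strictly below Xtop, so the first step brings c strictly below ctop. *)
pose cb := ctop * (dm / d 0) ^+ 4.
have cb_lt : cb < ctop.
  rewrite gtr_pMr ?ctop_gt0 // exprn_ilt1 // ?divr_ge0 ?(ltW dm0) ?(ltW (d_gt0 _)) //.
  by rewrite ltr_pdivrMr // mul1r.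
have c1 : cval taus 1 <= cb.
  rewrite /cb expr_div_n mulrA ler_pdivlMr ?exprn_gt0 //.
  apply: le_trans (c_step 0) _; rewrite ler_wpM2r ?exprn_ge0 ?(ltW dm0) //.
  by apply: cval0_le_ctop; have /andP[] := band 0.
have X10 : 0 < 1 + Xtop by rewrite addr_gt0 // Xtop_gt0.
pose nu := (ctop - cb) * dm ^+ 4 / (1 + Xtop).
have nu0 : 0 < nu.
  by rewrite divr_gt0 // mulr_gt0 ?subr_gt0 // exprn_gt0.
have top : dm ^+ 2 - (1 + Xtop) * dm ^+ 3 = ctop * dm ^+ 4.
  by rewrite /ctop /Xtop /dm; field; rewrite !gt_eqF // -/Xtop.
(* From [x_step] and next x <= Xtop: (1 + Xtop) d^3 >= d^2 - c dm^4 >= dm^2 - cb dm^4. By [top] the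
   last expression exceeds (1 + Xtop) dm^3 by (ctop - cb) dm^4, which defines [nu]. *)
have d3 n : dm ^+ 3 + nu <= d n.+1 ^+ 3.
  have dn := d_gt0 n.+1.
  have h1 : d n.+1 ^+ 2 - d n.+1 ^+ 3 - cval taus n.+1 * dm ^+ 4 <= Xtop * d n.+1 ^+ 3.
    have /andP[_ hX] := band n.+2.
    have := le_trans (x_step n.+1) (ler_wpM2r (exprn_ge0 2 (ltW dn)) hX).
    rewrite -(ler_pM2r dn) mulrBl divfK ?gt_eqF //.
    by congr (_ <= _); ring.
  have h2 : cval taus n.+1 * dm ^+ 4 <= cb * dm ^+ 4.
    by rewrite ler_wpM2r ?exprn_ge0 ?(ltW dm0) // (le_trans (c_dec n)).
  have h3 : dm ^+ 2 <= d n.+1 ^+ 2.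
    by rewrite lerXn2r ?nnegrE ?(ltW dm0) ?(ltW dn) // ltW.
  have nuE : (1 + Xtop) * nu = (ctop - cb) * dm ^+ 4 by rewrite mulrC divfK ?gt_eqF.
  rewrite -(ler_pM2l X10) mulrDr nuE mulrBl.
  lra.
have D0 : 0 < dm ^+ 3 + nu by rewrite addr_gt0 // exprn_gt0.
pose rho := dm ^+ 3 / (dm ^+ 3 + nu).
have rho0 : 0 <= rho by rewrite divr_ge0 ?exprn_ge0 ?(ltW dm0) // ltW.
have rho1 : rho < 1 by rewrite ltr_pdivrMr // mul1r ltrDl.
have hc n : cval taus n.+1 <= cval taus 1 * rho ^+ n.
  elim: n => [|n IH]; first by rewrite expr0 mulr1.
  rewrite exprSr mulrA; apply: (@le_trans _ _ (cval taus n.+1 * rho)); last first.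
    by rewrite ler_wpM2r.
  rewrite mulrA ler_pdivlMr // -(ler_pM2r dm0).
  apply: le_trans (_ : cval taus n.+2 * d n.+1 ^+ 4 <= _).
    rewrite -mulrA ler_wpM2l // [leRHS]exprSr ler_pM ?(ltW dm0) ?(ltW D0) //.
    exact: ltW.
  rewrite (_ : cval taus n.+1 * dm ^+ 3 * dm = cval taus n.+1 * dm ^+ 4); last by ring.
  exact: c_step.
rewrite -cvg_shiftS.
apply: (@squeeze_cvgr _ _ _ _ (fun=> 0) (fun n => cval taus 1 * rho ^+ n)).
- by near=> n; rewrite c_ge0 hc.
- exact: cvg_cst.
- by apply: cvg_geometric; rewrite ger0_norm.
Unshelve. all: by end_near. Qed.

Lemma critical_ratio1_cvg : ratio1 (rg_orbit taus n) @[n --> \oo] --> (L - 1) / taus.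
Proof.
have h : xval taus n - (L - 1) @[n --> \oo] --> (0 : R).
  apply: (@unstable_cvg0 _ (fun n => cval taus n * dm) Xtop).
  - move=> n; have /andP[h1 h2] := band n; rewrite subr_ge0 h1 /=.
    by apply: le_trans h2; rewrite gerBl subr_ge0 ltW.
  - move=> n; have dn := d_gt0 n; have /andP[h1 _] := band n.
    have h2 : (1 - d n) / d n - cval taus n * dm <= xval taus n.+1.
      rewrite -(ler_pM2r (exprn_gt0 2 dn)); apply: le_trans (x_step n).
      have -> : ((1 - d n) / d n - cval taus n * dm) * d n ^+ 2 =
        (1 - d n) * d n - cval taus n * (dm * d n ^+ 2) by field; rewrite gt_eqF.
      rewrite lerD2l lerN2 -mulrA ler_wpM2l // ler_pdivrMr //.
      have -> : dm * d n ^+ 2 * d n = dm * d n ^+ 3 by ring.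
      rewrite exprS ler_wpM2l ?(ltW dm0) // lerXn2r ?nnegrE ?(ltW dm0) ?(ltW dn) //.
      exact: ltW.
    (* The right side equals L (x - (L - 1)) / (L - x), and L - x <= 1 in the band. *)
    have h3 : L * (xval taus n - (L - 1)) <= (1 - d n) / d n - (L - 1).
      have dL : L * d n = L - xval taus n by rewrite /d; field; rewrite gt_eqF.
      have xE' : xval taus n = L - L * d n by rewrite dL opprB addrC subrK.
      have -> : (1 - d n) / d n - (L - 1) = (xval taus n - (L - 1)) / d n.
        by rewrite xE'; field; rewrite gt_eqF.
      rewrite ler_pdivlMr // mulrAC dL ler_piMl ?subr_ge0 //.
      by rewrite lerBlDr -lerBlDl.
    lra.
  - rewrite -[X in _ --> X](mul0r dm); apply: cvgM; last exact: cvg_cst.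
    exact: critical_cval_cvg.
have -> : (fun n => ratio1 (rg_orbit taus n)) =
    (fun n => (xval taus n - (L - 1)) / taus + (L - 1) / taus).
  by apply/funext => n; rewrite xE; field; rewrite gt_eqF.
rewrite -[X in _ --> X]add0r -[X in _ --> X + _](mul0r taus^-1).
by apply: cvgD; [apply: cvgM => //; exact: cvg_cst|exact: cvg_cst].
Qed.

Lemma critical_defect_cvg : defect (rg_orbit taus n) @[n --> \oo] --> (0 : R).
Proof.
have k0 : (theta + 1) * taus ^+ 2 != 0.
  by rewrite mulf_neq0 ?gt_eqF ?exprn_gt0 // ltr_wpDl.
have -> : (fun n => defect (rg_orbit taus n)) =
   (fun n => cval taus n / ((theta + 1) * taus ^+ 2)).
  by apply/funext => n; rewrite cE mulrC mulKf.
rewrite -[X in _ --> X](mul0r ((theta + 1) * taus ^+ 2)^-1).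
by apply: cvgM; [exact: critical_cval_cvg|exact: cvg_cst].
Qed.

End Critical.

End Orbit.

End Renormalization.

(** * Normalization *)

Section Normalization.
Variables (R : realType) (delta : nat) (theta L tau : R) (g : nat -> R).
Hypotheses (theta0 : 0 <= theta) (L0 : 0 < L) (delta1 : (1 < delta)%N)
  (tau0 : 0 <= tau) (gg : g 0%N = 1).

Local Notation st := (rg_start delta L).
Local Notation orb := (rg_orbit delta theta L).

Lemma conv_scaler (a : R) b c k : binconv b (fun j => a * c j) k = a * binconv b c k.
Proof. by rewrite /binconv mulr_sumr; apply: eq_bigr => j _; ring. Qed.

Lemma conv_scalel (a : R) b c k : binconv (fun j => a * b j) c k = a * binconv b c k.
Proof. by rewrite /binconv mulr_sumr; apply: eq_bigr => j _; ring. Qed.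

Lemma cpow_scale n (a : R) b k : cpow n (fun j => a * b j) k = a ^+ n * cpow n b k.
Proof.
elim: n k => [|n IH] k; first by rewrite expr0 mul1r.
rewrite /cpow !iterS -/(cpow n _) (_ : cpow n _ = fun j => a ^+ n * cpow n b j).
  by rewrite conv_scaler conv_scalel mulrA -exprSr.
exact/funext.
Qed.

Lemma start_scale (a : R) b : st (fun j => a * b j) = fun j => a ^+ delta * st b j.
Proof. by apply/funext => k; rewrite /rg_start /rescale cpow_scale mulrCA. Qed.

(** The two Newton inequalities squeeze the coefficient k + 2 between p u_(k+1) - (k + 1) q u_k and
    p u_(k+1), so q -> 0 forces the exponential. *)
Lemma LP_cvg_geometric (u : nat -> nat -> R) (P : R) : (forall n, LP (u n)) ->
  (forall n, u n 0%N = 1) -> ratio1 (u n) @[n --> \oo] --> P ->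
  defect (u n) @[n --> \oo] --> (0 : R) -> forall k, u n k @[n --> \oo] --> P ^+ k.
Proof.
move=> hu u1 hP hQ.
have ul n : lpineq (u n) by apply: lpineq_LP => //; rewrite u1.
have P1 n : ratio1 (u n) = u n 1%N by rewrite /ratio1 u1 divr1.
have Q1 n : defect (u n) = u n 1%N ^+ 2 - u n 2%N by rewrite /defect P1 u1 divr1.
suff H k : u n k @[n --> \oo] --> P ^+ k /\ u n k.+1 @[n --> \oo] --> P ^+ k.+1.
  by move=> k; have [] := H k.
elim: k => [|k [IH1 IH2]]; split=> //.
- by under eq_fun do rewrite u1; exact: cvg_cst.
- by under eq_fun do rewrite -P1.
apply: (@squeeze_cvgr _ _ _ _
  (fun n => ratio1 (u n) * u n k.+1 - k.+1%:R * defect (u n) * u n k)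
  (fun n => ratio1 (u n) * u n k.+1)).
- near=> n; rewrite Q1 P1.
  have [_ _ /(_ k.+1) + /(_ k)] := ul n; rewrite u1 expr1n !mul1r => -> /=.
  by rewrite lerBlDr => ->.
- have -> : P ^+ k.+2 = P * P ^+ k.+1 - k.+1%:R * 0 * P ^+ k by rewrite mulr0 mul0r subr0 exprS.
  apply: cvgB; first exact: cvgM.
  by apply: cvgM => //; apply: cvgM => //; exact: cvg_cst.
- by rewrite [P ^+ k.+2]exprS; exact: cvgM.
Unshelve. all: by end_near. Qed.

Variable P : R.
Hypotheses (pos : forall n, 0 < orb g tau n 0) (oLP : forall n, LP (orb g tau n))
  (adm : forall n, exists M B : R, [/\ 0 <= B, tau * B < 1 & gbound M B (st (orb g tau n))])
  (P0 : 0 <= P) (tP : tau * P < 1)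
  (hP : ratio1 (st (orb g tau n)) @[n --> \oo] --> P)
  (hQ : defect (st (orb g tau n)) @[n --> \oo] --> (0 : R))
  (sLP : forall n, LP (st (orb g tau n))).

Let sg n := st (orb g tau n).
Let sg0 n : 0 < sg n 0.
Proof. by rewrite /sg /rg_start /rescale expr0 mul1r cpow0E exprn_gt0. Qed.
Let e n k := (sg n 0)^-1 * sg n k.

Let e0 n : e n 0%N = 1. Proof. by rewrite /e mulVf // gt_eqF. Qed.

Let eLP n : LP (e n). Proof. by apply: LP_scale; [rewrite invr_gt0|exact: sLP]. Qed.

Let e_cvg k : e n k @[n --> \oo] --> P ^+ k.
Proof.
apply: LP_cvg_geometric => //.
  rewrite (_ : (fun n => ratio1 (e n)) = (fun n => ratio1 (sg n))) //.
  apply/funext => n; by rewrite /ratio1 /e; field; rewrite !gt_eqF.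
rewrite (_ : (fun n => defect (e n)) = (fun n => defect (sg n))) //.
apply/funext => n.
by rewrite /defect /ratio1 /e; field; rewrite !gt_eqF.
Qed.

Let e_gbound (B : R) : P < B -> \forall n \near \oo, gbound 1 B (e n).
Proof.
move=> PB; near=> n => k; have e00 : 0 < e n 0%N by rewrite e0.
have lp := lpineq_LP e00 (eLP n).
have /andP[-> h] := lpineq_gbound lp k; apply: le_trans h _; rewrite e0 !mul1r divr1.
have [_ ek _ _] := lp.
rewrite lerXn2r ?nnegrE //; first exact: le_trans (ltW PB).
apply: ltW; near: n.
by have := @e_cvg 1; rewrite expr1 => /cvgr_lt; apply.
Unshelve. all: by end_near. Qed.

Let exB : exists2 B : R, P < B & tau * B < 1.
Proof.
have [->|tn0] := eqVneq tau 0; first by exists (P + 1); rewrite ?ltrDl // mul0r.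
have tp : 0 < tau by rewrite lt_neqAle eq_sym tn0.
have : P < tau^-1 by rewrite -[tau^-1]mul1r ltr_pdivlMr // mulrC.
move=> h; exists ((P + tau^-1) / 2); first by lra.
have -> : tau * ((P + tau^-1) / 2) = (tau * P + 1) / 2 by field.
have := tP; lra.
Qed.

(** Logarithm of the factor by which the flow raises the constant term; [rinf] is its value for the
    limit exp(P z). *)
Let r n := ln (flow theta tau (e n) 0).
Let rinf := - theta * ln (1 - tau * P).

Let flow_e_ge1 n : 1 <= flow theta tau (e n) 0.
Proof.
have [M [B [B0 tB hB]]] := adm n.
have hb : gbound ((sg n 0)^-1 * M) B (e n).
  move=> k; have /andP[h1 h2] := hB k; rewrite /e.
  by rewrite mulr_ge0 ?invr_ge0 ?(ltW (sg0 n)) //= -mulrA ler_wpM2l // invr_ge0 ltW.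
by have := flow_ge 0 theta0 B0 hb tau0 tB; rewrite e0.
Qed.

Let r_cvg : r n @[n --> \oo] --> rinf.
Proof.
have [B PB tB] := exB; have B0 : 0 <= B by apply: le_trans (ltW PB).
have pP : 0 < 1 - tau * P by rewrite subr_gt0.
have h : flow theta tau (e n) 0 @[n --> \oo] --> (1 - tau * P) `^ (- theta).
  have h : flow theta tau (e n) 0 @[n --> \oo] --> flow theta tau (fun k => 1 * P ^+ k) 0.
    apply: (@flow_cvg_to R nat \oo _ theta 1 B tau e _ (fun=> tau)) => //.
    - near=> n; split; last by rewrite ger0_norm.
      by near: n; exact: e_gbound.
    - by move=> k; rewrite mul1r; exact: e_cvg.
    - exact: cvg_cst.
  by move: h; rewrite flow_geometric // expr0 mul1r mulr1.
have -> : rinf = ln ((1 - tau * P) `^ (- theta)) by rewrite ln_powR.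
by apply: continuous_cvg h; apply: continuous_ln; rewrite powR_gt0.
Unshelve. all: by end_near. Qed.

Let D : R := delta%:R.
Let D1 : 1 < D. Proof. by rewrite ltr1n. Qed.
Let D0 : 0 < D. Proof. exact: lt_trans ltr01 D1. Qed.

Let rbound : exists M : R, forall n, `|r n| <= M.
Proof.
have /cvg_seq_bounded /= [M [_ hM]] : cvgn r by apply/cvg_ex; exists rinf; exact: r_cvg.
by exists (M + 1) => n; apply: hM => //; rewrite ltrDl.
Qed.

Let term n i := (D^-1) ^+ i.+1 * r (n + i)%N.

(* [s_n] is the bounded solution of [s_(n+1) = delta s_n + r_n]. *)
Let s n := - limn (series (term n)).

Let cvg_dom (M : R) : cvgn (series (fun i => M * (D^-1) ^+ i.+1)).
Proof.
have -> : (fun i => M * (D^-1) ^+ i.+1) = (fun i => M * D^-1 * (D^-1) ^+ i).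
  by apply/funext => i; rewrite exprS mulrA.
by apply: cvg_geometric_pos; rewrite invr_ge0 (ltW D0) invf_lt1.
Qed.

Let term_le (M : R) n i : (forall n, `|r n| <= M) -> `|term n i| <= M * (D^-1) ^+ i.+1.
Proof.
have h : 0 <= D^-1 ^+ i.+1 by rewrite exprn_ge0 // invr_ge0 ltW.
by move=> hM; rewrite normrM mulrC (ger0_norm h) ler_wpM2r.
Qed.

Let s_rec n : s n.+1 = D * s n + r n.
Proof.
have [M hM] := rbound.
have ct m : cvgn (series (term m)) := series_dominated (@cvg_dom M) (fun i => term_le m i hM).
have h := series_shift (ct n).
have e1 : (fun i => term n i.+1) = (fun i => D^-1 * term n.+1 i).
  by apply/funext => i; rewrite /term addnS addSn exprS mulrA.
have h2 : limn (series (fun i => term n i.+1)) = limn (series (term n)) - term n 0.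
  exact: cvg_lim h.
rewrite e1 limn_seriesZ // in h2.
rewrite /s -[limn (series (term n.+1))](mulKf (lt0r_neq0 D0)) mulrC.
have -> : limn (series (term n.+1)) = D * (D^-1 * limn (series (term n.+1))).
  by rewrite mulrA divff ?mul1r // gt_eqF.
rewrite h2 /term addn0 expr1; field; rewrite gt_eqF //.
Qed.

Let s_cvg : s n @[n --> \oo] --> - rinf / (D - 1).
Proof.
have [M hM] := rbound.
rewrite mulNr; apply: cvgN.
have -> : rinf / (D - 1) = limn (series (fun i => (D^-1) ^+ i.+1 * rinf)).
  have E : (fun i => (D^-1) ^+ i.+1 * rinf) = geometric (rinf * D^-1) D^-1.
    by apply/funext => i; rewrite exprS /=; ring.
  have D1' : `|D^-1| < 1 by rewrite ger0_norm ?invr_ge0 ?(ltW D0) // invf_lt1.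
  rewrite E (cvg_lim _ (cvg_geometric_series D1')) //; field.
  by rewrite subr_eq0 !gt_eqF //= subr_gt0.
apply: (@tannery R nat \oo _ term _ (fun i => M * (D^-1) ^+ i.+1)).
- exact: cvg_dom.
- by near=> n => i; exact: term_le.
- move=> i; apply: cvgM; first exact: cvg_cst.
  by have := r_cvg; rewrite -(cvg_shiftn i).
Unshelve. all: by end_near. Qed.

(** A factor C in the datum becomes C^(delta^n) after n steps, which is the freedom delta^n in the
    recurrence for s. This choice selects the bounded solution, so that the constant terms exp(s n)
    converge. *)
Definition normalizer := expR (s 0).

Let orbit0E n : normalizer ^+ (delta ^ n) * orb g tau n 0 = expR (s n).
Proof.
elim: n => [|n IH]; first by rewrite expr1 /= gg mulr1.
rewrite s_rec expRD mulrC expRM_natl -IH exprMn -exprM -expnSr.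
rewrite mulrC -mulrA; congr (_ * _).
rewrite /r lnK ?posrE; last exact: lt_le_trans ltr01 (flow_e_ge1 n).
have [M [B [B0 tB hB]]] := adm n.
have tB' : `|tau| * B < 1 by rewrite ger0_norm.
have <- : sg n 0 = orb g tau n 0 ^+ delta.
  by rewrite /sg /rg_start /rescale expr0 mul1r cpow0E.
rewrite [in RHS](flow_scale (sg n 0)^-1 0 theta0 B0 hB tB') mulrCA mulrA mulVf ?gt_eqF //.
by rewrite mul1r.
Qed.

Lemma orbit_scale (a : R) n :
  orb (fun k => a * g k) tau n = fun k => a ^+ (delta ^ n) * orb g tau n k.
Proof.
elim: n => [|n IH]; first by rewrite expr1.
rewrite /rg_orbit iterS -/(orb _ tau n) IH /rg_step start_scale.
have [M [B [B0 tB hB]]] := adm n.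
have tB' : `|tau| * B < 1 by rewrite ger0_norm.
apply/funext => k; rewrite (flow_scale _ _ theta0 B0 hB tB') -exprM -expnSr.
by rewrite /rg_orbit iterS.
Qed.

Lemma normalizer_gt0 : 0 < normalizer. Proof. exact: expR_gt0. Qed.

(** exp(delta s) at s = -rinf / (delta - 1), the fixed point of s = delta s + rinf. *)
Let K := expR (- delta%:R * (- theta * ln (1 - tau * P)) / (delta%:R - 1)).

Let startE n : st (orb (fun k => normalizer * g k) tau n) =
  fun k => expR (s n) ^+ delta * e n k.
Proof.
rewrite orbit_scale start_scale -orbit0E exprMn; apply/funext => k.
rewrite /e -mulrA; congr (_ * _).
have <- : sg n 0 = orb g tau n 0 ^+ delta.
  by rewrite /sg /rg_start /rescale expr0 mul1r cpow0E.
by rewrite mulrA divff ?mul1r // gt_eqF.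
Qed.

Let factor_cvg : expR (s n) ^+ delta @[n --> \oo] --> K.
Proof.
have -> : (fun n => expR (s n) ^+ delta) = (fun n => expR (D * s n)).
  by apply/funext => n; rewrite expRM_natl.
apply: continuous_cvg; first exact: continuous_expR.
rewrite -mulrA mulNr -mulrN -[X in _ * X]mulNr; apply: cvgM; first exact: cvg_cst.
exact: s_cvg.
Qed.

Lemma normalized_start_cvg k :
  st (orb (fun k => normalizer * g k) tau n) k @[n --> \oo] --> K * P ^+ k.
Proof. by under eq_fun do rewrite startE; apply: cvgM. Qed.

Lemma normalized_start_gbound (B : R) : P < B -> \forall n \near \oo,
  gbound (K + 1) B (st (orb (fun k => normalizer * g k) tau n)).
Proof.
move=> PB; have B0 : 0 <= B by apply: le_trans (ltW PB).
near=> n => k; rewrite startE.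
have /(_ k) /andP[e1 e2] : gbound 1 B (e n) by near: n; exact: e_gbound.
rewrite mul1r in e2; rewrite mulr_ge0 ?exprn_ge0 ?expR_ge0 //=.
rewrite ler_pM ?exprn_ge0 ?expR_ge0 //; apply: ltW; near: n.
by move: factor_cvg => /cvgr_lt; apply; rewrite ltrDl.
Unshelve. all: by end_near. Qed.

End Normalization.

(** * Laguerre entire functions *)

Section ComplexTopology.
Variable R : realType.
Implicit Types (z w : R[i]).

Lemma cmodE z : cmod z = Num.sqrt (complex.Re z ^+ 2 + complex.Im z ^+ 2).
Proof. by rewrite /cmod normc_def. Qed.

Lemma cmod_real (x : R) : cmod x%:C = `|x|.
Proof. by rewrite cmodE /= expr0n addr0 sqrtr_sqr. Qed.

Lemma cmodC z : (cmod z)%:C = `|z|.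
Proof. by rewrite /cmod normc_def. Qed.

Lemma cmod_ge0 z : 0 <= cmod z.
Proof. by rewrite cmodE sqrtr_ge0. Qed.

Lemma Re_le_cmod z : `|complex.Re z| <= cmod z.
Proof. by have := normc_ge_Re z; rewrite -cmodC lecR. Qed.

Lemma Im_le_cmod z : `|complex.Im z| <= cmod z.
Proof. by rewrite cmodE -[X in X <= _]sqrtr_sqr ler_wsqrtr // lerDr sqr_ge0. Qed.

Lemma ReB z w : complex.Re (z - w) = complex.Re z - complex.Re w.
Proof. by case: z => a b; case: w. Qed.

Lemma ImB z w : complex.Im (z - w) = complex.Im z - complex.Im w.
Proof. by case: z => a b; case: w. Qed.

Lemma cvgC_dist T (F : set_system T) {FF : Filter F} (f : T -> R[i]) z :
  ((f x : R[i]^o) @[x --> F] --> (z : R[i]^o)) <->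
  (forall e : R, 0 < e -> \forall x \near F, cmod (z - f x) < e).
Proof.
split=> [/cvgrPdist_lt h e e0|h].
  have := h e%:C; rewrite ltcR => /(_ e0); apply: filterS => x.
  by rewrite -[`|_|]cmodC ltcR.
(* In the order of [R[i]] a positive number has zero imaginary part, so real radii suffice. *)
apply/cvgrPdist_lt => -[e e'] /=; rewrite ltcE /= => /andP[/eqP -> e0].
by apply: filterS (h e e0) => x; rewrite -[`|_|]cmodC ltcR.
Qed.

Lemma cvgC_Re T (F : set_system T) {FF : Filter F} (f : T -> R[i]) z :
  ((f x : R[i]^o) @[x --> F] --> (z : R[i]^o)) ->
  complex.Re (f x) @[x --> F] --> complex.Re z.
Proof.
move=> /cvgC_dist h; apply/cvgrPdist_lt => e /h; apply: filterS => x.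
by apply: le_lt_trans; rewrite -ReB Re_le_cmod.
Qed.

Lemma cvgC_Im T (F : set_system T) {FF : Filter F} (f : T -> R[i]) z :
  ((f x : R[i]^o) @[x --> F] --> (z : R[i]^o)) ->
  complex.Im (f x) @[x --> F] --> complex.Im z.
Proof.
move=> /cvgC_dist h; apply/cvgrPdist_lt => e /h; apply: filterS => x.
by apply: le_lt_trans; rewrite -ImB Im_le_cmod.
Qed.

Lemma cvgC_real T (F : set_system T) {FF : Filter F} (f : T -> R) (l : R) :
  f x @[x --> F] --> l -> ((f x)%:C : R[i]^o) @[x --> F] --> (l%:C : R[i]^o).
Proof.
move=> /cvgrPdist_lt h; apply/cvgC_dist => e /h; apply: filterS => x.
by rewrite -rmorphB /= cmod_real.
Qed.

Lemma cvgC_unique T (F : set_system T) {FF : ProperFilter F} (f : T -> R[i]) z w :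
  ((f x : R[i]^o) @[x --> F] --> (z : R[i]^o)) ->
  ((f x : R[i]^o) @[x --> F] --> (w : R[i]^o)) -> z = w.
Proof.
move=> hz hw.
have h1 := cvg_unique (@Rhausdorff R) (cvgC_Re hz) (cvgC_Re hw).
have h2 := cvg_unique (@Rhausdorff R) (cvgC_Im hz) (cvgC_Im hw).
by case: z w {hz hw} h1 h2 => a b [c d] /= -> ->.
Qed.

Lemma cexp_real (x : R) : cexp x%:C = (expR x)%:C.
Proof. by rewrite /cexp /= cos0 sin0 mulr1. Qed.

End ComplexTopology.

(** * Coefficients of Laguerre functions *)

Section LaguerreCoefficients.
Variable R : realType.
Implicit Types (b : nat -> R) (x B M : R).

Lemma mul1_conv x b : mul1 x b = binconv (egfc (1 + x *: 'X)) b.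
Proof.
have e0 : egfc (1 + x *: 'X) 0 = 1.
  by rewrite /egfc coefD coef1 coefZ coefX /= mulr0 addr0 mulr1.
have e1 : egfc (1 + x *: 'X) 1 = x.
  by rewrite /egfc coefD coef1 coefZ coefX /= mulr1 add0r mul1r.
have e2 j : egfc (1 + x *: 'X) j.+2 = 0.
  by rewrite /egfc coefD coef1 coefZ coefX /= mulr0 addr0 mulr0.
apply/funext => -[|k]; rewrite /binconv.
  by rewrite big_ord1 e0 !mul1r /mul1 mul0r mul0r addr0.
rewrite big_ord_recl big_ord_recl /= big1 => [|i _]; last first.
  by rewrite /bump /= e2 mul0r mulr0.
by rewrite /mul1 /bump /= e0 e1 bin0 bin1 subn0 subn1 /=; ring.
Qed.

Lemma LP_mul1 x b : 0 <= x -> LP b -> LP (mul1 x b).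
Proof.
move=> x0 hb; rewrite mul1_conv; apply: LP_conv => //.
apply: (@LP_cvg _ _ (fun=> 1 + x *: 'X)) => [_|k]; last exact: cvg_cst.
by exists 1, [:: x]; rewrite /= x0 big_seq1 scale1r.
Qed.

Lemma pow_bernoulli (B x : R) k : 0 <= B -> 0 <= x ->
  B ^+ k + k%:R * x * B ^+ k.-1 <= (B + x) ^+ k.
Proof.
move=> B0 x0; elim: k => [|[|k] IH]; first by rewrite !mul0r addr0.
  by rewrite !expr1 expr0 mulr1 mul1r.
rewrite exprS; apply: le_trans (ler_wpM2l (addr_ge0 B0 x0) IH) => /=.
rewrite -[k.+2%:R]natr1 [B ^+ k.+1]exprS.
have : 0 <= k.+1%:R * x * x * B ^+ k by rewrite !mulr_ge0 // exprn_ge0.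
move: (k.+1%:R) (B ^+ k) => c p; rewrite -subr_ge0 => h; rewrite -subr_ge0.
by move: h; rewrite subr0; congr (_ <= _); ring.
Qed.

Lemma mul1_gbound M B x b : 0 <= B -> 0 <= x -> gbound M B b -> gbound M (B + x) (mul1 x b).
Proof.
move=> B0 x0 hb k; have M0 := gbound_M_ge0 hb.
have /andP[b0 bM] := hb k; have /andP[b0' bM'] := hb k.-1.
rewrite /mul1 addr_ge0 // ?mulr_ge0 //=.
apply: (@le_trans _ _ (M * (B ^+ k + k%:R * x * B ^+ k.-1))); last first.
  by rewrite ler_wpM2l // pow_bernoulli.
rewrite mulrDr lerD // mulrCA ler_wpM2l // mulr_ge0 //.
Qed.

(** The factor k produced by 1 + x z is absorbed by a slightly larger base: k eta B'^(k-1) <= (B' +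
    eta)^k. *)
Lemma mul1_etype A x b : 0 <= A -> 0 <= x -> etype A b -> etype A (mul1 x b).
Proof.
move=> A0 x0 hb B AB; pose B' := (A + B) / 2; pose eta := B - B'.
have AB' : A < B' by rewrite /B'; lra.
have eta0 : 0 < eta by rewrite /eta /B'; lra.
have B'0 : 0 <= B' by apply: le_trans (ltW AB').
have [M hM] := hb _ AB'; have M0 := gbound_M_ge0 hM; exists (M * (1 + x / eta)) => k.
have /andP[b0 bM] := hM k; have /andP[b0' bM'] := hM k.-1.
rewrite /mul1 addr_ge0 // ?mulr_ge0 //=.
have -> : B = B' + eta by rewrite addrC subrK.
have h := pow_bernoulli k B'0 (ltW eta0).
have p1 : 0 <= k%:R * eta * B' ^+ k.-1 by rewrite !mulr_ge0 ?exprn_ge0 // ltW.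
have p2 : 0 <= B' ^+ k by rewrite exprn_ge0.
have -> : M * (1 + x / eta) * (B' + eta) ^+ k =
  M * (B' + eta) ^+ k + M * (x / eta * (B' + eta) ^+ k) by ring.
rewrite lerD //.
  by apply: le_trans bM _; rewrite ler_wpM2l //; apply: le_trans h; rewrite lerDl.
apply: (@le_trans _ _ (k%:R * x * (M * B' ^+ k.-1))).
  by rewrite ler_wpM2l // mulr_ge0.
have -> : k%:R * x * (M * B' ^+ k.-1) = M * (x / eta * (k%:R * eta * B' ^+ k.-1)).
  by field; rewrite gt_eqF.
rewrite ler_wpM2l // ler_wpM2l ?divr_ge0 ?(ltW eta0) //.
by apply: le_trans h; rewrite lerDr.
Qed.

Lemma egf_mul1 M B x b z : 0 <= B -> 0 <= x -> gbound M B b ->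
  egf (mul1 x b) z = (1 + x * z) * egf b z.
Proof.
move=> B0 x0 hb; rewrite mul1_conv.
have h : gbound 1 x (egfc (1 + x *: 'X)).
  case=> [|[|k]]; rewrite /egfc coefD coef1 coefZ coefX /=.
  - by rewrite mulr0 addr0 /= !mulr1 ler01 lexx.
  - by rewrite mulr1 add0r !mul1r expr1 x0 lexx.
  - by rewrite mulr0 addr0 mulr0 lexx mul1r exprn_ge0.
by rewrite (egf_conv _ x0 B0 h hb) egf_poly !hornerE.
Qed.

Lemma LP_exp (a : R) : 0 <= a -> LP (fun k => a ^+ k).
Proof.
move=> a0.
apply: (@LP_cvg _ _ (fun n => (1 + (a / n%:R) *: 'X) ^+ n)).
  move=> n; have h0 : 0 <= a / n%:R by rewrite divr_ge0.
  elim: n (a / n%:R) h0 => [|n IH] x x0.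
    by exists 1, [::]; rewrite expr0 big_nil scale1r.
  rewrite exprS; apply: hyperbolic_mul; last exact: IH.
  by exists 1, [:: x]; rewrite /= x0 big_seq1 scale1r.
move=> k; have E x n j : egfc ((1 + x *: 'X) ^+ n) j = ('C(n, j) * j`!)%:R * x ^+ j.
  elim: n j => [|n IH] j.
    rewrite expr0 egfc1 /unit_seq; case: j => [|j] /=; first by rewrite mulr1.
    by rewrite mul0n mul0r.
  rewrite exprS egfc_mul1 /mul1 !IH; case: j => [|j] /=.
    by rewrite !mul0r addr0 !bin0.
  rewrite binS mulnDl natrD mulrDl; congr (_ + _).
  by rewrite factS !natrM exprS; ring.
have h : ('C(n, k) * k`!)%:R / n%:R ^+ k * a ^+ k @[n --> \oo] --> a ^+ k.
  rewrite -[X in _ --> X]mul1r; apply: cvgM; last exact: cvg_cst.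
  exact: falling_ratio_cvg.
rewrite (_ : (fun n => _) = (fun n => ('C(n, k) * k`!)%:R / n%:R ^+ k * a ^+ k)) //.
by apply/funext => n; rewrite E expr_div_n mulrAC mulrA.
Qed.

Section Sequence.
Variables (alpha : R) (gamma : nat -> R).
Hypotheses (alpha0 : 0 <= alpha) (gamma0 : forall j, 0 <= gamma j)
  (cgamma : cvgn (series gamma)).

Fixpoint lag_partial n : nat -> R :=
  if n is n'.+1 then mul1 (gamma n') (lag_partial n') else fun k => alpha ^+ k.

(** Multiplying by 1 + gamma_j z increases all coefficients, which stay below those of exp((alpha +
    sum gamma) z), so this is a genuine limit. *)
Definition lag_coef k := limn (fun n => lag_partial n k).

Let S := limn (series gamma).

Let seriesS n : series gamma n <= S.
Proof. exact: nondecreasing_cvgn_le (nondecreasing_series (fun j _ _ => gamma0 j)) cgamma n. Qed.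

Let series0 n : 0 <= series gamma n.
Proof. by apply: sumr_ge0 => j _. Qed.

Lemma lag_partial_gbound n : gbound 1 (alpha + series gamma n) (lag_partial n).
Proof.
elim: n => [|n IH] /=; first by move=> k; rewrite /series /= big_geq // addr0 mul1r exprn_ge0 /=.
rewrite seriesSr addrA; apply: mul1_gbound => //.
by rewrite addr_ge0.
Qed.

Lemma lag_partial_gboundS n : gbound 1 (alpha + S) (lag_partial n).
Proof.
apply: gbound_weaken (lag_partial_gbound n); first exact: addr_ge0.
by rewrite lerD2l.
Qed.

Lemma lag_partial_ge0 n k : 0 <= lag_partial n k.
Proof. exact: gbound_ge0 (lag_partial_gbound n). Qed.

Lemma lag_partial_le n m k : (n <= m)%N -> lag_partial n k <= lag_partial m k.
Proof.
elim: m => [|m IH]; first by rewrite leqn0 => /eqP ->.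
rewrite leq_eqVlt => /predU1P[-> //|/IH h]; apply: le_trans h _ => /=.
by rewrite /mul1 lerDl !mulr_ge0 // lag_partial_ge0.
Qed.

Lemma lag_coef_cvg k : lag_partial n k @[n --> \oo] --> lag_coef k.
Proof.
apply: nondecreasing_is_cvgn; first by move=> n m; exact: lag_partial_le.
exists (1 * (alpha + S) ^+ k) => _ [n _ <-].
by have /andP[] := lag_partial_gboundS n k.
Qed.

Lemma lag_partial_lag_coef n k : lag_partial n k <= lag_coef k.
Proof.
apply: limr_ge; first by apply/cvg_ex; eexists; exact: lag_coef_cvg.
by near=> m; apply: lag_partial_le; near: m; exists n.
Unshelve. all: by end_near. Qed.

Lemma lag_coef_LP : LP lag_coef.
Proof.
apply: (@LP_closed _ lag_partial) => [n|k]; last exact: lag_coef_cvg.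
by elim: n => [|n IH]; [exact: LP_exp|apply: LP_mul1].
Qed.

Lemma lag_partial0 n : lag_partial n 0 = 1.
Proof. by elim: n => [//|n IH] /=; rewrite /mul1 IH !mul0r addr0. Qed.

Lemma lag_partial1 n : lag_partial n 1 = alpha + series gamma n.
Proof.
elim: n => [|n IH] /=; first by rewrite /series /= big_geq // addr0 expr1.
by rewrite /mul1 IH /= lag_partial0 seriesSr; ring.
Qed.

(** q is additive under products: the exponential contributes 0 and each factor gamma_j^2. In the
    limit q is the second moment. *)
Lemma lag_partial_defect n :
  lag_partial n 1 ^+ 2 - lag_partial n 2 = series (fun j => gamma j ^+ 2) n.
Proof.
elim: n => [|n IH] /=; first by rewrite /series /= big_geq // expr1 subrr.
by rewrite seriesSr -IH /mul1 /= lag_partial0; ring.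
Qed.

Lemma lag_coef0 : lag_coef 0 = 1.
Proof.
apply: (cvg_lim (@Rhausdorff R)); under eq_fun do rewrite lag_partial0.
exact: cvg_cst.
Qed.

Lemma lag_coef1 : lag_coef 1 = alpha + moment gamma 1.
Proof.
have -> : moment gamma 1 = S.
  by rewrite /moment; congr (limn (series _)); apply/funext => j; rewrite expr1.
apply: (cvg_lim (@Rhausdorff R)); under eq_fun do rewrite lag_partial1.
by apply: cvgD; [exact: cvg_cst|exact: cgamma].
Qed.

Lemma lag_coef_defect : defect lag_coef = moment gamma 2.
Proof.
rewrite /defect /ratio1 lag_coef0 !divr1; apply/esym/(cvg_lim (@Rhausdorff R)).
rewrite (_ : series _ = fun n => lag_partial n 1 ^+ 2 - lag_partial n 2); last first.
  by apply/funext => n; rewrite lag_partial_defect.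
apply: cvgB; last exact: lag_coef_cvg.
by under eq_fun do rewrite expr2; rewrite expr2; apply: cvgM; exact: lag_coef_cvg.
Qed.

Lemma lag_coef_ge k : 1 * alpha ^+ k <= lag_coef k.
Proof. by rewrite mul1r; exact: (lag_partial_lag_coef 0). Qed.

(* All but finitely many factors [1 + gamma_j z] have arbitrarily small total
   mass, and finitely many do not change the type. *)
Lemma lag_coef_etype : etype alpha lag_coef.
Proof.
move=> B aB; pose B' := (alpha + B) / 2.
have aB' : alpha < B' by rewrite /B'; lra.
have B'B : 0 < B - B' by rewrite /B'; lra.
have B'0 : 0 <= B' by apply: le_trans (ltW aB').
have hS : S - (B - B') < S by rewrite gtrBl.
have [n0 _ /(_ n0 (leqnn n0)) hn0] := cvgr_gt _ cgamma _ hS.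
have [M hM] : exists M, gbound M B' (lag_partial n0).
  suff : etype alpha (lag_partial n0) by apply.
  elim: (n0) => [|n IH]; last exact: mul1_etype.
  move=> C aC; exists 1 => k /=; rewrite exprn_ge0 //= mul1r lerXn2r ?nnegrE ?(ltW aC) //.
  exact: le_trans (ltW aC).
have h j : gbound M (B' + (series gamma (n0 + j)%N - series gamma n0)) (lag_partial (n0 + j)%N).
  elim: j => [|j IH]; first by rewrite addn0 subrr addr0.
  rewrite addnS seriesSr /= addrAC addrA; apply: mul1_gbound => //.
  by rewrite addr_ge0 // subr_ge0 nondecreasing_series // leq_addr.
exists M => k; rewrite (le_trans (lag_partial_ge0 0 k) (lag_partial_lag_coef 0 k)) /=.
apply: limr_le; first by apply/cvg_ex; eexists; exact: lag_coef_cvg.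
near=> n; have nn : (n0 <= n)%N by near: n; exists n0.
have hj := h (n - n0)%N; rewrite (subnKC nn) in hj.
suff hk : gbound M B (lag_partial n) by have /andP[] := hk k.
apply: gbound_weaken hj => //.
  by rewrite addr_ge0 // subr_ge0 nondecreasing_series.
have := seriesS n; move: hn0 => /=; lra.
Unshelve. all: by end_near. Qed.

Lemma egf_lag_partial n x : egf (lag_partial n) x =
  expR (alpha * x) * \prod_(j < n) (1 + gamma j * x).
Proof.
elim: n => [|n IH] /=.
  rewrite big_ord0 mulr1 -[RHS]mul1r -egf_geometric; congr egf.
  by apply/funext => k; rewrite mul1r.
rewrite (egf_mul1 _ _ _ (lag_partial_gbound n)) ?addr_ge0 // IH big_ord_recr /=; ring.
Qed.

Lemma egf_lag_coef_cvg x :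
  expR (alpha * x) * \prod_(j < n) (1 + gamma j * x) @[n --> \oo] --> egf lag_coef x.
Proof.
under eq_fun do rewrite -egf_lag_partial.
apply: (@egf_cvg_to _ _ _ _ 1 (alpha + S) `|x|).
- by rewrite addr_ge0 // (le_trans (series0 0)).
- by near=> n; split=> //; exact: lag_partial_gboundS.
- exact: lag_coef_cvg.
- exact: cvg_cst.
Unshelve. all: by end_near. Qed.

End Sequence.

Lemma laguerre_rep_unit c m alpha gamma (f : R[i] -> R[i]) :
  laguerre_rep c m alpha gamma f -> f 0 = 1 -> c = 1 /\ m = 0%N.
Proof.
move=> [_ _ _ /(_ 0) h] f0.
have : c * 0 ^+ m = f 0.
  apply: (@cvgC_unique R nat \oo _ (fun n : nat => c * 0 ^+ m * cexp (alpha%:C * 0)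
           * \prod_(j < n) (1 + (gamma j)%:C * 0))); last exact: h.
  apply: cvg_near_cst; near=> n.
  rewrite mulr0 [cexp 0]cexp_real expR0 mulr1 big1 ?mulr1 // => j _.
  by rewrite mulr0 addr0.
rewrite f0; case: m {h} => [|m]; first by rewrite expr0 mulr1.
by rewrite exprS mul0r mulr0 => /eqP; rewrite eq_sym oner_eq0.
Unshelve. all: by end_near. Qed.

(** Real arguments suffice, since [g] is evaluated at (x,x) only. *)
Lemma laguerre_rep_egf c m alpha gamma (f : R[i] -> R[i]) (x : R) :
  laguerre_rep c m alpha gamma f -> f 0 = 1 ->
  f x%:C = (egf (lag_coef alpha gamma) x)%:C.
Proof.
move=> rep f0; have [c1 m0] := laguerre_rep_unit rep f0.
have [a0 hg cg /(_ x%:C) h] := rep.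
have g0 j : 0 <= gamma j by have /andP[h0 h1] := hg j; apply: le_trans h1.
apply: cvgC_unique h _; rewrite c1 m0.
rewrite (_ : (fun n => _) = fun n => (expR (alpha * x) * \prod_(j < n) (1 + gamma j * x))%:C).
  by apply: cvgC_real; apply: egf_lag_coef_cvg.
apply/funext => n; rewrite mul1r expr0 mul1r rmorphM rmorph_prod /= -cexp_real.
by rewrite rmorphM; congr (_ * _); apply: eq_bigr => j _; rewrite rmorphD rmorphM rmorph1.
Qed.

(** If alpha + sum gamma = 0 for nonnegative terms, all of them vanish and f = 1. *)
Lemma laguerre_rep_nonconstant c m alpha gamma (f : R[i] -> R[i]) :
  laguerre_rep c m alpha gamma f -> f 0 = 1 -> (exists z w, f z <> f w) ->
  0 < lag_coef alpha gamma 1.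
Proof.
move=> rep f0 [z [w fzw]]; have [c1 m0] := laguerre_rep_unit rep f0.
have [a0 hg cg h] := rep.
have g0 j : 0 <= gamma j by have /andP[h0 h1] := hg j; apply: le_trans h1.
have h1 n := lag_partial_lag_coef a0 g0 cg n 1.
rewrite lt_neqAle (le_trans (lag_partial_ge0 a0 g0 0 1) (h1 0)) andbT eq_sym.
apply/negP => /eqP e; apply: fzw.
have z1 n : alpha + series gamma n = 0.
  apply/eqP; rewrite eq_le -{1}e -lag_partial1 h1 /= lag_partial1.
  by rewrite addr_ge0 // sumr_ge0.
have al0 : alpha = 0 by have := z1 0; rewrite /series /= big_geq // addr0.
have gz j : gamma j = 0.
  by have := z1 j.+1; rewrite seriesSr addrA z1 add0r.
have fE y : f y = 1.
  apply: cvgC_unique (h y) _; apply: cvg_near_cst; near=> n.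
  rewrite c1 m0 al0 mul0r expr0 !mul1r [cexp 0]cexp_real expR0 mul1r big1 // => j _.
  by rewrite gz mul0r addr0.
by rewrite !fE.
Unshelve. all: by end_near. Qed.

End LaguerreCoefficients.

(** * Radial solutions of the heat equation *)

Section RadialFunctions.
Variables (R : realType) (N : nat).
Implicit Types (b : nat -> R) (x h : 'rV[R]_N) (M B : R).

Definition radial b x : R[i] := (egf b (dotp x x))%:C.

Lemma dotp_ge0 x : 0 <= dotp x x.
Proof. by apply: sumr_ge0 => i _; rewrite -expr2 sqr_ge0. Qed.

Lemma dotp_eq0 x : (dotp x x == 0) = (x == 0).
Proof.
apply/idP/eqP => [|->]; last first.
  by rewrite /dotp big1 // => i _; rewrite !mxE mul0r.
rewrite psumr_eq0 => [/allP h|i _]; last by rewrite -expr2 sqr_ge0.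
apply/rowP => i; have := h i (mem_index_enum i).
by rewrite /= mxE mulf_eq0 orbb => /eqP.
Qed.

Lemma wnorm_le (beta K : R) (F : 'rV[R]_N -> R[i]) :
  (forall x, cmod (F x) <= K * expR (beta * dotp x x)) -> (wnorm beta F <= K%:E)%E.
Proof.
move=> h; apply: ge_ereal_sup => _ [x _ <-]; rewrite lee_fin expRN.
by rewrite ler_pdivrMr ?expR_gt0.
Qed.

Lemma wnorm_ge0 (beta : R) (F : 'rV[R]_N -> R[i]) : (0 <= wnorm beta F)%E.
Proof.
apply: le_trans (ereal_sup_ubound (ex_intro2 _ _ 0 I erefl)).
by rewrite lee_fin mulr_ge0 ?cmod_ge0 // expR_ge0.
Qed.

Lemma cmod_le_wnorm (beta K : R) (F : 'rV[R]_N -> R[i]) x :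
  (wnorm beta F <= K%:E)%E -> cmod (F x) <= K * expR (beta * dotp x x).
Proof.
move=> h; have := le_trans (ereal_sup_ubound (ex_intro2 _ _ x I erefl)) h.
by rewrite lee_fin expRN ler_pdivrMr ?expR_gt0.
Qed.

Lemma wnorm_radial_le M B beta b : gbound M B b -> B <= beta ->
  (wnorm beta (radial b) <= M%:E)%E.
Proof.
move=> hb Bb; apply: wnorm_le => x; rewrite cmod_real.
apply: le_trans (egf_norm_le (dotp x x) hb) _.
rewrite ger0_norm ?dotp_ge0 // ler_wpM2l ?(gbound_M_ge0 hb) //.
by rewrite ler_expR ler_wpM2r ?dotp_ge0.
Qed.

(** Termwise (beta z)^k / k! <= exp(beta z). The weighted sup norm is thus controlled by a weighted
    l^1 distance of coefficients, to which dominated convergence applies. *)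
Lemma egf_dist_le M B beta b c z : gbound M B b -> gbound M B c -> 0 <= B -> B < beta ->
  0 <= z -> `|egf b z - egf c z| <=
     limn (series (fun k => `|b k - c k| / beta ^+ k)) * expR (beta * z).
Proof.
move=> hb hc B0 Bb z0; have b0 : 0 < beta by apply: le_lt_trans Bb.
have M0 := gbound_M_ge0 hb.
have cb := cvg_egf (z := z) hb; have cc := cvg_egf (z := z) hc.
have dom k : `| `|b k - c k| / beta ^+ k | <= 2 * M * (B / beta) ^+ k.
  rewrite ger0_norm ?divr_ge0 ?exprn_ge0 ?(ltW b0) // expr_div_n mulrA.
  rewrite ler_pM2r ?invr_gt0 ?exprn_gt0 //.
  have /andP[b1 b2] := hb k; have /andP[c1 c2] := hc k.
  by rewrite ler_norml; lra.
have cD : cvgn (series (fun k => `|b k - c k| / beta ^+ k)).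
  apply: series_dominated dom; apply: cvg_geometric_pos.
  by rewrite divr_ge0 ?(ltW b0) //= ltr_pdivrMr // mul1r.
have e1 : egf b z - egf c z = limn (series (fun k => b k / k`!%:R * z ^+ k - c k / k`!%:R * z ^+ k)).
  by rewrite /egf -lim_seriesB.
rewrite e1 mulrC -limn_seriesZ //.
apply: series_norm_le => [|k]; first exact: is_cvg_seriesZ.
rewrite -!mulrA -mulrBl normrM.
have f0 : 0 < k`!%:R :> R by rewrite ltr0n fact_gt0.
rewrite [`|_^-1 * _|]ger0_norm; last by rewrite mulr_ge0 ?invr_ge0 ?exprn_ge0.
rewrite [leRHS]mulrCA ler_wpM2l // ler_pdivlMr ?exprn_gt0 //.
have -> : (k`!%:R)^-1 * z ^+ k * beta ^+ k = (beta * z) ^+ k / k`!%:R by rewrite exprMn; ring.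
have e0 : 0 <= beta * z by rewrite mulr_ge0 // ltW.
have cE := is_cvg_series_exp_coeff (beta * z).
apply: limr_ge cE _; near=> n; have kn : (k < n)%N by near: n; exists k.+1.
rewrite /series /= (bigD1_seq k) ?iota_uniq ?mem_index_iota //= /exp_coeff /=.
by rewrite lerDl sumr_ge0 // => i _; rewrite divr_ge0 ?exprn_ge0.
Unshelve. all: by end_near. Qed.

Lemma wnorm_radial_cvg M B beta (u : nat -> nat -> R) c : 0 <= B -> B < beta ->
  (\forall n \near \oo, gbound M B (u n)) -> gbound M B c ->
  (forall k, u n k @[n --> \oo] --> c k) ->
  wnorm beta (fun x => radial (u n) x - radial c x) @[n --> \oo] --> (0 : \bar R)%E.
Proof.
move=> B0 Bb hu hc uc; have b0 : 0 < beta by apply: le_lt_trans Bb.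
pose D n := limn (series (fun k => `|u n k - c k| / beta ^+ k)).
have D0 : D n @[n --> \oo] --> (0 : R).
  have -> : (0 : R) = limn (series (fun k : nat => 0 : R)).
    apply/esym/(cvg_lim (@Rhausdorff R)).
    have := @series_finite R (fun=> 0) 0; rewrite big_ord0; exact.
  apply: (@tannery R nat \oo _ (fun n k => `|u n k - c k| / beta ^+ k) _
    (fun k => 2 * M * (B / beta) ^+ k)).
  - apply: cvg_geometric_pos.
    by rewrite divr_ge0 ?(ltW b0) //= ltr_pdivrMr // mul1r.
  - near=> n => k; have hb : gbound M B (u n) by near: n.
    rewrite ger0_norm ?divr_ge0 ?exprn_ge0 ?(ltW b0) // expr_div_n mulrA.
    rewrite ler_pM2r ?invr_gt0 ?exprn_gt0 //.
    have /andP[b1 b2] := hb k; have /andP[c1 c2] := hc k.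
    by rewrite ler_norml; lra.
  - move=> k; rewrite -(mul0r (beta ^- k)); apply: cvgM; last exact: cvg_cst.
    rewrite -(@normr0 R R) -(subrr (c k)); apply: cvg_norm.
    by apply: cvgB => //; exact: cvg_cst.
apply: (@squeeze_cvge _ _ _ _ (fun=> 0%E) _ (fun n => (D n)%:E)).
- near=> n; rewrite wnorm_ge0 /=; apply: wnorm_le => x.
  rewrite /radial -rmorphB /= cmod_real.
  apply: egf_dist_le hc B0 Bb (dotp_ge0 x).
  by near: n.
- exact: cvg_cst.
- by apply/cvg_EFin => //; near=> n.
Unshelve. all: by end_near. Qed.

(** * Analyticity of radial functions *)

Section Analyticity.
Variables (x : 'rV[R]_N).

(** The power (x + h, x + h)^k is expanded over words [w] of length k in the coordinates;
    [wpoly w i] collects the factors of coordinate i as a polynomial in h_i. Its majorant, with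
    |x_i| for x_i and evaluated at 1, bounds absolute sums of coefficients. *)
Let wpoly k (w : {ffun 'I_k -> 'I_N}) (i : 'I_N) : {poly R} :=
  \prod_(j < k | w j == i) ('X + (x ord0 i)%:P) ^+ 2.

Let majpoly k (w : {ffun 'I_k -> 'I_N}) (i : 'I_N) : {poly R} :=
  \prod_(j < k | w j == i) ('X + `|x ord0 i|%:P) ^+ 2.

Let maj (p q : {poly R}) := forall m, `|p`_m| <= q`_m.

Let maj_mul p q p' q' : maj p q -> maj p' q' -> maj (p * p') (q * q').
Proof.
move=> h h' m; rewrite !coefM (le_trans (ler_norm_sum _ _ _)) // ler_sum // => i _.
by rewrite normrM ler_pM.
Qed.

Let maj_wpoly k (w : {ffun 'I_k -> 'I_N}) i : maj (wpoly w i) (majpoly w i).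
Proof.
apply: (big_ind2 maj) => //.
- by move=> m; rewrite coef1 normr_nat.
move=> j _; suff h : maj ('X + (x ord0 i)%:P) ('X + `|x ord0 i|%:P).
  by rewrite !expr2; exact: maj_mul.
move=> m; rewrite !coefD coefX !coefC; case: m => [|m] /=; first by rewrite !add0r.
by rewrite !addr0 normr_nat.
Qed.

Let A i := (1 + `|x ord0 i|) ^+ 2.
Let rho := \sum_i A i.

Let prod_words k (y : 'I_N -> R) :
  \sum_(w : {ffun 'I_k -> 'I_N}) \prod_i \prod_(j < k | w j == i) y i = (\sum_i y i) ^+ k.
Proof.
rewrite -[in RHS](card_ord k) -prodr_const bigA_distr_bigA; apply: eq_bigr => w _.
rewrite [RHS](partition_big w xpredT) //=; apply: eq_bigr => i _.
by apply: eq_bigr => j /eqP ->.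
Qed.

Let coef_k k (kap : {ffun 'I_N -> nat}) : R :=
  \sum_(w : {ffun 'I_k -> 'I_N}) \prod_i (wpoly w i)`_(kap i).

Let box n (kap : {ffun 'I_N -> 'I_n}) : {ffun 'I_N -> nat} :=
  [ffun i => nat_of_ord (kap i)].

Let boxsum k n h : \sum_(kap : {ffun 'I_N -> 'I_n})
    coef_k k (box kap) * \prod_i h ord0 i ^+ kap i =
  \sum_(w : {ffun 'I_k -> 'I_N}) \prod_i \sum_(m < n) (wpoly w i)`_m * h ord0 i ^+ m.
Proof.
under eq_bigr do rewrite /coef_k mulr_suml.
rewrite exchange_big /=; apply: eq_bigr => w _.
rewrite bigA_distr_bigA; apply: eq_bigr => kap _.
by rewrite -big_split; apply: eq_bigr => i _; rewrite /box ffunE.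
Qed.

Let maj_horner k (w : {ffun 'I_k -> 'I_N}) i :
  (majpoly w i).[1] = \prod_(j < k | w j == i) A i.
Proof.
rewrite horner_prod; apply: eq_bigr => j _.
by rewrite !hornerE.
Qed.

Let sum_coef_le (p q : {poly R}) n : maj p q -> \sum_(m < n) `|p`_m| <= q.[1].
Proof.
move=> h; have h0 m : 0 <= q`_m by apply: le_trans (h m).
rewrite (@horner_coef_wide _ (maxn n (size q))) ?leq_maxr //.
apply: (@le_trans _ _ (\sum_(m < n) q`_m)); first by apply: ler_sum => m _.
rewrite -(big_mkord xpredT (fun m => q`_m)) -(big_mkord xpredT (fun m => q`_m * 1 ^+ m)).
rewrite [leRHS](@big_cat_nat _ _ _ n) ?leq_maxl //=.
under [X in _ <= X + _]eq_bigr do rewrite expr1n mulr1.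
by rewrite lerDl sumr_ge0 // => m _; rewrite expr1n mulr1.
Qed.

Let abs_boxsum k n : \sum_(kap : {ffun 'I_N -> 'I_n}) `|coef_k k (box kap)| <= rho ^+ k.
Proof.
apply: (@le_trans _ _ (\sum_(kap : {ffun 'I_N -> 'I_n})
   \sum_(w : {ffun 'I_k -> 'I_N}) \prod_i `|(wpoly w i)`_(box kap i)|)).
  apply: ler_sum => kap _; rewrite (le_trans (ler_norm_sum _ _ _)) // ler_sum // => w _.
  by rewrite normr_prod.
rewrite exchange_big /= -prod_words; apply: ler_sum => w _.
apply: (@le_trans _ _ (\prod_i \sum_(m < n) `|(wpoly w i)`_m|)).
  rewrite bigA_distr_bigA; apply: ler_sum => kap _.
  by under eq_bigr do rewrite /box ffunE.
apply: ler_prod => i _; rewrite sumr_ge0 //= -maj_horner.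
apply: sum_coef_le; exact: maj_wpoly.
Qed.

Let boxsum_cvg k h : \sum_(kap : {ffun 'I_N -> 'I_n})
    coef_k k (box kap) * \prod_i h ord0 i ^+ kap i @[n --> \oo] --> dotp (x + h) (x + h) ^+ k.
Proof.
under eq_fun do rewrite boxsum.
have -> : dotp (x + h) (x + h) ^+ k = \sum_(w : {ffun 'I_k -> 'I_N}) \prod_i (wpoly w i).[h ord0 i].
  rewrite /dotp -prod_words; apply: eq_bigr => w _; apply: eq_bigr => i _.
  rewrite horner_prod; apply: eq_bigr => j _.
  by rewrite !hornerE mxE -expr2 addrC.
apply: cvg_sum_seq => w; apply: cvg_near_cst; near=> n.
apply: eq_bigr => i _; rewrite (@horner_coef_wide _ n) //.
have : (\sum_i size (wpoly w i) <= n)%N by near: n; exists (\sum_i size (wpoly w i))%N.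
by apply: leq_trans; rewrite (bigD1 i) //= leq_addr.
Unshelve. all: by end_near. Qed.

(** The expansions of (x + h, x + h)^k have coefficients of absolute sum at most rho^k. Weighted by
    b k / k! they are dominated by the series of M exp(B rho), so radius 1 works and the sums may be
    exchanged. *)
Lemma radial_analytic_at M B b : 0 <= B -> gbound M B b ->
  exists (r K : R) (c : {ffun 'I_N -> nat} -> R[i]),
  let coef n (k : {ffun 'I_N -> 'I_n}) := c [ffun i => nat_of_ord (k i)] in
  [/\ 0 < r,
      (forall n, \sum_(k : {ffun 'I_N -> 'I_n})
         cmod (coef n k) * r ^+ (\sum_(i < N) k i)%N <= K) &
      forall h : 'rV[R]_N, (forall i, `|h ord0 i| < r) ->
        (fun n : nat => (\sum_(k : {ffun 'I_N -> 'I_n})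
           coef n k * (\prod_(i < N) h ord0 i ^+ k i)%:C : R[i]^o)) @ \oo
        --> (radial b (x + h) : R[i]^o)].
Proof.
move=> B0 hb; have M0 := gbound_M_ge0 hb.
have rho0 : 0 <= rho by apply: sumr_ge0 => i _; rewrite sqr_ge0.
pose maj_k k := M * exp_coeff (B * rho) k.
have cmaj : cvgn (series maj_k) by exact: cvg_exp_bound.
have bk k : 0 <= b k / k`!%:R by rewrite divr_ge0 // (gbound_ge0 _ hb).
have bmaj k y : `|y| <= rho ^+ k -> `|b k / k`!%:R * y| <= maj_k k.
  move=> hy; rewrite normrM ger0_norm // /maj_k /exp_coeff /= exprMn.
  have -> : M * (B ^+ k * rho ^+ k / k`!%:R) = M * B ^+ k / k`!%:R * rho ^+ k by ring.
  rewrite ler_pM // ler_wpM2r ?invr_ge0 //.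
  by have /andP[] := hb k.
have norm_prod n (kap : {ffun 'I_N -> 'I_n}) h : (forall i, `|h ord0 i| < 1) ->
    `|\prod_i h ord0 i ^+ kap i| <= 1.
  move=> h1; rewrite normr_prod; apply: prodr_ile1 => i _.
  by rewrite normr_ge0 /= normrX exprn_ile1 // ltW.
have single k n (kap : {ffun 'I_N -> 'I_n}) : `|coef_k k (box kap)| <= rho ^+ k.
  apply: le_trans (abs_boxsum k n); rewrite (bigD1 kap) //= lerDl.
  by apply: sumr_ge0.
have absbox k n h : (forall i, `|h ord0 i| < 1) ->
  `|\sum_(kap : {ffun 'I_N -> 'I_n}) coef_k k (box kap) * \prod_i h ord0 i ^+ kap i| <= rho ^+ k.
  move=> h1; apply: le_trans (abs_boxsum k n); rewrite (le_trans (ler_norm_sum _ _ _)) //.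
  by apply: ler_sum => kap _; rewrite normrM ler_piMr // norm_prod.
pose c kap := limn (series (fun k => b k / k`!%:R * coef_k k kap)).
exists 1, (limn (series maj_k)), (fun kap => (c kap)%:C) => coef.
have lim_sum n (f : {ffun 'I_N -> 'I_n} -> nat -> R) :
   (forall kap, cvgn (series (f kap))) ->
   \sum_kap limn (series (f kap)) = limn (series (fun k => \sum_kap f kap k)).
  move=> hf; apply/esym/(cvg_lim (@Rhausdorff R)).
  rewrite (_ : series _ = fun m => \sum_kap series (f kap) m); last first.
    by apply/funext => m; rewrite /series /= exchange_big.
  exact: cvg_sum_seq.
split=> [//|n|h h1].
  apply: (@le_trans _ _ (\sum_(kap : {ffun 'I_N -> 'I_n})
     limn (series (fun k => b k / k`!%:R * `|coef_k k (box kap)|)))).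
    apply: ler_sum => kap _; rewrite /coef cmod_real expr1n mulr1.
    apply: series_norm_le => [|k]; last by rewrite normrM ger0_norm.
    apply: (series_dominated cmaj) => k; apply: bmaj; rewrite normr_id; exact: single.
  rewrite lim_sum; last first.
    move=> kap; apply: (series_dominated cmaj) => k; apply: bmaj; rewrite normr_id.
    exact: single.
  apply: le_trans (ler_norm _) _; apply: (series_norm_le cmaj) => k.
  rewrite -mulr_sumr; apply: bmaj; rewrite ger0_norm ?sumr_ge0 //.
rewrite (_ : (fun n => _) = fun n => (limn (series (fun k => b k / k`!%:R *
    \sum_(kap : {ffun 'I_N -> 'I_n}) coef_k k (box kap) * \prod_i h ord0 i ^+ kap i)))%:C).
  apply: cvgC_real; apply: (@tannery R nat \oo _ (fun n k => b k / k`!%:R *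
    \sum_(kap : {ffun 'I_N -> 'I_n}) coef_k k (box kap) * \prod_i h ord0 i ^+ kap i)
    (fun k => b k / k`!%:R * dotp (x + h) (x + h) ^+ k) maj_k) => //.
  - by near=> n => k; apply: bmaj; exact: absbox.
  - by move=> k; apply: cvgM; [exact: cvg_cst|exact: boxsum_cvg].
apply/funext => n; under eq_bigr do rewrite /coef -rmorphM /=.
rewrite -rmorph_sum /=; congr (_%:C).
have cv (kap : {ffun 'I_N -> 'I_n}) : cvgn (series (fun k => b k / k`!%:R * coef_k k (box kap))).
  by apply: (series_dominated cmaj) => k; apply: bmaj; exact: single.
transitivity (\sum_(kap : {ffun 'I_N -> 'I_n}) limn (series (fun k =>
    b k / k`!%:R * (coef_k k (box kap) * \prod_i h ord0 i ^+ kap i)))).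
  apply: eq_bigr => kap _.
  rewrite -[c _]/(limn (series (fun k => b k / k`!%:R * coef_k k (box kap)))) mulrC.
  rewrite -(limn_seriesZ _ (cv kap)); congr (limn (series _)).
  by apply/funext => k; rewrite mulrC mulrA.
rewrite lim_sum.
  by congr (limn (series _)); apply/funext => k; rewrite mulr_sumr.
move=> kap; apply: (series_dominated cmaj) => k; apply: bmaj.
by rewrite normrM -[leRHS]mulr1 ler_pM // norm_prod.
Unshelve. all: by end_near. Qed.

End Analyticity.

Lemma radial_analytic M B b : 0 <= B -> gbound M B b -> analytic (radial b).
Proof. by move=> B0 hb x; exact: radial_analytic_at B0 hb. Qed.

Lemma radial_in_A A b : 0 <= A -> etype A b -> in_A A (radial b).
Proof.
move=> A0 hb; have [|M0 h0] := hb (A + 1); first by rewrite ltrDl.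
split; first by apply: radial_analytic h0; rewrite addr_ge0.
move=> beta Ab; have [M hM] := hb _ Ab.
by apply: le_lt_trans (wnorm_radial_le hM (lexx _)) _; rewrite ltry.
Qed.

End RadialFunctions.

(** * The heat equation for radial functions *)

Section RadialHeatSolution.
Variables (R : realType) (N : nat).
Implicit Types (b : nat -> R) (x h : 'rV[R]_N) (M B : R).

Lemma derive_line (f : 'rV[R]_N -> R) x v (l : R) :
  is_derive (0 : R) 1 (fun s : R => f (s *: v + x)) l -> 'D_v f x = l.
Proof.
move=> hl; rewrite -(@derive_val _ _ _ _ _ _ _ hl) /derive.
rewrite (_ : (fun h : R => h^-1 *: ((f \o shift x) (h *: v) - f x)) =
  (fun h : R => h^-1 *: (((fun s : R => f (s *: v + x)) \o shift 0) h%:A - f (0 *: v + x)))) //.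
by apply/funext => s /=; rewrite scale0r add0r addr0 [s%:A]mulr1.
Qed.

Lemma dotp_line x (i : 'I_N) (s : R) :
  dotp (s *: delta_mx ord0 i + x) (s *: delta_mx ord0 i + x) =
  dotp x x + 2 * x ord0 i * s + s ^+ 2.
Proof.
have E (j : 'I_N) : (s *: delta_mx ord0 i + x) ord0 j = s * (j == i)%:R + x ord0 j.
  by rewrite !mxE eqxx.
rewrite /dotp (bigD1 i) //= [in RHS](bigD1 i) //= E eqxx.
rewrite (eq_bigr (fun j => x ord0 j * x ord0 j)) => [|j ji].
  by move: (\sum_(j | _) _) => S /=; ring.
by rewrite E (negbTE ji) mulr0 add0r.
Qed.

Lemma dotp_line_derive x (i : 'I_N) :
  is_derive (0 : R) 1 (fun s : R => dotp (s *: delta_mx ord0 i + x) (s *: delta_mx ord0 i + x))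
    (2 * x ord0 i).
Proof.
under eq_fun do rewrite dotp_line.
move: (dotp x x) (2 * x ord0 i) => c a.
apply/is_derive1_caratheodory; exists (fun s => a + s); split; last exact: addr0.
  by move=> s; rewrite mulr0 expr0n !addr0 subr0; ring.
by apply: cvgD; [exact: cvg_cst|exact: cvg_id].
Qed.

Lemma egf_line_derive M B b x (i : 'I_N) : gbound M B b ->
  is_derive (0 : R) 1
    (fun s : R => egf b (dotp (s *: delta_mx ord0 i + x) (s *: delta_mx ord0 i + x)))
    (2 * x ord0 i * egf (eshift b) (dotp x x)).
Proof.
move=> hb.
pose g (s : R) := dotp (s *: delta_mx ord0 i + x) (s *: delta_mx ord0 i + x).
have g0 : g 0 = dotp x x by rewrite /g scale0r add0r.
have dg : is_derive (0 : R) 1 g (2 * x ord0 i) := dotp_line_derive x i.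
have de : is_derive (g 0) 1 (egf b) (egf (eshift b) (g 0)) := egf_derive (g 0) hb.
have := is_derive1_comp de dg; rewrite g0 mulrC.
by [].
Qed.

Lemma partial_radial M B b i x : gbound M B b ->
  partial i (radial b) x = (2 * x ord0 i * egf (eshift b) (dotp x x))%:C.
Proof.
move=> hb; rewrite /partial /radial /=; congr (_ +i* _).
  by apply: derive_line; exact: egf_line_derive hb.
apply: derive_line; exact: is_derive_cst.
Qed.

Lemma egf_line_derive2 M B b x (i : 'I_N) : gbound M B b ->
  is_derive (0 : R) 1
    (fun s : R => 2 * (s *: delta_mx ord0 i + x) ord0 i *
       egf b (dotp (s *: delta_mx ord0 i + x) (s *: delta_mx ord0 i + x)))
    (2 * egf b (dotp x x) + 4 * x ord0 i ^+ 2 * egf (eshift b) (dotp x x)).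
Proof.
move=> hb; have d1 := egf_line_derive x i hb.
have d2 : is_derive (0 : R) 1 (fun s : R => 2 * (s *: delta_mx ord0 i + x) ord0 i) 2.
  have -> : (fun s : R => 2 * (s *: delta_mx ord0 i + x) ord0 i) =
    (2 \*: id) + cst (2 * x ord0 i) :> (R -> R).
    by apply/funext => s; rewrite !mxE !eqxx mulr1 mulrDr.
  by apply: is_derive_eq; rewrite /GRing.scale /=; ring.
apply: (is_derive_eq (is_deriveM d2 d1)); rewrite !scale0r !add0r.
rewrite /GRing.scale /=; move: (egf _ _) (egf _ _) (x ord0 i) => a c y.
by ring.
Qed.

Lemma partial2_radial M B b i x : gbound M B b ->
  partial i (partial i (radial b)) x =
  (2 * egf (eshift b) (dotp x x) + 4 * x ord0 i ^+ 2 * egf (eshift (eshift b)) (dotp x x))%:C.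
Proof.
move=> hb.
rewrite (_ : partial i (radial b) = fun y => (2 * y ord0 i * egf (eshift b) (dotp y y))%:C).
  rewrite /partial /=; congr (_ +i* _); last by apply: derive_line; exact: is_derive_cst.
  apply: derive_line; exact: egf_line_derive2 (eshift_gbound hb).
by apply/funext => y; exact: partial_radial hb.
Qed.

Lemma laplacian_radial M B b x : gbound M B b ->
  laplacian (radial b) x =
  (2 * N%:R * egf (eshift b) (dotp x x) + 4 * dotp x x * egf (eshift (eshift b)) (dotp x x))%:C.
Proof.
move=> hb; rewrite /laplacian; under eq_bigr do rewrite (partial2_radial _ _ hb).
rewrite -rmorph_sum big_split /= sumr_const card_ord -mulr_natl; congr (_%:C).
have -> : \sum_(i < N) 4 * x ord0 i ^+ 2 * egf (eshift (eshift b)) (dotp x x) =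
   4 * dotp x x * egf (eshift (eshift b)) (dotp x x).
  by rewrite -mulr_suml -mulr_sumr; under eq_bigr do rewrite expr2.
by ring.
Qed.

Lemma euler_radial M B b x : gbound M B b ->
  euler (radial b) x = (2 * dotp x x * egf (eshift b) (dotp x x))%:C.
Proof.
move=> hb; rewrite /euler; under eq_bigr do rewrite (partial_radial _ _ hb) -rmorphM /=.
rewrite -rmorph_sum /=; congr (_%:C); rewrite -mulrA mulr_suml mulr_sumr.
by apply: eq_bigr => i _; ring.
Qed.

Lemma is_derive_mull (c t : R) : is_derive t 1 (fun s : R => c * s) c.
Proof. exact: (is_derive_eq (is_deriveZ c (is_derive_id t 1)) (mulr1 c)). Qed.

Lemma derive_quotient (q : R -> R) (t l : R) : is_derive t 1 q l ->
  (s - t)^-1 * (q s - q t) @[s --> t^'] --> l.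
Proof.
move=> /is_derive1_caratheodory[g [gE gc <-]].
apply: (@cvg_trans _ (g s @[s --> nbhs t])); last exact: gc.
apply: (@cvg_trans _ (g s @[s --> t^'])).
  apply: near_eq_cvg; near=> s; rewrite gE mulrCA mulVf ?mulr1 // subr_eq0.
  by near: s; exact: nbhs_dnbhs_neq.
move=> P /= hP; exact: (cvg_within _ hP).
Unshelve. all: by end_near. Qed.

Lemma dotp_continuous x : dotp y y @[y --> x] --> dotp x x.
Proof.
apply: (@cvg_sum_seq R _ (nbhs x) (nbhs_filter x)) => i.
apply: cvgM; exact: (@coord_continuous R 1 N ord0 i x).
Qed.

Lemma egf_family_continuous M B (w : R -> nat -> R) : 0 <= B ->
  (forall t, gbound M B (w t)) -> (forall k t, w s k @[s --> t] --> w t k) ->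
  continuous (fun p : R * 'rV[R]_N => egf (w p.1) (dotp p.2 p.2)).
Proof.
move=> B0 hw cw p.
have c2 : dotp q.2 q.2 @[q --> p] --> dotp p.2 p.2.
  apply: (@cvg_comp _ _ _ snd (fun x => dotp x x)); first exact: cvg_snd.
  exact: dotp_continuous.
apply: (@egf_cvg_to R _ (nbhs p) _ M B (dotp p.2 p.2 + 1) (fun q => w q.1) _
    (fun q => dotp q.2 q.2)) => //.
  near=> q; split=> //; rewrite ger0_norm ?dotp_ge0 //; apply: ltW; near: q.
  by move: c2 => /cvgr_lt; apply; rewrite ltrDl.
move=> k; apply: (@cvg_comp _ _ _ fst (fun t => w t k)); first exact: cvg_fst.
exact: cw.
Unshelve. all: by end_near. Qed.

Lemma within_slab_continuous (f g : R * 'rV[R]_N -> R) :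
  continuous f -> (forall p, 0 <= p.1 <= 1 -> f p = g p) ->
  {within [set p : R * 'rV[R]_N | 0 <= p.1 <= 1], continuous (fun p => ((g p)%:C : R[i]^o))}.
Proof.
move=> cf fg; apply: (@subspace_eq_continuous _ _ _ (fun p => ((f p)%:C : R[i]^o))).
  by move=> p /set_mem /= hp; rewrite fg.
apply: continuous_subspaceT => p; apply: cvgC_real; exact: cf.
Qed.

Section Solution.
Variables (theta d tau M B : R) (b : nat -> R).
Hypotheses (theta0 : 0 <= theta) (thetaE : theta = (N%:R + d) / 2) (tau0 : 0 <= tau)
  (B0 : 0 <= B) (tauB : tau * B < 1) (hb : gbound M B b).

Let u (t : R) := flow theta (tau * t) b.
Let tin t : 0 <= t <= 1 -> 0 <= tau * t /\ tau * t * B < 1.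
Proof.
move=> /andP[t0 t1]; split; first exact: mulr_ge0.
apply: le_lt_trans tauB; rewrite ler_wpM2r //.
by rewrite ler_piMr.
Qed.

Let M1 := M * (1 - tau * B) `^ (- theta).
Let B1 := B / (1 - tau * B).
Let B10 : 0 <= B1. Proof. by rewrite divr_ge0 // subr_ge0 ltW. Qed.

Let ub t : 0 <= t <= 1 -> gbound M1 B1 (u t).
Proof.
move=> ht k; have [s0 sB] := tin ht; have /andP[t0 t1] := ht.
have /andP[-> _] := flow_gbound theta0 B0 hb s0 sB k.
have /andP[_ h] := flow_gbound theta0 B0 hb tau0 tauB k.
apply: le_trans h; apply: (flow_le _ theta0 B0 hb) => //; first by rewrite ler_piMr.
by move=> j; rewrite lexx andbT; exact: gbound_ge0 hb.
Qed.

Let uc k t : u (clamp 1 s) k @[s --> t] --> u (clamp 1 t) k.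
Proof.
apply: (@flow_cvg_to R R (nbhs t) _ theta M B tau (fun=> b) b
  (fun t => tau * clamp 1 t)) => //.
- near=> s; split=> //; have /andP[s0 s1] := clamp_in ltr01 s.
  by rewrite ger0_norm ?mulr_ge0 // ler_piMr.
- by move=> j; exact: cvg_cst.
- by apply: cvgM; [exact: cvg_cst|exact: clamp_cvg].
Unshelve. all: by end_near. Qed.

Let v0 (t : R) k := (theta + k%:R) * u t k.+1.

(** By k <= 2^k, the weight theta + k of D costs a doubling of the type. *)
Let geometric_weight k : (theta + k%:R) * (M1 * B1 ^+ k.+1) <= (theta + 1) * M1 * B1 * (2 * B1) ^+ k.
Proof.
have k2 : k%:R <= 2 ^+ k :> R by rewrite -natrX ler_nat ltnW // ltn_expl.
have k1 : 1 <= 2 ^+ k :> R by rewrite exprn_ege1 // ler1n.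
have hk : theta + k%:R <= (theta + 1) * 2 ^+ k.
  by rewrite mulrDl mul1r lerD // ler_peMr.
rewrite (_ : _ * (2 * B1) ^+ k = ((theta + 1) * 2 ^+ k) * (M1 * B1 ^+ k.+1)).
  by rewrite ler_wpM2r // mulr_ge0 ?exprn_ge0 // mulr_ge0 ?powR_ge0 // (gbound_M_ge0 hb).
by rewrite exprMn exprS; move: (2 ^+ k) (B1 ^+ k) => y z; ring.
Qed.

Let v0b t : 0 <= t <= 1 -> gbound ((theta + 1) * M1 * B1) (2 * B1) (v0 t).
Proof.
move=> ht k; have /andP[h0 h1] := ub ht k.+1; rewrite /v0 mulr_ge0 ?addr_ge0 //=.
by apply: le_trans (geometric_weight k); rewrite ler_wpM2l // addr_ge0.
Qed.

Let v (t : R) k := tau * v0 t k.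

Let vb t : 0 <= t <= 1 -> gbound (tau * ((theta + 1) * M1 * B1)) (2 * B1) (v t).
Proof.
move=> ht k; have /andP[h0 h1] := v0b ht k; rewrite /v mulr_ge0 //=.
by rewrite -mulrA ler_wpM2l.
Qed.

(** Dominates the difference quotients of the coefficients uniformly in time, for differentiation
    under the sum. *)
Let u_lip k s t : 0 <= s -> s <= t -> t <= 1 ->
  0 <= u t k - u s k <= tau * ((theta + k%:R) * (M1 * B1 ^+ k.+1)) * (t - s).
Proof.
move=> s0 st t1; have t01 : 0 <= t <= 1 by rewrite (le_trans s0 st) t1.
have [tt tB] := tin t01; have tst : tau * s <= tau * t by rewrite ler_wpM2l.
have D (x : R) : tau * s <= x <= tau * t ->
    is_derive x 1 (fun s => flow theta s b k) ((theta + k%:R) * flow theta x b k.+1).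
  move=> /andP[x0 x1]; have x00 : 0 <= x by apply: le_trans x0; rewrite mulr_ge0.
  apply: (flow_derive _ theta0 B0 hb); rewrite ger0_norm //.
  by apply: le_lt_trans tB; rewrite ler_wpM2r.
have db (x : R) : tau * s <= x <= tau * t -> 0 <= flow theta x b k.+1 <= M1 * B1 ^+ k.+1.
  move=> /andP[x0 x1]; have x00 : 0 <= x by apply: le_trans x0; rewrite mulr_ge0.
  have xB : x * B < 1 by apply: le_lt_trans tB; rewrite ler_wpM2r.
  have /andP[-> _] := flow_gbound theta0 B0 hb x00 xB k.+1.
  have /andP[_ h] := flow_gbound theta0 B0 hb tau0 tauB k.+1.
  apply: le_trans h; apply: (flow_le _ theta0 B0 hb) => //.
    by apply: le_trans x1 _; rewrite ler_piMr.
  by move=> j; rewrite lexx andbT; exact: gbound_ge0 hb.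
have k0 : 0 <= theta + k%:R by rewrite addr_ge0.
apply/andP; split.
  rewrite subr_ge0; apply: (le_of_derive_ge0 tst D) => x hx.
  by have /andP[h _] := db x hx; rewrite mulr_ge0.
pose c := (theta + k%:R) * (M1 * B1 ^+ k.+1).
have := @le_of_derive_ge0 R (fun y : R => c * y - flow theta y b k)
  (fun y : R => c - (theta + k%:R) * flow theta y b k.+1) (tau * s) (tau * t) tst.
rewrite /u -/c => h.
have {}h : c * (tau * s) - flow theta (tau * s) b k <= c * (tau * t) - flow theta (tau * t) b k.
  apply: h => x hx; last by rewrite subr_ge0 /c ler_wpM2l //; have /andP[] := db x hx.
  have d1 : is_derive x 1 (fun y : R => c * y) c.
    exact: is_derive_mull.
  exact: is_deriveB d1 (D x hx).
by rewrite mulrBr ![tau * c * _]mulrAC ![_ * c]mulrC; lra.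
Qed.

Let u_lip_abs k s t : 0 <= s <= 1 -> 0 <= t <= 1 ->
  `|u s k - u t k| <= tau * ((theta + k%:R) * (M1 * B1 ^+ k.+1)) * `|s - t|.
Proof.
move=> /andP[s0 s1] /andP[t0 t1]; have [st|/ltW ts] := leP s t.
  have /andP[h1 h2] := u_lip k s0 st t1.
  by rewrite distrC ger0_norm // [`|s - t|]distrC ger0_norm // subr_ge0.
have /andP[h1 h2] := u_lip k t0 ts s1.
by rewrite ger0_norm // ger0_norm // subr_ge0.
Qed.

Let u_derive k t : 0 <= t <= 1 ->
  (s - t)^-1 * (u s k - u t k) @[s --> within `[0, 1]%classic (t^')] --> v t k.
Proof.
move=> ht; have [tt tB] := tin ht.
have d1 : is_derive t 1 (fun s : R => tau * s) tau.
  exact: is_derive_mull.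
have d2 : is_derive (tau * t) 1 (fun s => flow theta s b k) ((theta + k%:R) * flow theta (tau * t) b k.+1).
  by apply: (flow_derive _ theta0 B0 hb); rewrite ger0_norm.
have d3 : is_derive t 1 (fun s => u s k) (v t k).
  by have := is_derive1_comp d2 d1; rewrite mulrC.
exact: cvg_within_filter (derive_quotient d3).
Qed.

Let egf_u_derive z t : 0 <= z -> 0 <= t <= 1 ->
  (s - t)^-1 * (egf (u s) z - egf (u t) z) @[s --> within `[0, 1]%classic (t^')]
    --> egf (v t) z.
Proof.
move=> z0 ht.
have N1 : \forall s \near within `[0, 1]%classic (t^'), 0 <= s <= 1.
  by apply: filterS (withinT _ _) => s; rewrite /= in_itv.
have N2 : \forall s \near within `[0, 1]%classic (t^'), s != t.
  exact: (cvg_within _ (nbhs_dnbhs_neq t)).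
have h : limn (series (fun k => (s - t)^-1 * (u s k - u t k) / k`!%:R * z ^+ k))
   @[s --> within `[0, 1]%classic (t^')] --> egf (v t) z.
  apply: (@tannery_filter R R _ _ _ _
     (fun k => tau * ((theta + 1) * M1 * B1) * exp_coeff (2 * B1 * z) k)).
  - exact: cvg_exp_bound.
  - near=> s => k; have hs : 0 <= s <= 1 by near: s.
    have st : 0 < `|s - t| by rewrite normr_gt0 subr_eq0; near: s.
    rewrite 2!normrM [`|_^-1|]ger0_norm ?invr_ge0 // [`|z ^+ k|]ger0_norm ?exprn_ge0 //.
    rewrite /exp_coeff /= exprMn.
    rewrite (_ : tau * ((theta + 1) * M1 * B1) * ((2 * B1) ^+ k * z ^+ k / k`!%:R) =
      tau * (((theta + 1) * M1 * B1) * (2 * B1) ^+ k) / k`!%:R * z ^+ k); last by ring.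
    rewrite ler_wpM2r ?exprn_ge0 // ler_wpM2r ?invr_ge0 //.
    rewrite normrM normfV mulrC ler_pdivrMr //.
    apply: le_trans (u_lip_abs k hs ht) _; rewrite ler_wpM2r // ler_wpM2l //.
  - by move=> k; have := egf_term_le z k (vb ht); rewrite [`|z|]ger0_norm.
  - move=> k; apply: cvgM; last exact: cvg_cst.
    by apply: cvgM; [exact: u_derive|exact: cvg_cst].
apply: cvg_trans h; apply: near_eq_cvg.
near=> s; have hs : 0 <= s <= 1 by near: s.
have c1 := cvg_egf (z := z) (ub hs); have c2 := cvg_egf (z := z) (ub ht).
rewrite /egf -(lim_seriesB c1 c2) -(limn_seriesZ _ (is_cvg_seriesB c1 c2)).
congr (limn (series _)); apply/funext => k /=.
by rewrite -mulrBl -mulrBl !mulrA.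
Unshelve. all: by end_near. Qed.

Lemma radial_flow_solution : is_solution (N := N) d tau (fun t => radial (flow theta (tau * t) b)).
Proof.
split.
- by move=> t /ub; exact: radial_analytic.
- by exists B1, M1 => t /ub ht; exact: wnorm_radial_le ht _.
- apply: (@within_slab_continuous (fun p => egf (u (clamp 1 p.1)) (dotp p.2 p.2))).
    apply: (@egf_family_continuous M1 B1 (fun t => u (clamp 1 t))) => // t.
    by apply: ub; exact: clamp_in ltr01 _.
  by move=> p hp; rewrite clampK.
exists (fun t => radial (v t)); split.
- apply: (@within_slab_continuous (fun p => egf (v (clamp 1 p.1)) (dotp p.2 p.2))).
    apply: (@egf_family_continuous _ _ (fun t => v (clamp 1 t)) _ (fun t => vb (clamp_in ltr01 t))) => //.
      by rewrite mulr_ge0.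
    move=> k t; apply: cvgM; first exact: cvg_cst.
    by apply: cvgM; [exact: cvg_cst|exact: uc].
  by move=> p hp; rewrite clampK.
- move=> t x ht; rewrite /is_time_derive.
  rewrite (_ : (fun s : R => _) = fun s =>
     ((s - t)^-1 * (egf (u s) (dotp x x) - egf (u t) (dotp x x)))%:C).
    by apply: cvgC_real; apply: egf_u_derive => //; exact: dotp_ge0.
  by apply/funext => s; rewrite /radial -(rmorphB (real_complex R)) -(rmorphM (real_complex R)).
- move=> t x ht x0; have hu := ub ht.
  rewrite (laplacian_radial _ hu) (euler_radial _ hu) -!(rmorphM (real_complex R)) -(rmorphD (real_complex R)) -(rmorphM (real_complex R)) /radial.
  congr (_%:C); rewrite /v (egf_scale _ _ (v0b ht)) (egf_heat _ _ hu) thetaE.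
  have : dotp x x != 0 by rewrite dotp_eq0.
  move: (dotp x x) (egf _ _) (egf _ _) (N%:R : R) => z e1 e2 n z0.
  by field.
Qed.

End Solution.

End RadialHeatSolution.

(** * Uniqueness *)

Section LineDerivatives.
Variable R : realType.
Implicit Types (C : nat -> R) (r M : R).

Lemma near0_lt r : 0 < r -> \forall s \near (0 : R), `|s| < r.
Proof.
move=> r0; apply/nbhs_ballP; exists r => //= s.
by rewrite /ball /= sub0r normrN.
Qed.

Lemma derive_le0_right (q : R -> R) (l : R) : is_derive (0 : R) 1 q l ->
  (\forall s \near (0 : R)^'+, q s <= q 0) -> l <= 0.
Proof.
move=> /is_derive1_caratheodory[g [gE gc <-]] hq; rewrite leNgt; apply/negP => g0.
near ((0 : R)^'+) => s.
have s0 : 0 < s by near: s; exact: nbhs_right_gt.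
have gs : 0 < g s.
  by near: s; exact: (cvg_within _ (cvgr_gt (g 0) gc 0 g0)).
have : q s <= q 0 by near: s.
by rewrite -subr_le0 gE subr0 leNgt mulr_gt0.
Unshelve. all: by end_near. Qed.

(** If q2 > 0, then q1 > 0 just to the right of 0, and the mean value theorem lifts q above its
    maximum. *)
Lemma second_order_max (q q1 : R -> R) (q2 r : R) : 0 < r ->
  (forall s : R, `|s| < r -> is_derive s 1 q (q1 s)) -> is_derive (0 : R) 1 q1 q2 ->
  (forall s, `|s| < r -> q s <= q 0) -> q1 0 = 0 /\ q2 <= 0.
Proof.
move=> r0 dq dq1 hq; have d0 : is_derive (0 : R) 1 q (q1 0) by apply: dq; rewrite normr0.
have near_r : \forall s \near (0 : R)^'+, `|s| < r.
  by apply: (cvg_within _ (near0_lt r0)).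
have q10 : q1 0 = 0.
  apply/eqP; rewrite eq_le; apply/andP; split.
    by apply: (derive_le0_right d0); apply: filterS near_r => s; exact: hq.
  rewrite -oppr_le0; apply: (@derive_le0_right (q \o -%R)); last first.
    by apply: filterS near_r => s sr /=; rewrite oppr0; apply: hq; rewrite normrN.
  have dn : is_derive (0 : R) 1 -%R (-1).
    exact: (is_deriveN (is_derive_id (0 : R) 1)).
  have d0' : is_derive (- (0 : R)) 1 q (q1 0) by rewrite oppr0.
  by apply: (is_derive_eq (is_derive1_comp d0' dn)); rewrite mulrN1.
split=> //; rewrite leNgt; apply/negP => q20.
have /is_derive1_caratheodory[g [gE gc g0]] := dq1.
have hg : \forall s \near (0 : R), 0 < g s by apply: (cvgr_gt (g 0) gc); rewrite g0.
have /nbhs_ballP[e /= e0 he] := hg.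
pose m := Num.min (e / 2) (r / 2).
have m0 : 0 < m by rewrite lt_min !divr_gt0.
have me : m < e by rewrite gt_min; apply/orP; left; rewrite ltr_pdivrMr //; lra.
have mr : m < r by rewrite gt_min; apply/orP; right; rewrite ltr_pdivrMr //; lra.
have pos (s : R) : 0 < s < e -> 0 < q1 s.
  move=> /andP[s0 se]; have := gE s; rewrite q10 !subr0 => ->; rewrite mulr_gt0 //.
  by apply: he; rewrite /ball /= sub0r normrN gtr0_norm.
have dm (s : R) : 0 <= s <= m -> is_derive s 1 q (q1 s).
  by move=> /andP[s0 sm]; apply: dq; rewrite ger0_norm //; apply: le_lt_trans mr.
have [|s|c] := MVT m0 (df := q1) (f := q).
- by move=> s; rewrite in_itv /= => /andP[s0 s1]; apply: dm; rewrite !ltW.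
- apply: derivable_within_continuous => w; rewrite in_itv /= => hw.
  by have [] := dm w hw.
rewrite in_itv /= => /andP[c0 cm] E.
have : 0 < q m - q 0.
  by rewrite E subr0 mulr_gt0 // pos // c0 /=; apply: lt_trans cm me.
by rewrite subr_gt0 ltNge hq // gtr0_norm.
Qed.

Definition geom_bounded M r C := forall l, `|C l| <= M / r ^+ l.

(** Halving the radius absorbs the factor l + 1 of differentiation. *)
Lemma geom_bounded_diffs M r C : 0 < r -> geom_bounded M r C ->
  geom_bounded (M / r) (r / 2) (pseries_diffs C).
Proof.
move=> r0 hC l; rewrite /pseries_diffs normrM normr_nat.
have M0 : 0 <= M by have := hC 0%N; rewrite expr0 divr1; apply: le_trans.
have k2 : l.+1%:R <= 2 ^+ l :> R by rewrite -natrX ler_nat ltn_expl.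
apply: (@le_trans _ _ (2 ^+ l * (M / r ^+ l.+1))); first by rewrite ler_pM.
rewrite expr_div_n exprS !invfM invrK.
by move: (2 ^+ l) ((r ^+ l)^-1) r^-1 => y z w; rewrite le_eqVlt; apply/orP; left; apply/eqP; ring.
Qed.

Lemma geom_bounded_cvg M r C (s : R) : 0 < r -> geom_bounded M r C -> `|s| < r ->
  cvgn (pseries C s).
Proof.
move=> r0 hC sr; apply: (@series_dominated R _ (fun l => M * (`|s| / r) ^+ l)).
  by apply: cvg_geometric_pos; rewrite divr_ge0 ?(ltW r0) //= ltr_pdivrMr // mul1r.
move=> l; rewrite normrM normrX expr_div_n [leRHS]mulrCA mulrC.
by rewrite ler_wpM2l ?exprn_ge0.
Qed.

Lemma geom_bounded_derive M r C (s : R) : 0 < r -> geom_bounded M r C -> `|s| < r / 4 ->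
  is_derive s 1 (fun s => limn (pseries C s)) (limn (pseries (pseries_diffs C) s)).
Proof.
move=> r0 hC sr; have h1 := geom_bounded_diffs r0 hC.
have r20 : 0 < r / 2 by rewrite divr_gt0.
have h2 := geom_bounded_diffs r20 h1.
have K0 : 0 <= (`|s| + r / 4) / 2 by rewrite divr_ge0 // addr_ge0 // divr_ge0 ?ltW.
apply: (@pseries_snd_diffs R C ((`|s| + r / 4) / 2)).
- by apply: (geom_bounded_cvg r0 hC); rewrite ger0_norm //; lra.
- by apply: (geom_bounded_cvg r20 h1); rewrite ger0_norm //; lra.
- by apply: (geom_bounded_cvg _ h2); rewrite ?divr_gt0 // ger0_norm //; lra.
- by rewrite [X in _ < X]ger0_norm //; lra.
Qed.

Lemma pseries_at0 C : limn (pseries C 0) = C 0%N.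
Proof.
apply: (cvg_lim (@Rhausdorff R)).
have := @series_finite R (fun l => C l * 0 ^+ l) 1; rewrite big_ord1 expr0 mulr1; apply.
by case=> // l _; rewrite exprS mul0r mulr0.
Qed.

(** * Analytic functions on coordinate lines and planes *)

Section DoubleSeries.
Variables (a : nat -> nat -> R) (M r : R).
Hypotheses (r0 : 0 < r)
  (aM : forall n, \sum_(m < n) \sum_(l < n) `|a m l| * r ^+ (m + l) <= M).

(** The coefficient of t^l in the double series sum of a m l s^m t^l, at fixed s. *)
Definition slice_coef (s : R) l := limn (series (fun m => a m l * s ^+ m)).

Let partial_le l n : series (fun m => `|a m l| * r ^+ m) n <= M / r ^+ l.
Proof.
rewrite ler_pdivlMr ?exprn_gt0 // /series /= big_mkord mulr_suml.
pose n' := (maxn n l.+1); apply: le_trans (aM n').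
apply: (@le_trans _ _ (\sum_(m < n) \sum_(l' < n') `|a m l'| * r ^+ (m + l'))).
  apply: ler_sum => m _; have ll : (l < n')%N by rewrite /n' leq_max ltnSn orbT.
  rewrite (bigD1 (Ordinal ll)) //= exprD mulrA lerDl; apply: sumr_ge0 => k _.
  by rewrite mulr_ge0 // exprn_ge0 // ltW.
rewrite -(big_mkord xpredT (fun m => \sum_(l' < n') `|a m l'| * r ^+ (m + l'))).
rewrite -[leRHS](big_mkord xpredT (fun m => \sum_(l' < n') `|a m l'| * r ^+ (m + l'))).
rewrite [leRHS](@big_cat_nat _ _ _ n) ?leq_maxl //= lerDl.
by apply: sumr_ge0 => m _; apply: sumr_ge0 => k _; rewrite mulr_ge0 // exprn_ge0 // ltW.
Qed.

Let abs_cvg l : cvgn (series (fun m => `|a m l| * r ^+ m)).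
Proof.
apply: nondecreasing_is_cvgn; last by exists (M / r ^+ l) => _ [n _ <-]; exact: partial_le.
by apply: nondecreasing_series => m _; rewrite mulr_ge0 // exprn_ge0 // ltW.
Qed.

Let term_le (s : R) l m : `|s| < r -> `|a m l * s ^+ m| <= `|a m l| * r ^+ m.
Proof. by move=> /ltW sr; rewrite normrM normrX ler_wpM2l // lerXn2r // nnegrE ltW. Qed.

Lemma slice_coef_bound s : `|s| < r -> geom_bounded M r (slice_coef s).
Proof.
move=> sr l; rewrite /slice_coef; have h := series_norm_le (@abs_cvg l) (fun m => term_le l m sr).
apply: le_trans h _.
by apply: limr_le (@abs_cvg l) _; near=> n; exact: partial_le.
Unshelve. all: by end_near. Qed.

Lemma slice_coef_cvg l : slice_coef s l @[s --> (0 : R)] --> slice_coef 0 l.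
Proof.
apply: (@tannery_filter R R (nbhs (0 : R)) _ (fun s m => a m l * s ^+ m) (fun m => a m l * 0 ^+ m)
  (fun m => `|a m l| * r ^+ m) (@abs_cvg l)).
- have h : \forall s \near (0 : R), `|s| < r.
    exact: near0_lt.
  by apply: filterS h => s sr m; exact: term_le.
- by move=> m; apply: term_le; rewrite normr0.
- by move=> m; apply: cvgM; [exact: cvg_cst|exact: exprn_continuous].
Qed.

Lemma slice_sum (s t F : R) : `|s| < r -> `|t| < r ->
  \sum_(m < n.+1) \sum_(l < n.+1) a m l * (s ^+ m * t ^+ l) @[n --> \oo] --> F ->
  F = limn (pseries (slice_coef s) t).
Proof.
move=> sr tr hF.
pose f n l := if (l < n.+1)%N then t ^+ l * series (fun m => a m l * s ^+ m) n.+1 else 0.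
have E n : \sum_(m < n.+1) \sum_(l < n.+1) a m l * (s ^+ m * t ^+ l) = limn (series (f n)).
  apply/esym/(cvg_lim (@Rhausdorff R)).
  have -> : \sum_(m < n.+1) \sum_(l < n.+1) a m l * (s ^+ m * t ^+ l) = \sum_(l < n.+1) f n l.
    rewrite exchange_big /=; apply: eq_bigr => l _; rewrite /f ltn_ord /series /= big_mkord.
    by rewrite mulr_sumr; apply: eq_bigr => m _; ring.
  by apply: series_finite => l; rewrite leqNgt /f => /negbTE ->.
apply: (cvg_unique _ hF) => //.
rewrite /= (eq_cvg _ _ E).
have M0 : 0 <= M by have := aM 0; rewrite big_ord0.
apply: (@tannery R nat \oo _ f _ (fun l => M * (`|t| / r) ^+ l)).
- by apply: cvg_geometric_pos; rewrite divr_ge0 ?(ltW r0) //= ltr_pdivrMr // mul1r.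
- near=> n => l; rewrite /f; case: ifP => _; last first.
    by rewrite normr0 mulr_ge0 // exprn_ge0 // divr_ge0 // ltW.
  rewrite normrM normrX expr_div_n mulrCA ler_wpM2l ?exprn_ge0 //.
  apply: le_trans (partial_le l n.+1); rewrite /series /= (le_trans (ler_norm_sum _ _ _)) //.
  by apply: ler_sum => m _; exact: term_le.
- move=> l; rewrite /= mulrC; apply: (@cvg_trans _ ((t ^+ l * series (fun m => a m l * s ^+ m) n.+1) @[n --> \oo])).
    apply: near_eq_cvg; near=> n; rewrite /f ifT //.
    by near: n; exists l => // n /= ln; rewrite ltnS.
  apply: cvgM; first exact: cvg_cst.
  rewrite (cvg_shiftS (series (fun m => a m l * s ^+ m))).
  by apply: series_dominated (@abs_cvg l) _ => m; exact: term_le.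
Unshelve. all: by end_near. Qed.

End DoubleSeries.

Section RealAnalytic.
Variable N : nat.
Implicit Types (f : 'rV[R]_N -> R) (x : 'rV[R]_N) (i j : 'I_N).

Definition ranalytic f := forall x, exists (r M : R) (c : {ffun 'I_N -> nat} -> R),
  let coef n (k : {ffun 'I_N -> 'I_n}) := c [ffun i => nat_of_ord (k i)] in
  [/\ 0 < r,
      (forall n, \sum_(k : {ffun 'I_N -> 'I_n})
         `|coef n k| * r ^+ (\sum_(i < N) k i)%N <= M) &
      forall h : 'rV[R]_N, (forall i, `|h ord0 i| < r) ->
        \sum_(k : {ffun 'I_N -> 'I_n}) coef n k * \prod_(i < N) h ord0 i ^+ k i @[n --> \oo]
        --> f (x + h)].

(** On the plane of the axes i and j only multi-indices supported there survive. If i = j, the plane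
    is the line of [t], and the terms with m != 0 are set to 0 so as not to count a multi-index
    twice. *)
Lemma box_slice (c : {ffun 'I_N -> nat} -> R) i j n (h : 'I_N -> R) (s t : R) :
  (forall q, h q = if q == j then t else if q == i then s else 0) ->
  \sum_(k : {ffun 'I_N -> 'I_n.+1}) c [ffun i => nat_of_ord (k i)] * \prod_q h q ^+ k q =
  \sum_(m < n.+1) \sum_(l < n.+1)
    (if (i == j) && (m != 0%N :> nat) then 0
     else c [ffun q => if q == j then nat_of_ord l else if q == i then nat_of_ord m else 0%N])
    * (s ^+ m * t ^+ l).
Proof.
move=> hE.
(* [kk] parametrizes the multi-indices that satisfy [D], those vanishing off i and j. *)
pose kk (p : 'I_n.+1 * 'I_n.+1) : {ffun 'I_N -> 'I_n.+1} :=
  [ffun q => if q == j then p.2 else if q == i then p.1 else ord0].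
pose D (k : {ffun 'I_N -> 'I_n.+1}) := [forall q, (q != j) && (q != i) ==> (k q == ord0)].
rewrite (bigID D) /= [X in _ + X]big1 => [|k]; last first.
  rewrite negb_forall => /existsP[q]; rewrite negb_imply => /andP[/andP[qj qi] kq].
  have kq0 : (k q == 0%N :> nat) = false by exact: negbTE kq.
  by rewrite (bigD1 q) //= hE (negbTE qj) (negbTE qi) expr0n kq0 mul0r mulr0.
rewrite addr0 (reindex_onto kk (fun k => (if i == j then ord0 else k i, k j))) /=; last first.
  move=> k /forallP Dk; apply/ffunP => q; rewrite ffunE /=.
  have [->//|qj] := eqVneq q j; have [qi|qi] := eqVneq q i.
    by rewrite -qi (negbTE qj).
  by have := Dk q; rewrite qj qi => /eqP.
rewrite pair_big /= [RHS](eq_bigr (fun p : 'I_n.+1 * 'I_n.+1 => if (i == j) && (p.1 != 0%N :> nat) then 0 else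
    c [ffun q => if q == j then nat_of_ord p.2 else if q == i then nat_of_ord p.1 else 0%N]
    * (s ^+ p.1 * t ^+ p.2))); last by move=> p _; case: ifP => _ //; rewrite mul0r.
under [RHS]eq_bigr do rewrite -if_neg.
rewrite -big_mkcond /=; apply: eq_big => [[m l]|[m l] /andP[_ hp]] /=.
  have -> : D (kk (m, l)).
    by apply/forallP => q; apply/implyP => /andP[qj qi]; rewrite ffunE (negbTE qj) (negbTE qi).
  rewrite /kk !ffunE eqxx xpair_eqE /= !eqxx andbT.
  by have [ij|ij] := eqVneq i j; rewrite ?eqxx //= negbK eq_sym.
congr (c _ * _).
  by apply/ffunP => q; rewrite !ffunE /=; case: ifP => // _; case: ifP.
have P q : h q ^+ kk (m, l) q = if q == j then t ^+ l else if q == i then s ^+ m else 1.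
  by rewrite hE ffunE; case: (q == j) => //; case: (q == i).
rewrite (eq_bigr _ (fun q _ => P q)) (bigD1 j) //= eqxx.
have [ij|ij] := eqVneq i j.
  rewrite big1 => [|q qj]; last by rewrite ij (negbTE qj).
  by move: hp; rewrite ij eqxx => /eqP[<- _]; rewrite mulrC.
rewrite (bigD1 i) //= (negbTE ij) eqxx big1 => [|q /andP[qj qi]]; last first.
  by rewrite (negbTE qj) (negbTE qi).
by rewrite mulr1 mulrC.
Qed.

(** One statement for lines and planes: the factor [(i != j)%:R] suppresses the displacement s when
    the two axes coincide. *)
Lemma ranalytic_slice f x i j : ranalytic f ->
  exists (r M : R) (C : R -> nat -> R),
  [/\ 0 < r, forall s, `|s| < r -> geom_bounded M r (C s),
      forall s t, `|s| < r -> `|t| < r ->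
        f (t *: delta_mx ord0 j + ((s * (i != j)%:R) *: delta_mx ord0 i + x)) = limn (pseries (C s) t) &
      forall l, C s l @[s --> (0 : R)] --> C 0 l].
Proof.
move=> /(_ x)[r [M [c [r0 cM cf]]]].
pose a m l := if (i == j) && (m != 0%N) then 0
     else c [ffun q => if q == j then l else if q == i then m else 0%N].
have aM n : \sum_(m < n) \sum_(l < n) `|a m l| * r ^+ (m + l) <= M.
  case: n => [|n]; first by have := cM 0%N; rewrite big_ord0; apply: le_trans; apply: sumr_ge0 => k _; rewrite mulr_ge0 // exprn_ge0 // ltW.
  apply: le_trans (cM n.+1).
  have := @box_slice (fun k => `|c k|) i j n (fun q => if q == j then r else if q == i then r else 0) r r (fun=> erefl).
  rewrite (_ : \sum_(m < n.+1) _ = \sum_(m < n.+1) \sum_(l < n.+1) `|a m l| * r ^+ (m + l)); last first.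
    apply: eq_bigr => m _; apply: eq_bigr => l _; rewrite exprD /a.
    by case: ifP; rewrite ?normr0.
  move=> <-; apply: ler_sum => k _; rewrite ler_wpM2l // expr_sum; apply: ler_prod => q _.
  have /andP[h0 hr] : 0 <= (if q == j then r else if q == i then r else 0) <= r.
    by case: (q == j); [|case: (q == i)]; rewrite ?lexx ?(ltW r0).
  by rewrite exprn_ge0 // lerXn2r // nnegrE ltW.
exists r, M, (slice_coef a); split => //.
- exact: slice_coef_bound.
- move=> s t sr tr; apply: (slice_sum r0 aM sr tr).
  set h := t *: delta_mx ord0 j + (s * (i != j)%:R) *: delta_mx ord0 i : 'rV_N.
  have hE q : h ord0 q = if q == j then t else if q == i then s else 0.
    rewrite !mxE eqxx /=; have [->|qj] := eqVneq q j.
      by rewrite eq_sym; case: eqVneq => _; rewrite ?mulr0 ?mul0r ?addr0 mulr1.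
    rewrite mulr0 add0r; have [qi|qi] := eqVneq q i; last by rewrite mulr0.
    by rewrite -qi qj !mulr1.
  rewrite addrA addrC -/h.
  have hr q : `|h ord0 q| < r by rewrite hE; do 2!case: ifP => // _; rewrite normr0.
  move/cf: hr; rewrite -cvg_shiftS /=.
  by under eq_fun do rewrite (box_slice _ _ hE).
- by move=> l; exact: (@slice_coef_cvg a M r r0 aM l).
Qed.

Lemma is_derive_line f x (v : 'rV[R]_N) (s l : R) :
  is_derive s 1 (fun t : R => f (t *: v + x)) l <-> is_derive (s *: v + x) v f l.
Proof.
have E : (fun h : R => h^-1 *: (((fun t : R => f (t *: v + x)) \o shift s) (h *: 1) - f (s *: v + x))) =
  (fun h : R => h^-1 *: ((f \o shift (s *: v + x)) (h *: v) - f (s *: v + x))).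
  by apply/funext => h /=; rewrite [h%:A]mulr1 scalerDl addrA.
by split=> -[h1 h2]; apply: DeriveDef; move: h1 h2; rewrite /derivable /derive ?E -?E.
Qed.

Lemma line_derive_local f x (v : 'rV[R]_N) (G : R -> R) (l rho s : R) : `|s| < rho ->
  (forall t, `|t| < rho -> f (t *: v + x) = G t) -> is_derive s 1 G l ->
  is_derive (s *: v + x) v f l.
Proof.
move=> srho fG dG; apply/is_derive_line; apply: near_eq_is_derive dG.
have c : `|t| @[t --> s] --> `|s| by apply: cvg_norm; exact: cvg_id.
have : \forall t \near s, `|t| < rho by move: c => /cvgr_lt; apply.
by apply: filterS => t /fG ->.
Qed.

Section PowerSeriesLine.
Variables (f : 'rV[R]_N -> R) (x v : 'rV[R]_N) (r M : R) (C : nat -> R).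
Hypotheses (r0 : 0 < r) (hC : geom_bounded M r C)
  (fC : forall t : R, `|t| < r -> f (t *: v + x) = limn (pseries C t)).

Lemma series_line_derive (s : R) : `|s| < r / 4 ->
  is_derive (s *: v + x) v f (limn (pseries (pseries_diffs C) s)).
Proof.
move=> sr; apply: (line_derive_local _ fC); last exact: geom_bounded_derive hC _.
by apply: lt_trans sr _; have := r0; lra.
Qed.

Lemma series_line_derive2 (s : R) : `|s| < r / 8 ->
  is_derive (s *: v + x) v ('D_v f) (limn (pseries (pseries_diffs (pseries_diffs C)) s)).
Proof.
move=> sr; apply: (@line_derive_local _ _ _ (fun t => limn (pseries (pseries_diffs C) t)) _ (r / 4)).
- by apply: lt_trans sr _; have := r0; lra.
- by move=> t tr; have [_ ->] := series_line_derive tr.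
- apply: (geom_bounded_derive _ (geom_bounded_diffs r0 hC)); first by have := r0; lra.
  by apply: lt_le_trans sr _; have := r0; lra.
Qed.

End PowerSeriesLine.

Lemma ranalytic_derive f x j : ranalytic f -> is_derive x (delta_mx ord0 j) f ('D_(delta_mx ord0 j) f x).
Proof.
move=> /(ranalytic_slice x j j)[r [M [C [r0 hC fC _]]]].
have n0 : `|0 : R| < r by rewrite normr0.
have fC0 t : `|t| < r -> f (t *: delta_mx ord0 j + x) = limn (pseries (C 0) t).
  by move=> tr; rewrite -(fC 0 t n0 tr) mul0r scale0r add0r.
have n4 : `|0 : R| < r / 4 by rewrite normr0 divr_gt0.
have := series_line_derive r0 (hC 0 n0) fC0 n4.
by rewrite scale0r add0r => h; have [_ ->] := h.
Qed.

Lemma ranalytic_derive2 f x j : ranalytic f ->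
  is_derive x (delta_mx ord0 j) ('D_(delta_mx ord0 j) f)
    ('D_(delta_mx ord0 j) ('D_(delta_mx ord0 j) f) x).
Proof.
move=> /(ranalytic_slice x j j)[r [M [C [r0 hC fC _]]]].
have n0 : `|0 : R| < r by rewrite normr0.
have fC0 t : `|t| < r -> f (t *: delta_mx ord0 j + x) = limn (pseries (C 0) t).
  by move=> tr; rewrite -(fC 0 t n0 tr) mul0r scale0r add0r.
have n8 : `|0 : R| < r / 8 by rewrite normr0 divr_gt0.
have := series_line_derive2 r0 (hC 0 n0) fC0 n8.
by rewrite scale0r add0r => h; have [_ ->] := h.
Qed.

(** Used to let x tend to 0 along an axis in the singular equation. For i != j the derivative at s
    is twice the slice coefficient of t^2; for i = j it is a power series in s. *)
Lemma ranalytic_derive2_cvg f x i j : ranalytic f ->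
  'D_(delta_mx ord0 j) ('D_(delta_mx ord0 j) f) (s *: delta_mx ord0 i + x) @[s --> (0 : R)]
  --> 'D_(delta_mx ord0 j) ('D_(delta_mx ord0 j) f) x.
Proof.
move=> /(ranalytic_slice x i j)[r [M [C [r0 hC fC cC]]]].
have n0 : `|0 : R| < r by rewrite normr0.
have r80 : 0 < r / 8 by rewrite divr_gt0.
have n8 : `|0 : R| < r / 8 by rewrite normr0.
have [ij|ij] := eqVneq i j.
  have fC0 t : `|t| < r -> f (t *: delta_mx ord0 j + x) = limn (pseries (C 0) t).
    by move=> tr; rewrite -(fC 0 t n0 tr) mul0r scale0r add0r.
  have D2 (s : R) : `|s| < r / 8 -> 'D_(delta_mx ord0 j) ('D_(delta_mx ord0 j) f) (s *: delta_mx ord0 j + x) =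
      limn (pseries (pseries_diffs (pseries_diffs (C 0))) s).
    by move=> sr; have [_ ->] := series_line_derive2 r0 (hC 0 n0) fC0 sr.
  have -> : 'D_(delta_mx ord0 j) ('D_(delta_mx ord0 j) f) x =
      limn (pseries (pseries_diffs (pseries_diffs (C 0))) 0).
    by have := D2 0 n8; rewrite scale0r add0r.
  have h2 := geom_bounded_diffs (divr_gt0 r0 (ltr0n R 2)) (geom_bounded_diffs r0 (hC 0 n0)).
  have r20 : 0 < r / 2 / 2 by rewrite !divr_gt0.
  have s0 : `|0 : R| < r / 2 / 2 / 4 by rewrite normr0 !divr_gt0.
  have [dG _] := geom_bounded_derive r20 h2 s0.
  move/derivable1_diffP/differentiable_continuous: dG.
  rewrite /continuous_at; apply: cvg_trans; apply: near_eq_cvg; near=> s.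
  have sr : `|s| < r / 8 by near: s; exact: near0_lt.
  by rewrite ij (D2 s sr).
have D2 (s : R) : `|s| < r -> 'D_(delta_mx ord0 j) ('D_(delta_mx ord0 j) f) (s *: delta_mx ord0 i + x) =
    2 * C s 2%N.
  move=> sr; have fCs t : `|t| < r -> f (t *: delta_mx ord0 j + (s *: delta_mx ord0 i + x)) = limn (pseries (C s) t).
    by move=> tr; rewrite -(fC s t sr tr) ij mulr1.
  have := series_line_derive2 r0 (hC s sr) fCs n8.
  rewrite scale0r add0r => -[_ ->]; rewrite pseries_at0 /pseries_diffs.
  by rewrite mul1r.
have -> : 'D_(delta_mx ord0 j) ('D_(delta_mx ord0 j) f) x = 2 * C 0 2%N.
  by have := D2 0 n0; rewrite scale0r add0r.
have c2 : 2 * C s 2%N @[s --> (0 : R)] --> 2 * C 0 2%N.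
  by apply: cvgM; [exact: cvg_cst|exact: cC].
apply: cvg_trans c2; apply: near_eq_cvg; near=> s; have sr : `|s| < r by near: s; exact: near0_lt.
by rewrite (D2 s sr).
Unshelve. all: by end_near. Qed.

End RealAnalytic.

End LineDerivatives.

(** * The maximum principle with a Gaussian barrier *)

Section MaximumPrinciple.
Variables (R : realType) (N : nat).
Implicit Types (x y : 'rV[R]_N) (i j : 'I_N) (f : 'rV[R]_N -> R).

(** The barrier at a fixed time. It is the radial function with coefficients C beta^k, which
    provides its derivatives. *)
Definition gaussian (C beta : R) x := C * expR (beta * dotp x x).

Section Gaussian.
Variables (C beta : R).
Hypotheses (C0 : 0 <= C) (beta0 : 0 <= beta).

Let b k := C * beta ^+ k.
Let hb : gbound C beta b.
Proof. by move=> k; rewrite lexx andbT mulr_ge0 // exprn_ge0. Qed.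
Let bS : eshift b = fun k => (C * beta) * beta ^+ k.
Proof. by apply/funext => k; rewrite /eshift /b exprS mulrA. Qed.
Let bSS : eshift (eshift b) = fun k => (C * beta * beta) * beta ^+ k.
Proof. by apply/funext => k; rewrite bS /eshift exprS !mulrA. Qed.

Lemma gaussian_derive x i :
  is_derive x (delta_mx ord0 i) (gaussian C beta) (2 * x ord0 i * beta * gaussian C beta x).
Proof.
have := egf_line_derive x i hb; rewrite bS egf_geometric => h.
have /is_derive_line : is_derive (0 : R) 1 (fun s : R => gaussian C beta (s *: delta_mx ord0 i + x))
    (2 * x ord0 i * (C * beta * expR (beta * dotp x x))).
  by under eq_fun do rewrite /gaussian -egf_geometric.
rewrite scale0r add0r => h'; apply: is_derive_eq; rewrite /gaussian.
by move: (expR _) => e; ring.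
Qed.

Lemma gaussian_derive2 x i :
  is_derive x (delta_mx ord0 i) (fun y => 2 * y ord0 i * beta * gaussian C beta y)
    ((2 * beta + 4 * x ord0 i ^+ 2 * beta ^+ 2) * gaussian C beta x).
Proof.
have := egf_line_derive2 x i (eshift_gbound hb); rewrite bSS bS !egf_geometric => h.
pose G y := 2 * y ord0 i * beta * gaussian C beta y.
have GE : (fun s : R => G (s *: delta_mx ord0 i + x)) =
   (fun s : R => 2 * (s *: delta_mx ord0 i + x) ord0 i *
       egf (fun k : nat => C * beta * beta ^+ k)
         (dotp (s *: delta_mx ord0 i + x) (s *: delta_mx ord0 i + x))).
  apply/funext => s; rewrite egf_geometric /G /gaussian.
  by move: (expR _) (_ ord0 i) => e y; ring.
have h2 : is_derive (0 : R) 1 (fun s : R => G (s *: delta_mx ord0 i + x))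
    ((2 * beta + 4 * x ord0 i ^+ 2 * beta ^+ 2) * gaussian C beta x).
  rewrite GE; apply: (is_derive_eq h); rewrite /gaussian.
  by move: (expR _) => e; ring.
have := proj1 (@is_derive_line R N G x (delta_mx ord0 i) 0 _) h2.
by rewrite scale0r add0r.
Qed.

End Gaussian.

Lemma space_maximum f C beta x : 0 <= C -> 0 <= beta -> ranalytic f ->
  (forall y, f y - gaussian C beta y <= f x - gaussian C beta x) ->
  forall i, 'D_(delta_mx ord0 i) f x = 2 * x ord0 i * beta * gaussian C beta x /\
    'D_(delta_mx ord0 i) ('D_(delta_mx ord0 i) f) x <=
      (2 * beta + 4 * x ord0 i ^+ 2 * beta ^+ 2) * gaussian C beta x.
Proof.
move=> C0 beta0 fa hmax i; set e := delta_mx ord0 i.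
pose q (s : R) := f (s *: e + x) - gaussian C beta (s *: e + x).
pose q1 (s : R) := 'D_e f (s *: e + x) - 2 * (s *: e + x) ord0 i * beta * gaussian C beta (s *: e + x).
pose q2 := 'D_e ('D_e f) x - (2 * beta + 4 * x ord0 i ^+ 2 * beta ^+ 2) * gaussian C beta x.
have [|s _||s _|] := @second_order_max R q q1 q2 1.
- exact: ltr01.
- apply: is_deriveB; apply/is_derive_line; first exact: ranalytic_derive.
  exact: gaussian_derive.
- have h1 : is_derive (0 : R) 1 (fun s : R => 'D_e f (s *: e + x)) ('D_e ('D_e f) x).
    apply/(@is_derive_line R N ('D_e f) x e 0); rewrite scale0r add0r.
    exact: ranalytic_derive2.
  have h2 : is_derive (0 : R) 1 (fun s : R => 2 * (s *: e + x) ord0 i * beta * gaussian C beta (s *: e + x))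
      ((2 * beta + 4 * x ord0 i ^+ 2 * beta ^+ 2) * gaussian C beta x).
    apply/(@is_derive_line R N (fun y => 2 * y ord0 i * beta * gaussian C beta y) x e 0); rewrite scale0r add0r.
    exact: gaussian_derive2.
  exact: is_deriveB h1 h2.
- by rewrite /q scale0r add0r.
by rewrite /q1 /q2 scale0r add0r => /eqP; rewrite subr_eq0 => /eqP -> ; rewrite subr_le0.
Qed.

Section HeatInequality.
Variables (d tau : R) (f v : 'rV[R]_N -> R).
Hypotheses (N0 : (0 < N)%N) (dN : - N%:R <= d) (tau0 : 0 <= tau) (fa : ranalytic f)
  (v0 : forall i, v (s *: delta_mx ord0 i) @[s --> (0 : R)] --> v 0)
  (pde : forall x, x != 0 -> v x = tau / 4 *
     (\sum_i 'D_(delta_mx ord0 i) ('D_(delta_mx ord0 i) f) x +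
      d / dotp x x * \sum_i x ord0 i * 'D_(delta_mx ord0 i) f x)).

Let trace x := \sum_i 'D_(delta_mx ord0 i) ('D_(delta_mx ord0 i) f) x.

Let dotp_e i (s : R) : dotp (s *: delta_mx ord0 i) (s *: delta_mx ord0 i : 'rV[R]_N) = s ^+ 2.
Proof.
have := dotp_line (0 : 'rV[R]_N) i s; rewrite addr0 => ->.
by rewrite mxE mulr0 mul0r addr0 (eqP (_ : dotp 0 0 == 0)) ?add0r // dotp_eq0.
Qed.

(** On the i-th axis the drift is d times the i-th derivative at s divided by s, a difference
    quotient because the gradient vanishes at 0. *)
Let at_origin i : 'D_(delta_mx ord0 i) f 0 = 0 ->
  v 0 = tau / 4 * (trace 0 + d * 'D_(delta_mx ord0 i) ('D_(delta_mx ord0 i) f) 0).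
Proof.
move=> f0; set e : 'rV[R]_N := delta_mx ord0 i.
have h1 : v (s *: e) @[s --> (0 : R)^'] --> v 0.
  exact: cvg_within_filter (@v0 i).
have h2 : tau / 4 * (trace (s *: e) + d * (s^-1 * 'D_e f (s *: e))) @[s --> (0 : R)^'] -->
    tau / 4 * (trace 0 + d * 'D_e ('D_e f) 0).
  apply: cvgM; first exact: cvg_cst.
  apply: cvgD.
    apply: cvg_sum_seq => j.
    apply: cvg_within_filter; apply: cvg_trans (@ranalytic_derive2_cvg R N f 0 i j fa).
    by apply: near_eq_cvg; near=> s; rewrite addr0.
  apply: cvgM; first exact: cvg_cst.
  have h := @ranalytic_derive2 R N f 0 i fa.
  have h' : is_derive (0 : R) 1 (fun s : R => 'D_e f (s *: e + 0)) ('D_e ('D_e f) 0).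
    by apply/(@is_derive_line R N ('D_e f) 0 e 0); rewrite scale0r add0r.
  have := derive_quotient h'; rewrite scale0r addr0 f0.
  by under eq_fun do rewrite subr0 subr0 addr0.
apply: (cvg_unique _ h1) => //.
apply: cvg_trans h2; apply: near_eq_cvg; near=> s.
have s0 : s != 0 by near: s; exact: nbhs_dnbhs_neq.
have es0 : s *: e != 0 by rewrite -dotp_eq0 dotp_e expf_neq0.
rewrite pde // dotp_e; congr (_ * (_ + _)).
rewrite (bigD1 i) //= big1 => [|j ji]; last by rewrite !mxE (negbTE ji) andbF mulr0 mul0r.
rewrite addr0 !mxE !eqxx mulr1 -/e; field.
exact: s0.
Unshelve. all: by end_near. Qed.

(** The right side is the heat operator applied to the Gaussian: at a maximum of f minus the
    Gaussian the gradients agree and the pure second derivatives of f are no larger. *)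
Lemma heat_at_maximum C beta x : 0 <= C -> 0 <= beta ->
  (forall y, f y - gaussian C beta y <= f x - gaussian C beta x) ->
  v x <= tau * ((N%:R + d) / 2 * beta + beta ^+ 2 * dotp x x) * gaussian C beta x.
Proof.
move=> C0 b0 hmax; have hm := space_maximum C0 b0 fa hmax.
have t4 : 0 <= tau / 4 by rewrite divr_ge0.
have g0 : 0 <= gaussian C beta x by rewrite mulr_ge0 // expR_ge0.
have trle : trace x <= (2 * N%:R * beta + 4 * dotp x x * beta ^+ 2) * gaussian C beta x.
  apply: (@le_trans _ _ (\sum_i (2 * beta + 4 * x ord0 i ^+ 2 * beta ^+ 2) * gaussian C beta x)).
    by apply: ler_sum => i _; have [_] := hm i.
  rewrite -mulr_suml ler_wpM2r // big_split /= sumr_const card_ord -mulr_suml -mulr_sumr.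
  rewrite -[_ *+ N]mulr_natl (_ : \sum_(i < N) x ord0 i ^+ 2 = dotp x x); last first.
    by apply: eq_bigr => i _; rewrite expr2.
  by rewrite [N%:R * _]mulrCA mulrA.
have [x0|x0] := eqVneq x 0; last first.
  have z0 : dotp x x != 0 by rewrite dotp_eq0.
  have eu : \sum_i x ord0 i * 'D_(delta_mx ord0 i) f x = 2 * dotp x x * beta * gaussian C beta x.
    rewrite /dotp mulr_sumr !mulr_suml; apply: eq_bigr => i _; have [-> _] := hm i.
    by move: (gaussian _ _ _) => g; ring.
  rewrite pde // eu -/(trace x).
  apply: (@le_trans _ _ (tau / 4 * ((2 * N%:R * beta + 4 * dotp x x * beta ^+ 2) * gaussian C beta x +
     d / dotp x x * (2 * dotp x x * beta * gaussian C beta x)))).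
    by rewrite ler_wpM2l // lerD2r.
  rewrite le_eqVlt; apply/orP; left; apply/eqP; field.
  exact: z0.
have z0 : dotp x x = 0 by apply/eqP; rewrite dotp_eq0 x0.
have df0 i : 'D_(delta_mx ord0 i) f 0 = 0.
  by have [+ _] := hm i; rewrite x0 mxE mulr0 !mul0r.
have Nn : (N%:R : R) != 0 by rewrite pnatr_eq0 -lt0n.
have Nv : N%:R * v 0 = tau / 4 * ((N%:R + d) * trace 0).
  have <- : \sum_(i < N) v 0 = N%:R * v 0 by rewrite sumr_const card_ord mulr_natl.
  rewrite (eq_bigr _ (fun i _ => at_origin (df0 i))).
  rewrite -mulr_sumr big_split /= sumr_const card_ord -mulr_sumr -/(trace 0).
  by rewrite mulrDl mulr_natl.
have -> : v x = tau / 4 * (N%:R + d) / N%:R * trace 0.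
  rewrite x0; apply: (mulfI Nn); rewrite Nv; field.
  exact: Nn.
have Np : 0 < (N%:R : R) by rewrite ltr0n.
have c0 : 0 <= tau / 4 * (N%:R + d) / N%:R.
  have Nd : 0 <= N%:R + d by have := dN; rewrite -subr_ge0 opprK addrC.
  by rewrite divr_ge0 ?ler0n // mulr_ge0.
move: trle; rewrite x0 => trle; apply: le_trans (ler_wpM2l c0 trle) _.
rewrite -x0 z0; rewrite le_eqVlt; apply/orP; left; apply/eqP; field.
exact: Nn.
Qed.

End HeatInequality.

(** Only earlier times are compared, so t = 1, where the derivative is one-sided, is covered. *)
Lemma time_maximum (q : R -> R) (t l vt : R) (w : R -> R) :
  0 < t <= 1 -> is_derive t 1 q l ->
  (s - t)^-1 * (w s - w t) @[s --> within `[0, 1]%classic (t^')] --> vt ->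
  (\forall s \near t^'-, w s - q s <= w t - q t) -> l <= vt.
Proof.
move=> /andP[t0 t1] dq dw hmax.
have left (P : set R) : (\forall s \near t^', P s) -> \forall s \near t^'-, P s.
  move=> hP; have {}hP : nbhs t (fun s => s != t -> P s) := hP.
  by apply: filterS hP => s Ps st; apply: Ps; rewrite lt_eqF.
have h1 : (s - t)^-1 * (q s - q t) @[s --> t^'-] --> l.
  by apply: cvg_trans (derive_quotient dq) => P /= hP; exact: left.
have h2 : (s - t)^-1 * (w s - w t) @[s --> t^'-] --> vt.
  apply: cvg_trans dw => P /= hP.
  suff : \forall s \near t^'-, P ((s - t)^-1 * (w s - w t)) by [].
  near=> s.
  suff : 0 <= s <= 1 -> P ((s - t)^-1 * (w s - w t)).
    apply; apply/andP; split; first by apply: ltW; near: s; exact: nbhs_left_gt.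
    by apply: le_trans t1; apply: ltW; near: s; exact: nbhs_left_lt.
  near: s; apply: left.
  have {}hP : \forall s \near t^', `[0, 1]%classic s -> P ((s - t)^-1 * (w s - w t)) := hP.
  by apply: filterS hP => s hs s01; apply: hs; rewrite /= in_itv.
apply: (ler_cvg_to h1 h2); near=> s.
have st : s < t by near: s; exact: nbhs_left_lt.
rewrite ler_nM2l ?invr_lt0 ?subr_lt0 //.
suff : w s - q s <= w t - q t by lra.
by near: s.
Unshelve. all: by end_near. Qed.

Section ShortTime.
Variables (d tau b K : R) (w v : R -> 'rV[R]_N -> R).
Hypotheses (N0 : (0 < N)%N) (dN : - N%:R <= d) (tau0 : 0 <= tau)
  (wa : forall t, 0 <= t <= 1 -> ranalytic (w t))
  (wb : forall t x, 0 <= t <= 1 -> w t x <= K * expR (b * dotp x x))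
  (wc : {within [set p : R * 'rV[R]_N | 0 <= p.1 <= 1], continuous (fun p => w p.1 p.2)})
  (vc : forall t i, 0 <= t <= 1 -> v t (s *: delta_mx ord0 i) @[s --> (0 : R)] --> v t 0)
  (dw : forall t x, 0 <= t <= 1 ->
     (s - t)^-1 * (w s x - w t x) @[s --> within `[0, 1]%classic (t^')] --> v t x)
  (pde : forall t x, 0 <= t <= 1 -> x != 0 -> v t x = tau / 4 *
     (\sum_i 'D_(delta_mx ord0 i) ('D_(delta_mx ord0 i) (w t)) x +
      d / dotp x x * \sum_i x ord0 i * 'D_(delta_mx ord0 i) (w t) x)).

Let theta := (N%:R + d) / 2.
(** The barrier is eps exp(gam (t - t0)) exp(beta(t) (x,x)) with beta growing from B to 2 B in time
    h. The slope B/h = 4 tau B^2 + B beats tau beta^2, and gam beats tau theta beta by 1, so it is a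
    strict supersolution; B > b makes it outgrow w at infinity. *)
Let B := `|b| + 1.
Let h := (4 * tau * B + 1)^-1.
Let gam := 2 * tau * theta * B + 1.

Let B0 : 0 < B. Proof. by rewrite /B ltr_wpDl. Qed.
Let theta0 : 0 <= theta. Proof. by rewrite /theta divr_ge0 //; have := dN; rewrite -subr_ge0 opprK addrC. Qed.
Let D0 : 0 < 4 * tau * B + 1.
Proof. by rewrite ltr_wpDl // mulr_ge0 ?mulr_ge0 // ltW. Qed.
Let h0 : 0 < h. Proof. by rewrite invr_gt0. Qed.
Let gam0 : 0 < gam.
Proof. by rewrite ltr_wpDl // mulr_ge0 ?(ltW B0) // mulr_ge0 // mulr_ge0. Qed.

Let beta t0 t := B + B / h * (t - t0).
Let amp eps t0 t := eps * expR (gam * (t - t0)).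

Let barrier_derive eps t0 x (t : R) :
  is_derive t 1 (fun s => gaussian (amp eps t0 s) (beta t0 s) x)
    ((B / h * dotp x x + gam) * gaussian (amp eps t0 t) (beta t0 t) x).
Proof.
pose u (s : R) := (B - B / h * t0) * dotp x x - gam * t0 + (B / h * dotp x x + gam) * s.
have E : (fun s => gaussian (amp eps t0 s) (beta t0 s) x) = (fun s => eps * expR (u s)).
  apply/funext => s; rewrite /gaussian /amp /beta -mulrA -expRD; congr (_ * expR _).
  by rewrite /u; move: (dotp x x) (B / h) => z y; ring.
have du : is_derive t 1 u (B / h * dotp x x + gam).
  apply: (is_derive_eq (is_deriveD (is_derive_cst _ t 1) (is_derive_mull _ t))).
  by rewrite add0r.
rewrite E (_ : gaussian _ _ _ = eps * expR (u t)); last by have := congr1 (@^~ t) E.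
apply: (is_derive_eq (is_deriveZ eps (is_derive1_comp (is_derive_expR (u t)) du))).
rewrite /GRing.scale /=; move: (expR _) => e; ring.
Qed.

Let short_time t0 t1 : 0 <= t0 -> t1 <= 1 -> t0 <= t1 -> t1 <= t0 + h ->
  (forall x, w t0 x <= 0) -> forall x, w t1 x <= 0.
Proof.
move=> t00 t11 t01 t1h w0 x1; rewrite leNgt; apply/negP => w1.
pose P eps t x := gaussian (amp eps t0 t) (beta t0 t) x.
have P1 t x : 0 < P 1 t x by rewrite /P /gaussian /amp mul1r mulr_gt0 ?expR_gt0.
(* The barrier then takes half the value of w at (t1, x1), where w exceeds it. *)
pose eps := w t1 x1 / (2 * P 1 t1 x1).
have eps0 : 0 < eps by rewrite divr_gt0 // mulr_gt0.
have PE t x : P eps t x = eps * P 1 t x by rewrite /P /gaussian /amp mul1r mulrA.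
have P0 t x : 0 < P eps t x by rewrite PE mulr_gt0.
have m1 : 0 < w t1 x1 - P eps t1 x1.
  rewrite PE /eps -mulrA invfM -!mulrA mulVf ?gt_eqF // mulr1; lra.
(* Outside the cube of half-side [rho], eps exp((x,x)) >= |K|, so the barrier lies above the growth
   bound on w and the maximum is attained inside. *)
pose rho := `|K| / eps + 1.
have K0 : 0 <= `|K| / eps by rewrite divr_ge0 // ltW.
have far t x i : t0 <= t <= t1 -> rho < `|x ord0 i| -> w t x - P eps t x <= 0.
  move=> /andP[tt0 tt1] hx.
  have t01' : 0 <= t <= 1 by rewrite (le_trans t00 tt0) (le_trans tt1 t11).
  have z0 := dotp_ge0 x.
  have zr : `|K| / eps <= dotp x x.
    apply: (@le_trans _ _ (x ord0 i ^+ 2)).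
      rewrite -real_normK ?num_real // expr2.
      have h1 : 1 <= `|x ord0 i| by apply: le_trans (ltW hx); rewrite /rho lerDr.
      apply: (@le_trans _ _ `|x ord0 i|); last by rewrite ler_peMr.
      by apply: le_trans (ltW hx); rewrite /rho lerDl.
    rewrite /dotp (bigD1 i) //= expr2 lerDl; apply: sumr_ge0 => k _.
    by rewrite -expr2 sqr_ge0.
  rewrite subr_le0; apply: le_trans (wb x t01') _.
  have Kle : K <= eps * expR (dotp x x).
    apply: (le_trans (ler_norm K)); rewrite mulrC -ler_pdivrMr //; apply: le_trans zr _.
    by apply: le_trans (expR_ge1Dx _); rewrite lerDr.
  apply: (@le_trans _ _ (eps * expR (dotp x x) * expR (b * dotp x x))).
    by rewrite ler_wpM2r // expR_ge0.
  rewrite (_ : P eps t x = eps * (expR (gam * (t - t0)) * expR (beta t0 t * dotp x x))); last first.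
    by rewrite mulrA.
  rewrite -mulrA -!expRD; apply: ler_wpM2l; first exact: ltW.
  rewrite ler_expR.
  have Bb : b + 1 <= beta t0 t.
    rewrite /beta; have := ler_norm b; have : 0 <= B / h * (t - t0).
      by rewrite mulr_ge0 ?subr_ge0 // divr_ge0 // ltW.
    by rewrite /B; lra.
  have : (b + 1) * dotp x x <= beta t0 t * dotp x x by rewrite ler_wpM2r.
  have : 0 <= gam * (t - t0) by rewrite mulr_ge0 ?subr_ge0 // ltW.
  by rewrite mulrDl mul1r; lra.
pose cube : set 'rV[R]_N := [set x | forall i, `[- rho, rho]%classic (x ord0 i)].
pose box : set (R * 'rV[R]_N) := `[t0, t1]%classic `*` cube.
have x1c : cube x1.
  move=> i; rewrite /= in_itv /= -ler_norml leNgt; apply/negP => /(far t1 x1 i).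
  by rewrite t01 lexx => /(_ isT); rewrite leNgt m1.
have box_compact : compact box.
  apply: compact_setX; first exact: segment_compact.
  by apply: (@rV_compact R N (fun=> `[- rho, rho]%classic)) => i; exact: segment_compact.
have boxne : box !=set0 by exists (t1, x1); split=> //=; rewrite in_itv /= t01 lexx.
have mc : {within box, continuous (fun p : R * 'rV[R]_N => w p.1 p.2 - P eps p.1 p.2)}.
  have cP : continuous (fun p : R * 'rV[R]_N => P eps p.1 p.2).
    move=> p; have c1 : q.1 - t0 @[q --> p] --> p.1 - t0 by apply: cvgB; [exact: cvg_fst|exact: cvg_cst].
    have c2 : dotp q.2 q.2 @[q --> p] --> dotp p.2 p.2.
      apply: (@cvg_comp _ _ _ snd (fun x => dotp x x)); first exact: cvg_snd.
      exact: dotp_continuous.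
    apply: cvgM.
      apply: cvgM; first exact: cvg_cst.
      apply: (@cvg_comp _ _ _ (fun q : R * 'rV[R]_N => gam * (q.1 - t0)) expR); last exact: continuous_expR.
      by apply: cvgM; [exact: cvg_cst|exact: c1].
    apply: (@cvg_comp _ _ _ (fun q : R * 'rV[R]_N => beta t0 q.1 * dotp q.2 q.2) expR); last exact: continuous_expR.
    apply: cvgM; last exact: c2.
    apply: cvgD; first exact: cvg_cst.
    by apply: cvgM; [exact: cvg_cst|exact: c1].
  have cw : {within box, continuous (fun p : R * 'rV[R]_N => w p.1 p.2)}.
    apply: continuous_subspaceW wc => p [/=]; rewrite in_itv /= => /andP[p0 p1] _.
    by rewrite (le_trans t00 p0) (le_trans p1 t11).
  have cP' : {within box, continuous (fun p : R * 'rV[R]_N => P eps p.1 p.2)}.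
    exact: continuous_subspaceT.
  by move=> p; apply: cvgB; [exact: cw|exact: cP'].
have [[ts xs]] := compact_EVT_max boxne box_compact mc.
rewrite inE => -[/=]; rewrite in_itv /= => /andP[ts0 ts1] xsc hmax.
have msp : 0 < w ts xs - P eps ts xs.
  apply: lt_le_trans m1 _; apply: (hmax (t1, x1)).
  by rewrite inE; split=> //=; rewrite in_itv /= t01 lexx.
have gmax t x : t0 <= t <= t1 -> w t x - P eps t x <= w ts xs - P eps ts xs.
  move=> ht; have [xc|nxc] := pselect (cube x).
    by apply: (hmax (t, x)); rewrite inE; split=> //=; rewrite in_itv.
  apply: le_trans (ltW msp).
  have [i hi] : exists i, rho < `|x ord0 i|.
    apply: contrapT => hn; apply: nxc => i; rewrite /= in_itv /= -ler_norml leNgt.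
    by apply/negP => hi; apply: hn; exists i.
  exact: far ht hi.
(* At t0 one has w <= 0 while the barrier is positive. *)
have ts01 : t0 < ts.
  rewrite lt_neqAle ts0 andbT; apply/eqP => tE; move: msp; rewrite -tE.
  by have := w0 xs; have := P0 t0 xs; lra.
have hts : 0 <= ts <= 1 by rewrite (le_trans t00 ts0) (le_trans ts1 t11).
have th : 0 <= ts - t0 by rewrite subr_ge0.
have th1 : ts - t0 <= h by lra.
have be1 : B <= beta t0 ts by rewrite /beta lerDl mulr_ge0 // divr_ge0 // ltW.
have be2 : beta t0 ts <= 2 * B.
  have : B / h * (ts - t0) <= B.
    by rewrite -mulrA ler_piMr ?(ltW B0) // mulrC ler_pdivrMr ?mul1r.
  by rewrite /beta; lra.
have U : v ts xs <= tau * (theta * beta t0 ts + beta t0 ts ^+ 2 * dotp xs xs) * P eps ts xs.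
  apply: (heat_at_maximum N0 dN tau0 (wa hts) (fun i => vc i hts) (fun x => pde hts)).
  - by rewrite mulr_ge0 ?expR_ge0 // ltW.
  - by apply: le_trans be1; exact: ltW.
  - by move=> y; apply: gmax; rewrite ts0 ts1.
have Lw : (B / h * dotp xs xs + gam) * P eps ts xs <= v ts xs.
  apply: (@time_maximum (fun s => P eps s xs) ts _ _ (fun s => w s xs)).
  - by rewrite (le_lt_trans t00 ts01) (le_trans ts1 t11).
  - exact: barrier_derive.
  - exact: dw.
  - near=> s; apply: gmax; apply/andP; split.
      by apply: ltW; near: s; exact: nbhs_left_gt.
    by apply: le_trans ts1; apply: ltW; near: s; exact: nbhs_left_lt.
(* The time derivative of the barrier would be at most its heat operator, against the choice of [h]
   and [gam]. *)
have := le_trans Lw U; rewrite ler_pM2r //; apply/negP; rewrite -ltNge.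
have z0 := dotp_ge0 xs; move: (dotp xs xs) z0 => z z0.
have e1 : tau * (theta * beta t0 ts) <= 2 * tau * theta * B.
  rewrite [leRHS](_ : _ = tau * (theta * (2 * B))); last by ring.
  by rewrite ler_wpM2l // ler_wpM2l.
have e2 : tau * (beta t0 ts ^+ 2 * z) <= tau * (4 * B ^+ 2 * z).
  rewrite ler_wpM2l // ler_wpM2r //.
  rewrite [leRHS](_ : _ = (2 * B) ^+ 2); last by ring.
  by rewrite lerXn2r // nnegrE ?mulr_ge0 ?(ltW B0) // (le_trans (ltW B0) be1).
have e3 : B / h * z = tau * (4 * B ^+ 2 * z) + B * z.
  by rewrite /h invrK; ring.
have e4 : 0 <= B * z by rewrite mulr_ge0 // ltW.
rewrite mulrDr e3 /gam; lra.
Unshelve. all: by end_near. Qed.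

(** The step length [h] does not depend on t0, so finitely many short steps cover [0, 1]. *)
Lemma maximum_principle : (forall x, w 0 x <= 0) -> forall t x, 0 <= t <= 1 -> w t x <= 0.
Proof.
move=> w0 t x /andP[t0 t1].
have H n : forall s : R, 0 <= s -> s <= 1 -> s <= n%:R * h -> forall y, w s y <= 0.
  elim: n => [|n IH] s s0 s1 sn y.
    have -> : s = 0 by apply/eqP; rewrite eq_le s0 andbT; move: sn; rewrite mul0r.
    exact: w0.
  have [sn'|/ltW sn'] := leP s (n%:R * h); first exact: IH.
  have nh0 : 0 <= n%:R * h by rewrite mulr_ge0 // ltW.
  apply: (short_time nh0 s1 sn') => //.
    by move: sn; rewrite -natr1 mulrDl mul1r.
  by apply: IH => //; apply: le_trans sn' s1.
have [n hn] : exists n : nat, h^-1 <= n%:R.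
  by exists (Num.bound h^-1); apply/ltW/archi_boundP; rewrite invr_ge0 ltW.
apply: (H n) => //; apply: le_trans t1 _.
by rewrite -ler_pdivrMr // mul1r.
Qed.

End ShortTime.

End MaximumPrinciple.

(** * Uniqueness of complex solutions *)

Section Uniqueness.
Variables (R : realType) (N : nat).
Implicit Types (x y : 'rV[R]_N) (i j : 'I_N) (f : 'rV[R]_N -> R) (F : 'rV[R]_N -> R[i]).

Lemma ranalyticB f g : ranalytic f -> ranalytic g -> ranalytic (fun x => f x - g x).
Proof.
move=> fa ga x; have [r1 [M1 [c1 [r10 cM1 cf1]]]] := fa x.
have [r2 [M2 [c2 [r20 cM2 cf2]]]] := ga x.
pose r := Num.min r1 r2.
have rr1 : r <= r1 by rewrite ge_min lexx.
have rr2 : r <= r2 by rewrite ge_min lexx orbT.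
have r0 : 0 < r by rewrite lt_min r10.
exists r, (M1 + M2), (fun k => c1 k - c2 k); split=> // [n|h hr].
  apply: le_trans (lerD (cM1 n) (cM2 n)); rewrite -big_split; apply: ler_sum => k _ /=.
  apply: le_trans (ler_wpM2r _ (ler_normB _ _)) _; first by rewrite exprn_ge0 // ltW.
  by rewrite mulrDl lerD // ler_wpM2l // lerXn2r // nnegrE ltW.
have h1 := cf1 h (fun i => lt_le_trans (hr i) rr1).
have h2 := cf2 h (fun i => lt_le_trans (hr i) rr2).
apply: cvg_trans (cvgB h1 h2); apply: near_eq_cvg; near=> n.
by rewrite -[LHS]sumrB; apply: eq_bigr => k _; rewrite mulrBl.
Unshelve. all: by end_near. Qed.

Lemma slab_line_cvg (T : topologicalType) (g : R * 'rV[R]_N -> T) (t : R) i :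
  {within [set p : R * 'rV[R]_N | 0 <= p.1 <= 1], continuous g} -> 0 <= t <= 1 ->
  g (t, s *: delta_mx ord0 i) @[s --> (0 : R)] --> g (t, 0).
Proof.
move=> /subspace_continuousP h ht P /(h (t, 0) ht) hP.
have c : (t, s *: delta_mx ord0 i : 'rV[R]_N) @[s --> (0 : R)] --> (t, 0 : 'rV[R]_N).
  have c2 : s *: delta_mx ord0 i @[s --> (0 : R)] --> (0 : 'rV[R]_N).
    by have := @scalel_continuous R 'rV[R]_N (delta_mx ord0 i) 0; rewrite /continuous_at scale0r.
  exact: (cvg_pair (cvg_cst t) c2).
have {}hP : nbhs (t, 0 : 'rV[R]_N) (fun p => 0 <= p.1 <= 1 -> P (g p)) := hP.
have {}hP : \forall s \near (0 : R), 0 <= t <= 1 -> P (g (t, s *: delta_mx ord0 i)) := c _ hP.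
suff : \forall s \near (0 : R), P (g (t, s *: delta_mx ord0 i)) by [].
by apply: filterS hP => s; apply.
Qed.

Lemma drift_linear (k a1 a2 c e1 e2 : R) :
  k * (a1 + c * e1) - k * (a2 + c * e2) = k * ((a1 - a2) + c * (e1 - e2)).
Proof. by ring. Qed.

Section RealComponent.
(* [pr] stands for the real or the imaginary part. *)
Variable pr : R[i] -> R.
Hypotheses (prD : forall z w, pr (z + w) = pr z + pr w) (pr0 : pr 0 = 0)
  (prB : forall z w, pr (z - w) = pr z - pr w)
  (prM : forall (a : R) z, pr (a%:C * z) = a * pr z)
  (pr_le : forall z, `|pr z| <= cmod z)
  (pr_partial : forall i F x, pr (partial i F x) = 'D_(delta_mx ord0 i) (fun y => pr (F y)) x)
  (pr_cvg : forall T (G : set_system T) (FF : Filter G) (f : T -> R[i]) z,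
     (fun q => f q : R[i]^o) @ G --> (z : R[i]^o) -> (fun q => pr (f q)) @ G --> pr z).

Let pr_sum (I : Type) (r : seq I) (F : I -> R[i]) : pr (\sum_(k <- r) F k) = \sum_(k <- r) pr (F k).
Proof. by apply: (big_morph _ prD pr0). Qed.

Lemma analytic_component F : analytic F -> ranalytic (fun x => pr (F x)).
Proof.
move=> Fa x; have [r [M [c [r0 cM cf]]]] := Fa x.
exists r, M, (fun k => pr (c k)); split=> // [n|h /cf hh].
  by apply: le_trans (cM n); apply: ler_sum => k _; rewrite ler_wpM2r // exprn_ge0 // ltW.
apply: cvg_trans (pr_cvg _ hh); apply: near_eq_cvg; near=> n.
by rewrite pr_sum; apply: eq_bigr => k _; rewrite mulrC prM mulrC.
Unshelve. all: by end_near. Qed.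

Let pr_laplacian F x :
  pr (laplacian F x) = \sum_i 'D_(delta_mx ord0 i) ('D_(delta_mx ord0 i) (fun y => pr (F y))) x.
Proof.
rewrite /laplacian pr_sum; apply: eq_bigr => i _; rewrite pr_partial.
by congr ('D_(_) _ x); apply/funext => y; rewrite pr_partial.
Qed.

Let pr_euler F x :
  pr (euler F x) = \sum_i x ord0 i * 'D_(delta_mx ord0 i) (fun y => pr (F y)) x.
Proof. by rewrite /euler pr_sum; apply: eq_bigr => i _; rewrite prM pr_partial. Qed.

Variables (d tau : R).
Hypotheses (N0 : (0 < N)%N) (dN : - N%:R <= d) (tau0 : 0 <= tau).

Let pr_heat F x : pr ((tau / 4)%:C * (laplacian F x + (d / dotp x x)%:C * euler F x)) =
  tau / 4 * (\sum_i 'D_(delta_mx ord0 i) ('D_(delta_mx ord0 i) (fun y => pr (F y))) x +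
    d / dotp x x * \sum_i x ord0 i * 'D_(delta_mx ord0 i) (fun y => pr (F y)) x).
Proof. by rewrite prM prD prM pr_laplacian pr_euler. Qed.

Lemma solution_component_le (u1 u2 : R -> 'rV[R]_N -> R[i]) :
  is_solution d tau u1 -> is_solution d tau u2 -> (forall x, u1 0 x = u2 0 x) ->
  forall t x, 0 <= t <= 1 -> pr (u1 t x) <= pr (u2 t x).
Proof.
move=> [a1 [b1 [K1 wb1]] c1 [v1 [vc1 vd1 pde1]]] [a2 [b2 [K2 wb2]] c2 [v2 [vc2 vd2 pde2]]] u0 t x ht.
pose w t x := pr (u1 t x) - pr (u2 t x).
pose v t x := pr (v1 t x) - pr (v2 t x).
have da t' : 0 <= t' <= 1 -> ranalytic (fun y => pr (u1 t' y)) /\ ranalytic (fun y => pr (u2 t' y)).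
  by move=> ht'; split; apply: analytic_component; [exact: a1|exact: a2].
have dE t' i y : 0 <= t' <= 1 -> 'D_(delta_mx ord0 i) (w t') y =
    'D_(delta_mx ord0 i) (fun y => pr (u1 t' y)) y - 'D_(delta_mx ord0 i) (fun y => pr (u2 t' y)) y.
  move=> /da[r1 r2]; apply: derive_val.
  exact: is_deriveB (ranalytic_derive y i r1) (ranalytic_derive y i r2).
suff : w t x <= 0 by rewrite subr_le0.
apply: (@maximum_principle R N d tau (`|b1| + `|b2|) (`|K1| + `|K2|) w v) => //.
- by move=> t' /da[r1 r2]; exact: ranalyticB.
- move=> t' y ht'.
  have h1 := cmod_le_wnorm y (wb1 _ ht'); have h2 := cmod_le_wnorm y (wb2 _ ht').
  have z0 := dotp_ge0 y; move: (dotp y y) z0 h1 h2 => z z0 h1 h2.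
  have e1 (K b c : R) : 0 <= c -> K * expR (b * z) <= `|K| * expR ((`|b| + c) * z).
    move=> c0; apply: (@le_trans _ _ (`|K| * expR (b * z))).
      by rewrite ler_wpM2r ?expR_ge0 // ler_norm.
    rewrite ler_wpM2l // ler_expR ler_wpM2r //; have := ler_norm b; lra.
  have := e1 K1 b1 _ (normr_ge0 b2); have := e1 K2 b2 _ (normr_ge0 b1).
  rewrite [`|b2| + _]addrC mulrDl /w; have := ler_norm (pr (u1 t' y)).
  have := ler_norm (- pr (u2 t' y)); rewrite normrN.
  have := pr_le (u1 t' y); have := pr_le (u2 t' y); lra.
- by move=> p; apply: cvgB; [apply: pr_cvg; exact: c1|apply: pr_cvg; exact: c2].
- move=> t' i ht'; apply: cvgB; apply: pr_cvg.
    exact: (@slab_line_cvg _ (fun p => (v1 p.1 p.2 : R[i]^o)) t' i vc1 ht').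
  exact: (@slab_line_cvg _ (fun p => (v2 p.1 p.2 : R[i]^o)) t' i vc2 ht').
- move=> t' y ht'; have FF : Filter (within `[0, 1]%classic (t'^')) by exact: within_filter.
  have h1 := pr_cvg FF (vd1 t' y ht'); have h2 := pr_cvg FF (vd2 t' y ht').
  apply: cvg_trans (cvgB h1 h2); apply: near_eq_cvg; near=> s.
  transitivity (pr (((s - t')^-1)%:C * (u1 s y - u1 t' y)) -
    pr (((s - t')^-1)%:C * (u2 s y - u2 t' y))); first by [].
  rewrite !prM !prB -mulrBr /w; congr (_ * _).
  by move: (pr _) (pr _) (pr _) (pr _) => z1 z2 z3 z4; ring.
- move=> t' y ht' y0; rewrite /v (pde1 _ _ ht' y0) (pde2 _ _ ht' y0) !pr_heat.
  have [r1 r2] := da t' ht'.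
  have e1 : \sum_i 'D_(delta_mx ord0 i) ('D_(delta_mx ord0 i) (w t')) y =
     \sum_i 'D_(delta_mx ord0 i) ('D_(delta_mx ord0 i) (fun y => pr (u1 t' y))) y -
     \sum_i 'D_(delta_mx ord0 i) ('D_(delta_mx ord0 i) (fun y => pr (u2 t' y))) y.
    rewrite -sumrB; apply: eq_bigr => i _.
    rewrite (_ : 'D_(delta_mx ord0 i) (w t') = 'D_(delta_mx ord0 i) (fun y => pr (u1 t' y)) -
       'D_(delta_mx ord0 i) (fun y => pr (u2 t' y))); last by apply/funext => z; exact: dE.
    apply: derive_val.
    exact: is_deriveB (ranalytic_derive2 y i r1) (ranalytic_derive2 y i r2).
  have e2 : \sum_i y ord0 i * 'D_(delta_mx ord0 i) (w t') y =
     \sum_i y ord0 i * 'D_(delta_mx ord0 i) (fun y => pr (u1 t' y)) y -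
     \sum_i y ord0 i * 'D_(delta_mx ord0 i) (fun y => pr (u2 t' y)) y.
    by rewrite -sumrB; apply: eq_bigr => i _; rewrite dE // mulrBr.
  exact: etrans (drift_linear _ _ _ _ _ _)
    (esym (congr2 (fun a e => tau / 4 * (a + d / dotp y y * e)) e1 e2)).
- by move=> y; rewrite /w u0 subrr.
Unshelve. all: by end_near. Qed.

End RealComponent.

Lemma solution_unique (d tau : R) (u1 u2 : R -> 'rV[R]_N -> R[i]) : (0 < N)%N ->
  - N%:R <= d -> 0 <= tau ->
  is_solution d tau u1 -> is_solution d tau u2 -> (forall x, u1 0 x = u2 0 x) ->
  forall t x, 0 <= t <= 1 -> u1 t x = u2 t x.
Proof.
move=> N0 dN tau0 s1 s2 u0 t x ht; apply/eqP; rewrite eq_complex.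
have re_le v1 v2 : is_solution d tau v1 -> is_solution d tau v2 ->
    (forall x, v1 0 x = v2 0 x) -> complex.Re (v1 t x) <= complex.Re (v2 t x).
  move=> h1 h2 h0; apply: (@solution_component_le (@complex.Re R) _ _ _ _ _ _ _ d tau N0 dN tau0 v1 v2 h1 h2 h0 t x ht) => //.
  - by move=> [? ?] [? ?].
  - exact: ReB.
  - by move=> a [? ?] /=; rewrite mul0r subr0.
  - exact: Re_le_cmod.
  - by move=> T G FF f z; exact: cvgC_Re.
have im_le v1 v2 : is_solution d tau v1 -> is_solution d tau v2 ->
    (forall x, v1 0 x = v2 0 x) -> complex.Im (v1 t x) <= complex.Im (v2 t x).
  move=> h1 h2 h0; apply: (@solution_component_le (@complex.Im R) _ _ _ _ _ _ _ d tau N0 dN tau0 v1 v2 h1 h2 h0 t x ht) => //.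
  - by move=> [? ?] [? ?].
  - exact: ImB.
  - by move=> a [? ?] /=; rewrite mul0r addr0.
  - exact: Im_le_cmod.
  - by move=> T G FF f z; exact: cvgC_Im.
by rewrite !eq_le !re_le ?im_le.
Qed.

End Uniqueness.

(** * Convergence *)

Section RenormalizationLimit.
Variables (R : realType) (delta : nat) (theta L E : R).
Hypotheses (theta0 : 0 <= theta) (L1 : 1 < L) (E1 : 1 < E)
  (dLE : delta%:R = E ^+ 4 * L ^+ 2) (d1 : (1 < delta)%N).
Variables (g : nat -> R) (T : R).
Hypotheses (T0 : 0 < T) (g0 : g 0%N = 1) (g1 : 0 < g 1%N) (LPg : LP g)
  (gT : etype ((L - 1) / T) g)
  (gdefect : (theta + 1) * defect g <=
     E ^+ 2 * L * ((1 - E^-1) / Xtop L E) * ratio1 g ^+ 2)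
  (nT : ~ exits_below delta theta L E g T T).

Local Notation orb := (rg_orbit delta theta L).
Local Notation st := (rg_start delta L).
Definition normalized tau n :=
  st (orb (fun k => normalizer delta theta L tau g * g k) tau n).
Definition fixed_height tau P :=
  expR (- delta%:R * (- theta * ln (1 - tau * P)) / (delta%:R - 1)).

Let g00 : 0 < g 0%N. Proof. by rewrite g0. Qed.
Let L0 : 0 < L. Proof. exact: lt_trans ltr01 L1. Qed.

(** [P] is the limit of p at the start of a step, after division by L; hence the factor L in the
    hypothesis on the orbit. *)
Let limit_at (tau P : R) : 0 <= tau <= T -> 0 <= P -> tau * P < 1 ->
  (forall n, LP (orb g tau n)) -> ratio1 (orb g tau n) @[n --> \oo] --> P * L ->
  defect (orb g tau n) @[n --> \oo] --> (0 : R) ->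
  (forall k, normalized tau n k @[n --> \oo] --> fixed_height tau P * P ^+ k) /\
  forall B, P < B -> \forall n \near \oo, gbound (fixed_height tau P + 1) B (normalized tau n).
Proof.
move=> ht P0 tP oLP hP hQ; have /andP[t0 tT] := ht.
have pos n : 0 < orb g tau n 0.
  by have [] := orbit_gt0 theta0 L1 E1 dLE T0 g00 g1 gT n ht.
have adm n : exists M B : R, [/\ 0 <= B, tau * B < 1 & gbound M B (st (orb g tau n))].
  have [M [B [B0 TB hB]]] := etype_start_admissible L1 E1 dLE T0 (orbit_etype theta0 L1 E1 dLE T0 gT n ht).
  by exists M, B; split=> //; apply: le_lt_trans TB; rewrite ler_wpM2r.
have hP' : ratio1 (st (orb g tau n)) @[n --> \oo] --> P.
  rewrite -[P](mulfK (lt0r_neq0 L0)).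
  have -> : (fun n => ratio1 (st (orb g tau n))) = (fun n => ratio1 (orb g tau n) / L).
    by apply/funext => n; rewrite (start_ratio1 L1 E1 dLE).
  by apply: cvgM => //; exact: cvg_cst.
have hQ' : defect (st (orb g tau n)) @[n --> \oo] --> (0 : R).
  have -> : (fun n => defect (st (orb g tau n))) = (fun n => defect (orb g tau n) / (E ^+ 4 * L ^+ 4)).
    by apply/funext => n; rewrite (start_defect L1 E1 dLE).
  by rewrite -(mul0r (E ^+ 4 * L ^+ 4)^-1); apply: cvgM => //; exact: cvg_cst.
have sLP n := @LP_start R delta L L1 _ (oLP n).
split=> [k|B PB].
  exact: (@normalized_start_cvg R delta theta L tau g theta0 d1 t0 g0 P pos adm P0 tP hP' hQ' sLP k).
exact: (@normalized_start_gbound R delta theta L tau g theta0 d1 t0 g0 P pos adm P0 tP hP' hQ' sLP B PB).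
Qed.

Lemma renormalization_limit : exists taus : R, 0 < taus <= T /\
  forall tau, 0 <= tau <= taus ->
  let P := if tau < taus then 0 else (L - 1) / (taus * L) in
  (forall k, normalized tau n k @[n --> \oo] --> fixed_height tau P * P ^+ k) /\
  forall B, P < B -> \forall n \near \oo, gbound (fixed_height tau P + 1) B (normalized tau n).
Proof.
have [taus [/andP[ts0 tsT] below band]] := critical_exists theta0 L1 E1 dLE T0 g00 g1 LPg gT gdefect nT.
exists taus; split=> [|tau /andP[t0 tts]]; first by rewrite ts0.
have ht : 0 <= tau <= T by rewrite t0 (le_trans tts).
have [ltau|taule] := ltP tau taus; last first.
  have -> : tau = taus by apply/eqP; rewrite eq_le tts.
  have hts : 0 <= taus <= T by rewrite (ltW ts0).
  apply: limit_at => //.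
  - by rewrite divr_ge0 ?mulr_ge0 ?(ltW ts0) ?(ltW L0) // subr_ge0 ltW.
  - rewrite (_ : taus * ((L - 1) / (taus * L)) = 1 - L^-1).
      by rewrite gtrDl oppr_lt0 invr_gt0.
    by field; rewrite !gt_eqF.
  - exact: (critical_LP theta0 L1 E1 dLE T0 g00 g1 LPg gT ts0 tsT band).
  - rewrite (_ : (L - 1) / (taus * L) * L = (L - 1) / taus); last by field; rewrite !gt_eqF.
    exact: (@critical_ratio1_cvg R delta theta L E theta0 L1 E1 dLE g T T0 g00 g1 LPg gT gdefect taus ts0 tsT band).
  - exact: (@critical_defect_cvg R delta theta L E theta0 L1 E1 dLE g T T0 g00 g1 LPg gT gdefect taus ts0 tsT band).
have tb : exits_below delta theta L E g T tau by apply: below; rewrite t0.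
have [oLP hP] := subcritical_limit theta0 L1 E1 dLE T0 g00 g1 LPg gT ht tb.
apply: limit_at => //; rewrite ?mulr0 ?mul0r //.
(* 0 <= q <= p^2, so p -> 0 suffices. *)
apply: (@squeeze_cvgr _ _ _ _ (fun=> 0) (fun n => ratio1 (orb g tau n) ^+ 2)).
- near=> n; have [p0 p1] := orbit_gt0 theta0 L1 E1 dLE T0 g00 g1 gT n ht.
  have [q0 q1 _ _] := lpineq_LP p0 (oLP n).
  apply/andP; split; first by apply: lpineq_defect_ge0; exact: lpineq_LP.
  by rewrite /defect gerBl divr_ge0 // ltW.
- exact: cvg_cst.
- have -> : (fun n => ratio1 (orb g tau n) ^+ 2) = (fun n => ratio1 (orb g tau n) * ratio1 (orb g tau n)).
    by apply/funext => n; rewrite expr2.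
  by rewrite -[X in _ --> X](mul0r 0); exact: cvgM.
Unshelve. all: by end_near. Qed.

End RenormalizationLimit.

(** * Convergence in the weighted norms *)

Section FlowConvergence.
Variables (R : realType) (N : nat) (theta taus A P K s : R) (G : nat -> nat -> R).
Hypotheses (theta0 : 0 <= theta) (ts0 : 0 < taus) (A0 : 0 <= A) (P0 : 0 <= P)
  (PA : P <= A / (1 + taus * A)) (K0 : 0 <= K) (hs : 0 <= s <= taus)
  (Gcvg : forall k, G n k @[n --> \oo] --> K * P ^+ k)
  (Gb : forall B, P < B -> \forall n \near \oo, gbound (K + 1) B (G n))
  (Ge : forall n, etype A (flow theta s (G n))).

Let s0 : 0 <= s. Proof. by have /andP[] := hs. Qed.
Let sts : s <= taus. Proof. by have /andP[] := hs. Qed.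
Let tA0 : 0 < 1 + taus * A.
Proof. by rewrite ltr_pwDl // mulr_ge0 // ltW. Qed.
Let sP : s * P < 1.
Proof.
apply: (@le_lt_trans _ _ (taus * (A / (1 + taus * A)))); first by rewrite ler_pM.
by rewrite mulrA ltr_pdivrMr // mul1r ltrDr.
Qed.
Let sP0 : 0 < 1 - s * P. Proof. by rewrite subr_gt0. Qed.

Definition limit_coef k := K * (1 - s * P) `^ (- theta) * (P / (1 - s * P)) ^+ k.

Let limit_coefE : limit_coef = flow theta s (fun k => K * P ^+ k).
Proof. by apply/funext => k; rewrite flow_geometric. Qed.

Let C0 : 0 <= K * (1 - s * P) `^ (- theta). Proof. by rewrite mulr_ge0 // powR_ge0. Qed.

Let limit_etype : etype A limit_coef.
Proof.
move=> B AB; exists (K * (1 - s * P) `^ (- theta)).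
have Q0 : 0 <= P / (1 - s * P) by rewrite divr_ge0 // ltW.
apply: (@gbound_weaken _ _ (P / (1 - s * P))) => //; last first.
  by move=> k; rewrite lexx andbT mulr_ge0 // exprn_ge0.
apply: le_trans (ltW AB); rewrite ler_pdivrMr //.
have h1 : P * (1 + taus * A) <= A by rewrite -ler_pdivlMr.
have h2 : s * (P * A) <= taus * (P * A) by rewrite ler_wpM2r // mulr_ge0.
have e1 : P * (1 + taus * A) = P + taus * (P * A) by ring.
have e2 : A * (1 - s * P) = A - s * (P * A) by ring.
rewrite e1 in h1; rewrite e2; lra.
Qed.

(** [A / (1 + taus * A)] is the type which a flow of length taus raises to exactly A, so [PA] gives
    the limit type at most A. *)
Lemma flow_cvg_A : cvg_A A (fun n => radial (N := N) (flow theta s (G n))) (radial limit_coef).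
Proof.
split=> [n||beta Abeta]; [exact: radial_in_A|exact: radial_in_A|].
pose b' := (A + beta) / 2.
have Ab' : A < b' by rewrite /b'; lra.
have b'b : b' < beta by rewrite /b'; lra.
have b'0 : 0 < b' by apply: le_lt_trans Ab'.
have tb0 : 0 < 1 + taus * b' by rewrite addr_gt0 // mulr_gt0.
(* The type raised to b' in time taus: bounds on the data with [B] become bounds with b' < beta
   after the flow. *)
pose B := b' / (1 + taus * b').
have B0 : 0 <= B by rewrite divr_ge0 // ltW.
have PB : P < B.
  apply: (le_lt_trans PA); rewrite ltr_pdivrMr // /B mulrAC ltr_pdivlMr //.
  have : A * b' = b' * A by rewrite mulrC.
  have e1 : A * (1 + taus * b') = A + taus * (A * b') by ring.
  have e2 : b' * (1 + taus * A) = b' + taus * (A * b') by ring.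
  by rewrite e1 e2; lra.
have tB : taus * B < 1 by rewrite /B mulrA ltr_pdivrMr // mul1r ltrDr.
have sB : s * B < 1 by apply: le_lt_trans tB; rewrite ler_wpM2r.
have sB0 : 0 < 1 - s * B by rewrite subr_gt0.
have sBb : B / (1 - s * B) <= b'.
  rewrite ler_pdivrMr // /B ler_pdivrMr //.
  rewrite -mulrA ler_peMr ?(ltW b'0) // mulrBl mul1r -mulrA divfK ?gt_eqF //.
  have : s * b' <= taus * b' by rewrite ler_wpM2r // ltW.
  lra.
have Q0 : 0 <= B / (1 - s * B) by rewrite divr_ge0 // ltW.
have Gc : gbound (K + 1) B (fun k => K * P ^+ k).
  move=> k; rewrite mulr_ge0 ?exprn_ge0 //= ler_pM ?exprn_ge0 //; first by rewrite lerDl.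
  by rewrite lerXn2r ?nnegrE // ltW.
apply: (@wnorm_radial_cvg R N ((K + 1) * (1 - s * B) `^ (- theta)) b' beta) => //.
- exact: ltW.
- near=> n; have hG : gbound (K + 1) B (G n) by near: n; exact: Gb.
  exact: gbound_weaken Q0 sBb (flow_gbound theta0 B0 hG s0 sB).
- by rewrite limit_coefE; exact: gbound_weaken Q0 sBb (flow_gbound theta0 B0 Gc s0 sB).
move=> k; rewrite limit_coefE.
apply: (@flow_cvg_to R nat \oo _ theta (K + 1) B s G _ (fun=> s)) => //; last exact: cvg_cst.
near=> n; split; first by near: n; exact: Gb.
by rewrite ger0_norm.
Unshelve. all: by end_near. Qed.

End FlowConvergence.

(** * The solution sequence in radial form *)

Section SolutionSequence.
Variables (R : realType) (N delta : nat) (theta lambda d tau L E taus : R) (b : nat -> R).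
Hypotheses (N0 : (0 < N)%N) (theta0 : 0 <= theta) (thetaE : theta = (N%:R + d) / 2)
  (L1 : 1 < L) (E1 : 1 < E) (dLE : delta%:R = E ^+ 4 * L ^+ 2)
  (scaleE : (delta%:R `^ (- ((1 + lambda) / 2))) ^+ 2 = (delta%:R * L)^-1)
  (ts0 : 0 < taus) (ht : 0 <= tau <= taus) (bT : etype ((L - 1) / taus) b).

Definition radial_solution n t : 'rV[R]_N -> R[i] :=
  if n is m.+1 then radial (flow theta (tau * t) (rg_start delta L (rg_orbit delta theta L b tau m)))
  else radial b.

Let oT n := orbit_etype theta0 L1 E1 dLE ts0 bT n ht.

Let initial n x : radial (N := N) (rg_start delta L (rg_orbit delta theta L b tau n)) x =
  radial (rg_orbit delta theta L b tau n) ((delta%:R `^ (- ((1 + lambda) / 2))) *: x) ^+ delta.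
Proof.
have A0 : 0 <= (L - 1) / taus by rewrite divr_ge0 ?(ltW ts0) // subr_ge0 ltW.
have [|M hM] := @oT n ((L - 1) / taus + 1); first by rewrite ltrDl.
rewrite /radial /rg_start egf_rescale (egf_cpow _ _ _ hM); last by rewrite addr_ge0.
rewrite rmorphXn; congr ((egf _ _)%:C ^+ _).
rewrite -scaleE /dotp mulr_sumr; apply: eq_bigr => i _; rewrite !mxE.
by move: (_ `^ _) (x ord0 i) => c y; ring.
Qed.

Let end_time n : radial_solution n 1 = radial (rg_orbit delta theta L b tau n).
Proof. by case: n => [//|n]; rewrite /radial_solution mulr1. Qed.

Lemma radial_solutionP : solution_sequence delta lambda d tau (radial b) radial_solution.
Proof.
have /andP[t0 tts] := ht.
split=> // n; split; last by move=> x; rewrite end_time /radial_solution mulr0 flow0 initial.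
have [M [B [B0 TB hB]]] := etype_start_admissible L1 E1 dLE ts0 (oT n).
apply: (radial_flow_solution _ thetaE t0 B0 _ hB) => //.
by apply: le_lt_trans TB; rewrite ler_wpM2r.
Qed.

(** The initial datum of a step depends only on the previous function at time 1, so uniqueness for
    the heat equation propagates by induction. *)
Lemma radial_solution_unique F : solution_sequence delta lambda d tau (radial b) F ->
  F 0%N 1 = radial b /\ forall n t, 0 <= t <= 1 -> F n.+1 t = radial_solution n.+1 t.
Proof.
move=> [F0 Fs]; have [_ Rs] := radial_solutionP; have /andP[t0 tts] := ht.
have F01 : F 0%N 1 = radial b by apply/funext.
have dN : - N%:R <= d.
  have := theta0; rewrite thetaE pmulr_lge0 ?invr_gt0 ?ltr0n //.
  by move=> h; rewrite -subr_ge0 opprK addrC.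
have next n : F n 1 = radial_solution n 1 -> forall t, 0 <= t <= 1 -> F n.+1 t = radial_solution n.+1 t.
  move=> Fn t t01; apply/funext => x; have [s1 i1] := Fs n; have [s2 i2] := Rs n.
  apply: (solution_unique N0 dN t0 s1 s2) => // y.
  by rewrite i1 i2 Fn.
have one : 0 <= (1 : R) <= 1 by rewrite ler01 lexx.
split=> //; elim=> [|n IH]; apply: next => //; exact: IH.
Qed.

Lemma flow_orbit_etype n t : 0 <= t <= 1 -> etype ((L - 1) / taus)
  (flow theta (tau * t) (rg_start delta L (rg_orbit delta theta L b tau n))).
Proof.
move=> /andP[t0 t1]; have /andP[tau0 tts] := ht.
have htt : 0 <= tau * t <= taus by rewrite mulr_ge0 //= (le_trans _ tts) // ler_piMr.
exact: (@etype_step R delta theta L E theta0 L1 E1 dLE taus _ (tau * t) ts0 htt (oT n)).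
Qed.

End SolutionSequence.

Theorem theorem1p4 (R : realType) (lambda : R) (delta N : nat) (d : R)
    (theta := (N%:R + d) / 2)
    (g : R[i] -> R[i]) (alpha : R) (gamma : nat -> R) :
  0 < lambda < 1 / 2 -> (2 <= delta)%N -> (1 <= N)%N -> - N%:R <= d ->
  laguerre_family delta lambda theta g alpha gamma ->
  exists (taustar : R) (C : R -> R),
  let betastar := taustar / (delta%:R `^ lambda - 1) in
  let F0 (tau : R) (x : 'rV[R]_N) := (C tau)%:C * g (dotp x x)%:C in
  [/\ 0 < taustar,
      interval_I delta lambda alpha taustar,
      (forall tau, 0 <= tau <= taustar -> 0 <= C tau),
      (forall tau, 0 <= tau <= taustar ->
         exists F, solution_sequence delta lambda d tau (F0 tau) F) &
      (forall tau F, 0 <= tau < taustar ->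
         solution_sequence delta lambda d tau (F0 tau) F ->
         sequence_cvg betastar^-1 F (fun _ _ => 1)) /\
      (forall F,
         solution_sequence delta lambda d taustar (F0 taustar) F ->
         sequence_cvg betastar^-1 F (F_star delta lambda theta taustar))].
Proof.
move=> /andP[l0 l12] d2 N1 dN [[c [m rep]] g01 gnc hyp _].
have thetaE : theta = (N%:R + d) / 2 by [].
have theta0 : 0 <= theta.
  by rewrite thetaE divr_ge0 //; move: dN; rewrite -subr_ge0 opprK addrC.
move: theta thetaE theta0 hyp => theta thetaE theta0 hyp.
set D : R := delta%:R.
have D1 : 1 < D by rewrite /D ltr1n.
have D0 : 0 < D by apply: lt_trans D1.
pose ell := ln D; have ell0 : 0 < ell by rewrite ln_gt0.
have pw (a : R) : D `^ a = expR (a * ell) by rewrite /powR gt_eqF.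
have DE : D = expR ell by rewrite lnK.
pose eps : R := (1 - 2 * lambda) / 4.
have eps0 : 0 < eps by rewrite divr_gt0 //; lra.
pose L := D `^ lambda; pose E := D `^ eps.
have L1 : 1 < L by rewrite /L pw -expR0 ltr_expR mulr_gt0.
have E1 : 1 < E by rewrite /E pw -expR0 ltr_expR mulr_gt0.
have L0 : 0 < L by apply: lt_trans L1.
have E0 : 0 < E by apply: lt_trans E1.
have dLE : D = E ^+ 4 * L ^+ 2.
  rewrite /E /L !pw -!expRM_natl -expRD {1}DE; congr expR.
  by rewrite /eps; field.
have halfE : D `^ (1 / 2) = E ^+ 2 * L.
  rewrite /E /L !pw -!expRM_natl -expRD; congr expR.
  by rewrite /eps; field.
have EV : D `^ (- eps) = E^-1 by rewrite /E !pw mulNr expRN.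
have LV : D `^ (- lambda) = L^-1 by rewrite /L !pw mulNr expRN.
have scaleE : (D `^ (- ((1 + lambda) / 2))) ^+ 2 = (D * L)^-1.
  rewrite /L !pw -!expRM_natl {1}DE -expRD -expRN; congr expR.
  by field.
have [alpha0 gam_mono cgam _] := rep.
have gam0 j : 0 <= gamma j by have /andP[h1 h2] := gam_mono j; apply: le_trans h2.
pose b := lag_coef alpha gamma.
have b0 : b 0%N = 1 := lag_coef0 alpha gamma.
have b00 : 0 < b 0%N by rewrite b0.
have b1 : 0 < b 1%N := laguerre_rep_nonconstant rep g01 gnc.
have LPb : LP b := lag_coef_LP alpha0 gam0 cgam.
have r1 : ratio1 b = alpha + moment gamma 1 by rewrite /ratio1 b0 divr1 /b lag_coef1.
have r10 : 0 < ratio1 b by rewrite /ratio1 b0 divr1.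
(* The hypothesis on m_2: delta^(1/2) = E^2 L, and vartheta is (1 - E^-1) / Xtop. *)
have bdefect : (theta + 1) * defect b <= E ^+ 2 * L * ((1 - E^-1) / Xtop L E) * ratio1 b ^+ 2.
  have th1 : 0 < theta + 1 by rewrite ltr_wpDl.
  rewrite /b lag_coef_defect // -/b r1 -ler_pdivrMr ?exprn_gt0 -?r1 // r1.
  move: hyp; rewrite /vartheta -/D -/eps -/L EV halfE -/(Xtop L E) => hyp.
  rewrite -[leLHS]mulrA [leLHS]mulrC -ler_pdivlMr //.
  apply: (le_trans hyp).
  by rewrite mulrAC.
have Xtop0 : 0 < Xtop L E by exact: Xtop_gt0.
(* For alpha > 0 this is the right end of I(g), where the type (L - 1)/T is alpha. For alpha = 0 the
   function has type 0, and T is taken so large that x = Xtop + 1 initially. *)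
have [T [T0 bT nT TI]] : exists T, [/\ 0 < T, etype ((L - 1) / T) b,
    ~ exits_below delta theta L E b T T & 0 < alpha -> T = (L - 1) / alpha].
  have [al0|al] := eqVneq alpha 0.
    pose T := (Xtop L E + 1) / ratio1 b.
    have T0 : 0 < T by rewrite divr_gt0 // addr_gt0.
    exists T; split=> //; last by rewrite al0 ltxx.
      move=> B hB; apply: (lag_coef_etype alpha0 gam0 cgam); rewrite al0; apply: le_lt_trans hB.
      by rewrite divr_ge0 ?(ltW T0) // subr_ge0 ltW.
    apply: not_exits_below_large => //.
    by rewrite /T divfK ?gt_eqF // ltrDl.
  have alp : 0 < alpha by rewrite lt_neqAle eq_sym al.
  pose T := (L - 1) / alpha.
  have T0 : 0 < T by rewrite divr_gt0 // subr_gt0.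
  have LT : (L - 1) / T = alpha.
    by rewrite /T invfM invrK mulrA divff ?mul1r // subr_eq0 gt_eqF.
  have bT : etype ((L - 1) / T) b by rewrite LT; exact: lag_coef_etype.
  exists T; split=> //.
  apply: (@not_exits_below_type R delta theta L E theta0 L1 E1 dLE b T T0 b00 b1 LPb bT alpha 1) => // k.
  exact: lag_coef_ge.
have [taus [/andP[ts0 tsT] lim]] := renormalization_limit theta0 L1 E1 dLE d2 T0 b0 b1 LPb bT bdefect nT.
pose A := (L - 1) / taus.
have A0 : 0 < A by rewrite divr_gt0 // subr_gt0.
have AT : (L - 1) / T <= A.
  by rewrite ler_wpM2l ?subr_ge0 ?(ltW L1) // lef_pV2.
have LA : 1 + taus * A = L by rewrite /A; field; rewrite gt_eqF.
pose nz tau := normalizer delta theta L tau b.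
have nz0 tau : 0 < nz tau by exact: normalizer_gt0.
pose bn tau k := nz tau * b k.
have bnA tau : etype A (bn tau).
  move=> B AB; have [M hM] := bT B (le_lt_trans AT AB); exists (nz tau * M) => k.
  have /andP[h1 h2] := hM k; rewrite /bn mulr_ge0 ?(ltW (nz0 _)) //= -mulrA.
  by rewrite ler_wpM2l // ltW.
exists taus, nz => betastar F0.
have F0E tau : F0 tau = radial (bn tau).
  apply/funext => x; rewrite /F0 (laguerre_rep_egf _ rep g01) -rmorphM /radial /bn.
  have [|M hM] := @bT (A + 1); first by apply: le_lt_trans AT _; rewrite ltrDl.
  by rewrite (egf_scale _ _ hM).
have betaE : betastar^-1 = A by rewrite /betastar invf_div.
have limits tau F : 0 <= tau <= taus -> solution_sequence delta lambda d tau (F0 tau) F ->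
  let P := if tau < taus then 0 else (L - 1) / (taus * L) in
  sequence_cvg A F (fun t => radial (limit_coef theta P (fixed_height delta theta tau P) (tau * t))).
  move=> ht; rewrite F0E => hF P; have [limP gbP] := lim tau ht.
  have [F01 FE] := radial_solution_unique N1 theta0 thetaE L1 E1 dLE scaleE ts0 ht (bnA tau) hF.
  have P0 : 0 <= P.
    by rewrite /P; case: ifP => // _; rewrite divr_ge0 ?mulr_ge0 ?subr_ge0 // ltW.
  split; first by rewrite F01; apply: radial_in_A => //; exact: ltW.
  move=> t t01; rewrite (_ : (fun n => F n.+1 t) =
    fun n => radial (flow theta (tau * t) (normalized delta theta L b tau n))); last first.
    by apply/funext => n; rewrite FE.
  have /andP[tau0 tts] := ht; have /andP[t0 t1] := t01.
  apply: (flow_cvg_A N theta0 ts0 (ltW A0) P0) => //.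
  - rewrite LA /A /P; case: ifP => _; last by rewrite invfM mulrA.
    by rewrite !divr_ge0 ?subr_ge0 // ltW.
  - exact: expR_ge0.
  - by rewrite mulr_ge0 //= (le_trans _ tts) // ler_piMr.
  - move=> n; exact: (flow_orbit_etype theta0 L1 E1 dLE ts0 ht (bnA tau) n t01).
split=> //.
- split; first exact: ltW.
  by move=> /TI <-.
- by move=> tau _; exact: ltW.
- move=> tau ht; exists (@radial_solution R N delta theta tau L (bn tau)); rewrite F0E.
  exact: (radial_solutionP theta0 thetaE L1 E1 dLE scaleE ts0 ht (bnA tau)).
rewrite betaE; split=> [tau F /andP[tau0 tts] hF|F hF].
  have ht : 0 <= tau <= taus by rewrite tau0 ltW.
  have := limits tau F ht hF; rewrite tts /=.
  (* With P = 0 both the height and the exponential are 1. *)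
  rewrite (_ : (fun t => _) = (fun _ _ => 1)) //.
  apply/funext => t; apply/funext => x; rewrite /radial /limit_coef egf_geometric.
  rewrite /fixed_height !mulr0 subr0 ln1 !mulr0 mul0r expR0 powR1 !mul1r !mul0r expR0.
  by [].
have ht : 0 <= taus <= taus by rewrite lexx ltW.
have := limits taus F ht hF; rewrite ltxx /=.
rewrite (_ : (fun t => _) = F_star delta lambda theta taus) //.
apply/funext => t; apply/funext => x; rewrite /radial /limit_coef egf_geometric /F_star -/D LV.
(* So 1 - taus P = 1/L, and the height is L^(-delta theta / (delta - 1)), the constant of
   [F_star]. *)
have tP : taus * ((L - 1) / (taus * L)) = 1 - L^-1 by field; rewrite !gt_eqF.
congr (_ %:C); congr (_ * _ * expR _).
- rewrite /fixed_height tP opprB addrC subrK lnV ?posrE // {1}/L pw expRK pw; congr expR.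
  have D10 : D - 1 != 0 by rewrite subr_eq0 gt_eqF.
  by rewrite -/D; field.
- by rewrite -tP; congr (_ `^ _); ring.
- have -> : taus * t * ((L - 1) / (taus * L)) = t * (1 - L^-1) by rewrite -tP; ring.
  rewrite mul1r [taus^-1 * _]mulrA; congr (_ / _ * _).
  by field; rewrite !gt_eqF.
Qed.
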